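(* Let $k$ be an algebraically closed field of characteristic zero. Let $G$ be a finite group, let $V$ be a finite-dimensional purely odd $kG$-module, and let $M$ be a finite-dimensional $V\rtimes G$-supermodule. Then $$|V\rtimes G|_M\cong\{[v]\in V/G : M|_{\langle v\rangle}\text{ is not free}\},$$ where $[v]$ denotes the $G$-orbit of $v\in V$.
   Context: For a superalgebra $A$, $\operatorname{Ext}_A^n(M,-)$ is the $n$-th right derived functor of $\operatorname{Hom}_A(M,-)$ (all even and odd supermodule homomorphisms) from the abelian category of $A$-supermodules with even homomorphisms to superspaces; $\operatorname{H}^\bullet(A,k)=\operatorname{Ext}^\bullet_A(k,k)$. For a Hopf superalgebra $A$ this is a graded-commutative superalgebra: $ab=(-1)^{\overline a\,\overline b+\deg(a)\deg(b)}ba$. For a graded-commutative superalgebra $B$, the nilpotent elements form an ideal $\operatorname{Nil}(B)$, $B/\operatorname{Nil}(B)$ is an ordinary commutative ring, and $\operatorname{Max}(B)$ is its maximal ideal spectrum. For an $A$-supermodule $M$, $I_A(M)$ is the kernel of the ring homomorphism $\operatorname{H}^\bullet(A,k)\to\operatorname{Ext}_A^\bullet(M,M)$, $\alpha\mapsto\alpha\otimes M$, induced by the exact functor $-\otimes M$; and $|A|=\operatorname{Max}(\operatorname{H}^\bullet(A,k))$, $|A|_M=\operatorname{Max}(\operatorname{H}^\bullet(A,k)/I_A(M))\subseteq|A|$. $A=\Lambda(V)\# kG$ is the smash product of the exterior algebra on $V$ (elements of $V$ odd and primitive) with $kG$ (purely even, elements of $G$ group-like), with $gvg^{-1}=g\cdot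 v$. The corresponding finite supergroup scheme is $V\rtimes G$; $V\rtimes G$-supermodules are $A$-supermodules, $|V\rtimes G|=|A|$ and $|V\rtimes G|_M=|A|_M$. The isomorphism is the one induced by the identification $|V\rtimes G|\cong\operatorname{Max}(S(V^* )^G)\cong V/G$ coming from the isomorphism $\operatorname{H}^\bullet(\Lambda(V)\# kG,k)\cong S(V^* )^G$ given by restriction to $\Lambda(V)$. For $v\in V$, $M|_{\langle v\rangle}$ denotes $M$ regarded as a supermodule over the one-variable exterior algebra $k[t]/(t^2)$ ($t$ odd) with $t$ acting as $v$; thus for $v=0$ the element $t$ acts by zero and $M|_{\langle 0\rangle}$ is not free when $M\neq 0$. (Whether $M|_{\langle v\rangle}$ is free depends only on the orbit $[v]$.) *)

(* Defs.v *)
(* Written against the MathComp libraries (with multinomials).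

   Supermodules over A = Lambda(V) # kG, where V = k^n is the representation rV
   of the finite group gT on column vectors, g . v = rV g *m v, placed in odd
   degree.  Cohomology is computed from injective resolutions, which appear as
   parameters since derived functors do not depend on the choice. *)
From HB Require Import structures.
From mathcomp Require Import all_boot all_order all_algebra all_fingroup all_character.
From mathcomp Require Import mpoly.
Set Implicit Arguments. Unset Strict Implicit. Unset Printing Implicit Defensive.
Import GRing.Theory. Local Open Scope ring_scope.

(* Lambda(k^n) with basis e_S = e_i1 e_i2 ... (i1 < i2 < ...) indexed by the
   subsets S of 'I_n; k^o is k as a module over itself. *)
Definition exterior (k : fieldType) (n : nat) := {ffun {set 'I_n} -> k^o}.
HB.instance Definition _ k n := GRing.Lmodule.on (exterior k n).

Section Exterior.
Variables (k : fieldType) (n : nat).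
Implicit Types (a b c : exterior k n) (S T U : {set 'I_n}).

(* e_S e_T = (-1)^(ninv S T) e_(S u T) for disjoint S and T. *)
Definition ninv S T : nat := \sum_(i in S) \sum_(j in T) (j < i)%N.

Definition emul a b : exterior k n :=
  [ffun S : {set 'I_n} => \sum_(T : {set 'I_n} | T \subset S)
               (-1) ^+ ninv T (S :\: T) * a T * b (S :\: T)].

Definition ebasis S : exterior k n := [ffun T : {set 'I_n} => (T == S)%:R].

Definition evec (v : 'cV[k]_n) : exterior k n := \sum_i v i 0 *: ebasis [set i].

Lemma ninv0l S : ninv set0 S = 0%N.
Proof. by rewrite /ninv big_set0. Qed.

Lemma ninv0r S : ninv S set0 = 0%N.
Proof. by rewrite /ninv big1 // => i _; rewrite big_set0. Qed.

Lemma ninvUl S T U : [disjoint S & T] -> ninv (S :|: T) U = (ninv S U + ninv T U)%N.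
Proof. by move=> d; rewrite /ninv (big_setID S) /= setUK setDUl setDv set0U (setDidPl _) // disjoint_sym. Qed.

Lemma ninvUr S T U : [disjoint T & U] -> ninv S (T :|: U) = (ninv S T + ninv S U)%N.
Proof.
move=> d; rewrite /ninv -big_split /=; apply: eq_bigr => i _.
by rewrite (big_setID T) /= setUK setDUl setDv set0U (setDidPl _) // disjoint_sym.
Qed.

Lemma emulA : associative emul.
Proof.
move=> a b c; apply/ffunP => S; rewrite !ffunE.
transitivity (\sum_(U : {set 'I_n} | U \subset S) \sum_(W : {set 'I_n} | W \subset S :\: U)
   (-1) ^+ (ninv U (S :\: U) + ninv W (S :\: U :\: W)) * (a U * b W * c (S :\: U :\: W))).
  apply: eq_bigr => U _; rewrite ffunE mulr_sumr; apply: eq_bigr => W _.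
  by rewrite exprD -!mulrA; congr (_ * _); rewrite mulrCA.
transitivity (\sum_(T : {set 'I_n} | T \subset S) \sum_(U : {set 'I_n} | U \subset T)
   (-1) ^+ (ninv T (S :\: T) + ninv U (T :\: U)) * (a U * b (T :\: U) * c (S :\: T))); last first.
  apply: eq_bigr => T _; rewrite ffunE mulr_sumr mulr_suml; apply: eq_bigr => U _.
  by rewrite exprD !mulrA.
rewrite [RHS](exchange_big_dep (fun U : {set 'I_n} => U \subset S)) /=; last first.
  by move=> T U TS UT; apply: subset_trans TS.
apply: eq_bigr => U US.
rewrite [RHS](reindex_onto (fun W => U :|: W) (fun T => T :\: U)) /=; last first.
  by move=> T /andP[_ UT]; rewrite setDE setUIr setUCr setIT; apply/setUidPr.
apply: eq_big => [W|W].
  rewrite subUset US subsetUl andbT /= setDUl setDv set0U subsetD.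
  by congr (_ && _); apply/setDidPl/eqP.
rewrite subsetD => /andP[WS]; rewrite disjoint_sym => dUW.
have eW : (U :|: W) :\: U = W.
  by rewrite setDUl setDv set0U; apply/setDidPl; rewrite disjoint_sym.
rewrite eW -setDDl; congr (_ ^+ _ * _).
set R := S :\: U :\: W.
have eSU : S :\: U = W :|: R.
  by rewrite -(setID (S :\: U) W) (setIidPr _) // subsetD WS disjoint_sym.
have dWR : [disjoint W & R] by rewrite disjoint_sym disjoints_subset /R setDE subsetIr.
by rewrite eSU ninvUl // ninvUr // -addnA [RHS]addnC.
Qed.

Lemma emul1 : left_id (ebasis set0) emul.
Proof.
move=> a; apply/ffunP => S; rewrite !ffunE (bigD1 set0) ?sub0set //=.
rewrite !ffunE eqxx mulr1 setD0 ninv0l expr0 mul1r big1 ?addr0 // => T /andP[_ T0].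
by rewrite ffunE (negPf T0) mulr0 mul0r.
Qed.

Lemma emulr1 : right_id (ebasis set0) emul.
Proof.
move=> a; apply/ffunP => S; rewrite !ffunE (bigD1 S) //=.
rewrite !ffunE setDv eqxx mulr1 ninv0r expr0 mul1r big1 ?addr0 // => T /andP[TS nTS].
rewrite ffunE setD_eq0; case: (boolP (S \subset T)) => [ST|_]; last by rewrite mulr0.
by rewrite eqEsubset TS ST in nTS.
Qed.

Lemma emulDl : left_distributive emul +%R.
Proof.
move=> a b c; apply/ffunP => S; rewrite !ffunE -big_split /=; apply: eq_bigr => T _.
by rewrite ffunE mulrDr mulrDl.
Qed.

Lemma emulDr : right_distributive emul +%R.
Proof.
move=> a b c; apply/ffunP => S; rewrite !ffunE -big_split /=; apply: eq_bigr => T _.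
by rewrite ffunE mulrDr.
Qed.

Lemma ebasis0_neq0 : ebasis set0 != 0.
Proof. by apply/eqP => /ffunP/(_ set0); rewrite !ffunE eqxx => /eqP; rewrite oner_eq0. Qed.

HB.instance Definition _ := GRing.Zmodule_isNzRing.Build (exterior k n)
  emulA emul1 emulr1 emulDl emulDr ebasis0_neq0.

Lemma emulE a b S : (a * b) S = \sum_(T : {set 'I_n} | T \subset S)
               (-1) ^+ ninv T (S :\: T) * a T * b (S :\: T).
Proof. by rewrite [_ * _]/(emul a b) ffunE. Qed.

Lemma escaleAl (x : k) a b : x *: (a * b) = (x *: a) * b.
Proof.
apply/ffunP => S; rewrite ffunE !emulE scaler_sumr; apply: eq_bigr => T _.
by rewrite ffunE /GRing.scale /= !mulrA [x * _]mulrC.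
Qed.
HB.instance Definition _ := GRing.Lmodule_isLalgebra.Build k (exterior k n) escaleAl.

Lemma escaleAr (x : k) a b : x *: (a * b) = a * (x *: b).
Proof.
apply/ffunP => S; rewrite ffunE !emulE scaler_sumr; apply: eq_bigr => T _.
by rewrite ffunE /GRing.scale /= mulrCA.
Qed.
HB.instance Definition _ := GRing.Lalgebra_isAlgebra.Build k (exterior k n) escaleAr.

End Exterior.

Section EnumSets.
Variable n : nat.
Implicit Types (S T : {set 'I_n}) (i j : 'I_n).

Lemma sorted_enum_set S : sorted (fun i j : 'I_n => i < j)%N (enum S).
Proof.
have -> : enum S = [seq i <- enum 'I_n | i \in S].
  by rewrite enumT.
apply: sorted_filter; first by move=> i j l; apply: ltn_trans.
by rewrite -(sorted_map (f := val) (e' := ltn)) val_enum_ord iota_ltn_sorted.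
Qed.

Lemma sorted_enum_uniq S (s : seq 'I_n) :
  sorted (fun i j : 'I_n => i < j)%N s -> s =i S -> enum S = s.
Proof.
move=> ss es.
apply: (@irr_sorted_eq _ (fun i j : 'I_n => i < j)%N) => //.
- by move=> i j l; apply: ltn_trans.
- by move=> i; rewrite ltnn.
- exact: sorted_enum_set.
by move=> i; rewrite mem_enum es.
Qed.

Lemma enum_set_cons S i : (forall j, j \in S -> (i < j)%N) ->
  enum (i |: S) = i :: enum S.
Proof.
move=> lt_i; apply: sorted_enum_uniq => [|j]; last by rewrite !inE mem_enum.
rewrite /= path_min_sorted ?sorted_enum_set //.
by apply/allP => j; rewrite mem_enum => /lt_i.
Qed.

Lemma enum_set_rcons S i : (forall j, j \in S -> (j < i)%N) ->
  enum (i |: S) = rcons (enum S) i.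
Proof.
move=> lt_i; apply: sorted_enum_uniq => [|j]; last first.
  by rewrite mem_rcons !inE mem_enum.
rewrite -rev_sorted rev_rcons /= path_min_sorted ?rev_sorted ?sorted_enum_set //.
by apply/allP => j; rewrite mem_rev mem_enum => /lt_i.
Qed.

Lemma set_min_ind (P : {set 'I_n} -> Prop) :
  P set0 ->
  (forall S i, (forall j, j \in S -> (i < j)%N) -> P S -> P (i |: S)) ->
  forall S, P S.
Proof.
move=> P0 PS S; have [m] := ubnP #|S|; elim: m S => // m IH S.
have [->//|[i0 Si0]] := set_0Vmem S.
case: (arg_minnP (fun i : 'I_n => val i) Si0) => i Si mini; rewrite ltnS => leS.
rewrite -(setD1K Si); apply: PS => [j|].
  by rewrite !inE => /andP[nj /mini]; rewrite leq_eqVlt eq_sym val_eqE (negPf nj).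
by apply: IH; apply: leq_trans leS; apply: proper_card; apply: properD1.
Qed.

Lemma set_max_ind (P : {set 'I_n} -> Prop) :
  P set0 ->
  (forall S i, (forall j, j \in S -> (j < i)%N) -> P S -> P (i |: S)) ->
  forall S, P S.
Proof.
move=> P0 PS S; have [m] := ubnP #|S|; elim: m S => // m IH S.
have [->//|[i0 Si0]] := set_0Vmem S.
case: (arg_maxnP (fun i : 'I_n => val i) Si0) => i Si maxi; rewrite ltnS => leS.
rewrite -(setD1K Si); apply: PS => [j|].
  by rewrite !inE => /andP[nj /maxi le_ji]; rewrite ltn_neqAle; apply/andP.
by apply: IH; apply: leq_trans leS; apply: proper_card; apply: properD1.
Qed.

End EnumSets.

Section Lift.
Variables (k : fieldType) (n : nat) (B : algType k) (c : 'I_n -> B).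
Implicit Types (a b : exterior k n) (S T U : {set 'I_n}) (i j m : 'I_n).

Definition eprod S : B := \prod_(i <- enum S) c i.
(* The universal property of Lambda(k^n): see eliftM below. *)
Definition elift a : B := \sum_S a S *: eprod S.

Hypothesis c_sq : forall i, c i * c i = 0.
Hypothesis c_anti : forall i j, c i * c j = - (c j * c i).

Lemma eprod0 : eprod set0 = 1.
Proof. by rewrite /eprod enum_set0 big_nil. Qed.

Lemma eprodU1l S i : (forall j, j \in S -> (i < j)%N) -> eprod (i |: S) = c i * eprod S.
Proof. by move=> H; rewrite /eprod enum_set_cons // big_cons. Qed.

Lemma eprodU1r S i : (forall j, j \in S -> (j < i)%N) -> eprod (i |: S) = eprod S * c i.
Proof. by move=> H; rewrite /eprod enum_set_rcons // -cats1 big_cat big_seq1. Qed.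

Lemma ninv1S i S : ninv [set i] S = (\sum_(j in S) (j < i))%N.
Proof. by rewrite /ninv big_set1. Qed.

Lemma mul_c_eprod i T : c i * eprod T =
  if i \in T then 0 else (-1) ^+ ninv [set i] T *: eprod (i |: T).
Proof.
elim/set_min_ind: T => [|T m ltm IH].
  by rewrite inE ninv0r expr0 scale1r eprod0 eprodU1l ?eprod0 // => j; rewrite inE.
have mT : m \notin T by apply/negP => /ltm; rewrite ltnn.
rewrite eprodU1l // in_setU1; case: (ltngtP i m) => [im|mi|im].
- have iT : i \notin T by apply/negP => /ltm /ltn_trans/(_ im); rewrite ltnn.
  have lti j : j \in m |: T -> (i < j)%N.
    by rewrite !inE => /orP[/eqP->//|/ltm]; apply: ltn_trans.
  rewrite -val_eqE /= (ltn_eqF im) (negPf iT) /= eprodU1l // -eprodU1l // ninv1S.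
  by rewrite big1 ?expr0 ?scale1r // => j /lti ij; rewrite ltnNge (ltnW ij).
- rewrite -val_eqE /= (gtn_eqF mi) /= mulrA c_anti mulNr -mulrA IH.
  case: ifP => [_|/negbT iT]; first by rewrite mulr0 oppr0.
  rewrite -scalerAr -eprodU1l; last first.
    by move=> j; rewrite !inE => /orP[/eqP->//|/ltm].
  by rewrite !ninv1S big_setU1 //= mi exprD expr1 mulN1r scaleNr setUCA.
- have -> : i = m by apply: val_inj.
  by rewrite eqxx /= mulrA c_sq mul0r.
Qed.

Lemma disjointsU1 i S T : [disjoint i |: S & T] = (i \notin T) && [disjoint S & T].
Proof. by rewrite !disjoints_subset subUset sub1set in_setC. Qed.

Lemma eprodM S T : eprod S * eprod T =
  if [disjoint S & T] then (-1) ^+ ninv S T *: eprod (S :|: T) else 0.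
Proof.
elim/set_max_ind: S T => [|S m ltm IH] T.
  by rewrite eprod0 mul1r disjoints_subset sub0set ninv0l expr0 scale1r set0U.
have mS : m \notin S by apply/negP => /ltm; rewrite ltnn.
rewrite eprodU1r // -mulrA mul_c_eprod disjointsU1; case: (boolP (m \in T)) => mT /=.
  by rewrite mulr0.
rewrite -scalerAr IH [X in if X then _ else 0]disjoint_sym disjointsU1 mS /= disjoint_sym.
case: ifP => dST; last by rewrite scaler0.
rewrite scalerA -exprD setUCA setUA ninvUl; last by rewrite disjoints1.
rewrite [X in (_ + X)%N]ninvUr; last by rewrite disjoints1.
suff -> : ninv S [set m] = 0%N by rewrite add0n.
by rewrite /ninv big1 // => j Sj; rewrite big_set1 ltnNge (ltnW (ltm _ Sj)).
Qed.

Lemma eliftM a b : elift (a * b) = elift a * elift b.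
Proof.
rewrite /elift mulr_suml.
transitivity (\sum_(S : {set 'I_n}) \sum_(T : {set 'I_n} | T \subset S)
   (a T * b (S :\: T)) *: (eprod T * eprod (S :\: T))).
  apply: eq_bigr => S _; rewrite emulE scaler_suml; apply: eq_bigr => T TS.
  rewrite eprodM disjoint_sym disjoints_subset setDE subsetIr scalerA.
  have eS : T :|: S :\: T = S by rewrite -[RHS](setID S T) (setIidPr TS).
  by rewrite -setDE eS /= -mulrA mulrC.
rewrite (exchange_big_dep xpredT) //=; apply: eq_bigr => T _.
rewrite mulr_sumr [RHS](bigID (fun U : {set 'I_n} => [disjoint T & U])) /=.
rewrite [X in _ + X]big1 ?addr0; last first.
  by move=> U dTU; rewrite -scalerAl -scalerAr eprodM (negPf dTU) !scaler0.
rewrite [LHS](reindex_onto (fun U => T :|: U) (fun S => S :\: T)) /=; last first.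
  by move=> S TS; rewrite setUC -[RHS](setID S T) (setIidPr TS) setUC.
apply: eq_big => [U|U].
  rewrite subsetUl /= setDUl setDv set0U disjoint_sym.
  by apply/eqP/idP => /setDidPl.
move=> /andP[_ /eqP ->].
by rewrite -scalerAl -scalerAr scalerA.
Qed.

Lemma eliftE S : elift (ebasis k S) = eprod S.
Proof.
rewrite /elift (bigD1 S) //= ffunE eqxx scale1r big1 ?addr0 // => T /negPf nTS.
by rewrite ffunE nTS scale0r.
Qed.

Lemma elift1 : elift 1 = 1.
Proof. by rewrite -[1 in LHS]/(ebasis k set0) eliftE eprod0. Qed.

Lemma elift_linear : linear elift.
Proof.
move=> x a b; rewrite /elift scaler_sumr -big_split /=; apply: eq_bigr => S _.
by rewrite !ffunE scalerDl scalerA.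
Qed.
End Lift.

Section ExteriorBasis.
Variables (k : fieldType) (n : nat).
Implicit Types (a b : exterior k n) (S T U : {set 'I_n}) (i j : 'I_n).
Local Notation e := (ebasis k).

Lemma ebasisM S T : e S * e T =
  if [disjoint S & T] then (-1) ^+ ninv S T *: e (S :|: T) else 0.
Proof.
apply/ffunP => R; rewrite emulE.
transitivity (if (S \subset R) && (R :\: S == T) then (-1) ^+ ninv S T else 0 : k).
  rewrite big_mkcond (bigD1 S) //= big1 ?addr0; last first.
    by move=> W /negPf WS; case: ifP => // _; rewrite !ffunE WS mulr0 mul0r.
  rewrite !ffunE eqxx mulr1; case: ifP => //= _; case: eqP => [->|_].
    by rewrite mulr1.
  by rewrite mulr0.
have [->|neR] := eqVneq R (S :|: T).
  rewrite subsetUl /= setDUl setDv set0U.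
  have -> : (T :\: S == T) = [disjoint S & T].
    by rewrite disjoint_sym; apply/eqP/idP => /setDidPl.
  by case: ifP => _; rewrite !ffunE // eqxx [RHS]mulr1.
case: ifP => [/andP[SR /eqP eT]|_].
  by case/eqP: neR; rewrite -eT -[LHS](setID R S) (setIidPr SR).
by case: ifP => _; rewrite !ffunE // (negPf neR) [RHS]mulr0.
Qed.

Lemma exteriorE a : a = \sum_S a S *: e S.
Proof.
apply/ffunP => S; rewrite sum_ffunE (bigD1 S) //= big1.
  by rewrite !ffunE eqxx addr0 [RHS]mulr1.
by move=> T /negPf TS; rewrite !ffunE eq_sym TS [LHS]mulr0.
Qed.

Lemma ebasis1_sq i : e [set i] * e [set i] = 0.
Proof. by rewrite ebasisM disjoints1 inE eqxx. Qed.

Lemma ebasis1_anti i j : e [set i] * e [set j] = - (e [set j] * e [set i]).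
Proof.
have [->|ij] := eqVneq i j; first by rewrite ebasis1_sq oppr0.
rewrite !ebasisM !disjoints1 !inE ij eq_sym ij /= setUC -scaleNr; congr (_ *: _).
rewrite /ninv !big_set1; case: ltngtP => [_|_|/val_inj eij]; rewrite ?expr0 ?expr1 ?opprK //.
by rewrite eij eqxx in ij.
Qed.

Lemma eprod_ebasis S : eprod (fun i => e [set i]) S = e S.
Proof.
elim/set_min_ind: S => [|S i lti IH]; first exact: eprod0.
have iS : i \notin S by apply/negP => /lti; rewrite ltnn.
rewrite eprodU1l // IH ebasisM disjoints1 iS ninv1S big1 ?expr0 ?scale1r //.
by move=> j /lti ij; rewrite ltnNge (ltnW ij).
Qed.

Lemma evec_linear : linear (@evec k n).
Proof.
move=> x v w; rewrite /evec scaler_sumr -big_split /=; apply: eq_bigr => i _.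
by rewrite !mxE scalerDl scalerA.
Qed.

Lemma evec_anti v w : evec v * evec w = - (evec w * evec v) :> exterior k n.
Proof.
rewrite /evec !mulr_suml -sumrN.
under eq_bigr do rewrite mulr_sumr.
rewrite exchange_big; apply: eq_bigr => j _; rewrite mulr_sumr -sumrN.
apply: eq_bigr => i _.
by rewrite -!scalerAl -!scalerAr ebasis1_anti !scalerN !scalerA mulrC.
Qed.

Lemma evec_sq v : evec v * evec v = 0 :> exterior k n.
Proof.
suff: evec v * evec v = 0 :> exterior k n /\
      forall i, e [set i] * evec v = - (evec v * e [set i]) by case.
rewrite /evec; elim/big_rec: _ => [|i x _ [xx ix]].
  by split=> [|i]; rewrite ?mulr0 ?mul0r ?oppr0.
split=> [|j]; last first.
  by rewrite mulrDr mulrDl opprD ix -scalerAl -scalerAr ebasis1_anti scalerN.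
rewrite mulrDl !mulrDr xx addr0 -!scalerAl -!scalerAr ebasis1_sq !scaler0 add0r.
by rewrite ix scalerN addNr.
Qed.

End ExteriorBasis.

Section ExteriorMap.
Variable k : fieldType.

(* Lambda(f) : Lambda(k^p) -> Lambda(k^n). *)
Definition emap p n (f : 'M[k]_(n, p)) : exterior k p -> exterior k n :=
  elift (fun i => evec (col i f)).

Lemma emapM p n (f : 'M[k]_(n, p)) : {morph emap f : a b / a * b}.
Proof. by move=> a b; apply: eliftM => *; [apply: evec_sq | apply: evec_anti]. Qed.

Lemma emap1 p n (f : 'M[k]_(n, p)) : emap f 1 = 1.
Proof. exact: elift1. Qed.

Lemma emap_linear p n (f : 'M[k]_(n, p)) : linear (emap f).
Proof. exact: elift_linear. Qed.
HB.instance Definition _ p n f :=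
  GRing.isLinear.Build k (exterior k p) (exterior k n) _ (@emap p n f) (emap_linear f).
HB.instance Definition _ p n f :=
  GRing.isMonoidMorphism.Build (exterior k p) (exterior k n) (@emap p n f)
    (emap1 f, emapM f).

Lemma emap_vec p n (f : 'M[k]_(n, p)) v : emap f (evec v) = evec (f *m v).
Proof.
rewrite {1}/evec linear_sum /=.
have ->: f *m v = \sum_i v i 0 *: col i f.
  apply/matrixP => i j; rewrite ord1 !mxE summxE; apply: eq_bigr => l _.
  by rewrite !mxE mulrC.
have [evL] : exists L : {linear 'cV[k]_n -> exterior k n}, L =1 @evec k n.
  pose L := GRing.isLinear.Build k 'cV[k]_n (exterior k n) _ (@evec k n) (@evec_linear k n).
  pose L' : {linear 'cV[k]_n -> exterior k n} := HB.pack (@evec k n) L.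
  by exists L'.
move=> eL; rewrite -eL linear_sum; apply: eq_bigr => i _; rewrite !linearZ /= eL.
congr (_ *: _); rewrite /emap eliftE /eprod enum_set1 big_seq1 //.
Qed.

Lemma emap_basis p n (f : 'M[k]_(n, p)) S :
  emap f (ebasis k S) = \prod_(i <- enum S) evec (col i f).
Proof. exact: eliftE. Qed.

Lemma emap_comp p n m (f : 'M[k]_(n, p)) (g : 'M[k]_(m, n)) a :
  emap g (emap f a) = emap (g *m f) a.
Proof.
rewrite [emap f a]/elift linear_sum [RHS]/elift; apply: eq_bigr => S _.
rewrite linearZ /= -!eliftE -/(emap _ _) -/(emap _ _).
congr (_ *: _); rewrite !emap_basis rmorph_prod; apply: eq_bigr => i _.
by rewrite /= emap_vec colE mulmxA -colE.
Qed.

Lemma emap_id n a : emap (1%:M : 'M[k]_n) a = a.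
Proof.
rewrite [a in RHS]exteriorE /emap /elift; apply: eq_bigr => S _.
rewrite -eprod_ebasis; congr (_ *: _); apply: eq_bigr => i _.
rewrite /evec (bigD1 i) //= big1 ?addr0.
  by rewrite !mxE eqxx scale1r.
by move=> j /negPf ji; rewrite !mxE ji scale0r.
Qed.

End ExteriorMap.

(* a : smash rV stands for the sum over g of a(g) # g, with product
   (u # g)(w # h) = u (g . w) # gh. *)
Definition smash (k : fieldType) (gT : finGroupType) (n : nat)
  (rV : mx_representation k [set: gT] n) := {ffun gT -> exterior k n}.
HB.instance Definition _ k gT n rV := GRing.Lmodule.on (@smash k gT n rV).

Section Smash.
Variables (k : fieldType) (gT : finGroupType) (n : nat).
Variable rV : mx_representation k [set: gT] n.
Local Notation A := (smash rV).
Implicit Types (a b c : A) (x y z : gT).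

Definition smul a b : A :=
  [ffun x => \sum_y a y * emap (rV y) (b (y^-1 * x)%g)].

Definition sext (u : exterior k n) : A := [ffun x => if x == 1%g then u else 0].
Definition sgrp (g : gT) : A := [ffun x => (x == g)%:R].

Lemma rV_mul x y : rV (x * y)%g = rV x *m rV y.
Proof. by rewrite repr_mxM ?inE. Qed.

Lemma smulA : associative smul.
Proof.
move=> a b c; apply/ffunP => x; rewrite !ffunE.
transitivity (\sum_y \sum_z a y * (emap (rV y) (b (y^-1 * z)%g) * emap (rV z) (c (z^-1 * x)%g))).
  apply: eq_bigr => y _; rewrite ffunE linear_sum mulr_sumr.
  rewrite (reindex (fun z => y^-1 * z)%g) /=; last first.
    by exists (fun z => y * z)%g => z _; rewrite ?mulKVg ?mulKg.
  apply: eq_bigr => z _; rewrite rmorphM /= emap_comp -rV_mul mulKVg.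
  by rewrite invMg invgK -mulgA mulKVg.
rewrite exchange_big; apply: eq_bigr => z _; rewrite ffunE mulr_suml.
by apply: eq_bigr => y _; rewrite mulrA.
Qed.

Lemma smul1 : left_id (sext 1) smul.
Proof.
move=> a; apply/ffunP => x; rewrite !ffunE (bigD1 1%g) //= ffunE eqxx mul1r.
rewrite invg1 mul1g repr_mx1 emap_id big1 ?addr0 // => y /negPf y1.
by rewrite ffunE y1 mul0r.
Qed.

Lemma smulr1 : right_id (sext 1) smul.
Proof.
move=> a; apply/ffunP => x; rewrite !ffunE (bigD1 x) //= ffunE mulVg eqxx emap1 mulr1.
rewrite big1 ?addr0 // => y /negPf yx.
by rewrite ffunE -eq_mulVg1 yx linear0 mulr0.
Qed.

Lemma smulDl : left_distributive smul +%R.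
Proof.
move=> a b c; apply/ffunP => x; rewrite !ffunE -big_split /=; apply: eq_bigr => y _.
by rewrite ffunE mulrDl.
Qed.

Lemma smulDr : right_distributive smul +%R.
Proof.
move=> a b c; apply/ffunP => x; rewrite !ffunE -big_split /=; apply: eq_bigr => y _.
by rewrite ffunE linearD mulrDr.
Qed.

Lemma sext1_neq0 : sext 1 != 0.
Proof. by apply/eqP => /ffunP/(_ 1%g); rewrite !ffunE eqxx => /eqP; rewrite oner_eq0. Qed.

HB.instance Definition _ := GRing.Zmodule_isNzRing.Build A
  smulA smul1 smulr1 smulDl smulDr sext1_neq0.

Lemma smulE a b x : (a * b) x = \sum_y a y * emap (rV y) (b (y^-1 * x)%g).
Proof. by rewrite [_ * _]/(smul a b) ffunE. Qed.

Lemma sscaleAl (t : k) a b : t *: (a * b) = (t *: a) * b.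
Proof.
apply/ffunP => x; rewrite ffunE !smulE scaler_sumr; apply: eq_bigr => y _.
by rewrite ffunE scalerAl.
Qed.
HB.instance Definition _ := GRing.Lmodule_isLalgebra.Build k A sscaleAl.

Lemma sscaleAr (t : k) a b : t *: (a * b) = a * (t *: b).
Proof.
apply/ffunP => x; rewrite ffunE !smulE scaler_sumr; apply: eq_bigr => y _.
by rewrite ffunE linearZ scalerAr.
Qed.
HB.instance Definition _ := GRing.Lalgebra_isAlgebra.Build k A sscaleAr.

Lemma sext_linear : linear sext.
Proof. by move=> t u v; apply/ffunP => x; rewrite !ffunE; case: ifP; rewrite ?scaler0 ?addr0. Qed.
HB.instance Definition _ :=
  GRing.isLinear.Build k (exterior k n) A _ sext sext_linear.

Lemma sext_monoid : monoid_morphism sext.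
Proof.
split=> // u v; apply/ffunP => x; rewrite smulE ffunE (bigD1 1%g) //= !ffunE eqxx.
rewrite invg1 mul1g repr_mx1 emap_id big1 ?addr0; last first.
  by move=> y /negPf y1; rewrite ffunE y1 mul0r.
by case: ifP; rewrite ?mulr0.
Qed.
HB.instance Definition _ :=
  GRing.isMonoidMorphism.Build (exterior k n) A sext sext_monoid.

Lemma sgrp1 : sgrp 1%g = 1.
Proof. by apply/ffunP => x; rewrite !ffunE; case: eqP. Qed.

Lemma sgrpM g h : sgrp (g * h)%g = sgrp g * sgrp h.
Proof.
apply/ffunP => x; rewrite smulE ffunE (bigD1 g) //= !ffunE eqxx mul1r.
rewrite big1 ?addr0; last by move=> y /negPf yg; rewrite ffunE yg mul0r.
rewrite rmorph_nat; congr (_ %:R); congr nat_of_bool.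
by rewrite -(inj_eq (mulgI g^-1%g)) mulKg.
Qed.

Lemma sgrp_sext g u : sgrp g * sext u = sext (emap (rV g) u) * sgrp g.
Proof.
apply/ffunP => x; rewrite !smulE (bigD1 g) //= [in RHS](bigD1 1%g) //=.
rewrite !big1 ?addr0; first last.
- by move=> y /negPf yg; rewrite ffunE yg mul0r.
- by move=> y /negPf y1; rewrite ffunE y1 mul0r.
rewrite !ffunE !eqxx mul1r invg1 mul1g rmorph_nat /= -eq_mulVg1 eq_sym.
by case: ifP; rewrite ?mulr1 ?mulr0 ?linear0.
Qed.

End Smash.

(* A superspace X = X_0 (+) X_1 is given by its two projections. *)
Record superspace (k : fieldType) (X : lmodType k) := Superspace {
  spart : bool -> X -> X;
  spart_linear : forall b, linear (spart b);
  spartK : forall b c x, spart b (spart c x) = if b == c then spart b x else 0;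
  spart_sum : forall x, spart false x + spart true x = x }.

Definition is_homog (k : fieldType) (X : lmodType k) (sX : superspace X) (b : bool) (x : X) : Prop :=
  spart sX b x = x.

Record superalgebra (k : fieldType) := Superalgebra {
  sa_alg :> algType k;
  sa_parity : superspace sa_alg;
  sa_one : is_homog sa_parity false 1;
  sa_mul : forall b c x y, is_homog sa_parity b x -> is_homog sa_parity c y ->
    is_homog sa_parity (b (+) c) (x * y) }.

Record superalg_hom (k : fieldType) (A B : superalgebra k) := SuperalgHom {
  sah_fun :> {lrmorphism A -> B};
  sah_even : forall b a, is_homog (sa_parity A) b a -> is_homog (sa_parity B) b (sah_fun a) }.

Record supermodule (k : fieldType) (A : superalgebra k) (X : lmodType k) := Supermodule {
  sm_parity : superspace X;
  sm_act : A -> X -> X;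
  sm_linear_r : forall a, linear (sm_act a);
  sm_linear_l : forall x, linear (sm_act^~ x);
  sm_act1 : forall x, sm_act 1 x = x;
  sm_actM : forall a b x, sm_act (a * b) x = sm_act a (sm_act b x);
  sm_act_homog : forall b c a x, is_homog (sa_parity A) b a -> is_homog sm_parity c x ->
    is_homog sm_parity (b (+) c) (sm_act a x) }.

Section Restriction.
Variables (k : fieldType) (A B : superalgebra k) (f : superalg_hom A B).
Variables (X : lmodType k) (sX : supermodule B X).

Lemma restrict_linear_l x : linear (fun a : A => sm_act sX (f a) x).
Proof. by move=> t a b; rewrite linearP /= (sm_linear_l sX). Qed.

Lemma restrict_act1 x : sm_act sX (f 1) x = x.
Proof. by rewrite rmorph1 sm_act1. Qed.

Lemma restrict_actM a b x :
  sm_act sX (f (a * b)) x = sm_act sX (f a) (sm_act sX (f b) x).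
Proof. by rewrite rmorphM sm_actM. Qed.

Lemma restrict_homog b c a x : is_homog (sa_parity A) b a -> is_homog (sm_parity sX) c x ->
  is_homog (sm_parity sX) (b (+) c) (sm_act sX (f a) x).
Proof. by move=> /(sah_even f); apply: sm_act_homog. Qed.

Definition restrict : supermodule A X :=
  Supermodule (fun a => sm_linear_r sX (f a)) restrict_linear_l
    restrict_act1 restrict_actM restrict_homog.
End Restriction.

Section HomogTheory.
Variables (k : fieldType) (X : lmodType k) (sX : superspace X).

Lemma homog0 b : is_homog sX b 0.
Proof.
have := spart_linear sX b 1 0 0; rewrite !scale1r addr0 => /eqP.
by rewrite -subr_eq0 opprD addrA subrr add0r oppr_eq0 => /eqP.
Qed.

Lemma homogP b t x y : is_homog sX b x -> is_homog sX b y -> is_homog sX b (t *: x + y).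
Proof. by rewrite /is_homog spart_linear => -> ->. Qed.

Lemma homogZ b t x : is_homog sX b x -> is_homog sX b (t *: x).
Proof. by move=> hx; rewrite -[_ *: _]addr0; apply: homogP (homog0 b). Qed.

Lemma homog_sum b (I : Type) (r : seq I) (P : pred I) (F : I -> X) :
  (forall i, P i -> is_homog sX b (F i)) -> is_homog sX b (\sum_(i <- r | P i) F i).
Proof.
move=> hF; elim/big_rec: _ => [|i x Pi hx]; first exact: homog0.
by rewrite -[F i]scale1r; apply: homogP => //; apply: hF.
Qed.
End HomogTheory.

Section BaseField.
Variable k : fieldType.

Definition base_spart (b : bool) (x : k^o) : k^o := if b then 0 else x.

Lemma base_spart_linear b : linear (base_spart b).
Proof. by case: b => t x y //=; rewrite scaler0 addr0. Qed.

Lemma base_spartK b c x :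
  base_spart b (base_spart c x) = if b == c then base_spart b x else 0.
Proof. by case: b c => [] []. Qed.

Lemma base_spart_sum x : base_spart false x + base_spart true x = x.
Proof. exact: addr0. Qed.

Definition base_superspace := Superspace base_spart_linear base_spartK base_spart_sum.

Lemma base_mul b c (x y : k^o) : is_homog base_superspace b x -> is_homog base_superspace c y ->
  is_homog base_superspace (b (+) c) (x * y).
Proof. case: b c => [] [] //=; rewrite /is_homog /=.
- by move=> <- _; rewrite mul0r.
- by move=> _ <-; rewrite mulr0. Qed.

Definition base_superalgebra : superalgebra k :=
  @Superalgebra k k^o base_superspace (erefl _) base_mul.

Definition regular_base : supermodule base_superalgebra k^o.
Proof.
apply: (@Supermodule k base_superalgebra k^o base_superspace (fun a x => a * x)).
- by move=> a t x y; rewrite mulrDr scalerAr.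
- by move=> x t a b; rewrite mulrDl scalerAl.
- exact: mul1r.
- by move=> a b x; rewrite mulrA.
- exact: base_mul.
Defined.

Definition trivial_supermodule (A : superalgebra k)
  (eps : superalg_hom A base_superalgebra) : supermodule A k^o :=
  restrict eps regular_base.
End BaseField.

Section ExteriorSuper.
Variable k : fieldType.

Definition espart n (b : bool) (a : exterior k n) : exterior k n :=
  [ffun S : {set 'I_n} => if odd #|S| == b then a S else 0].

Lemma espart_linear n b : linear (@espart n b).
Proof.
by move=> t x y; apply/ffunP => S; rewrite !ffunE; case: ifP; rewrite // scaler0 addr0.
Qed.

Lemma espartK n b c x : espart b (espart c x) = if b == c then espart b x else 0 :> exterior k n.
Proof.
apply/ffunP => S; rewrite !ffunE; case: (eqVneq b c) => [->|bc]; rewrite !ffunE.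
  by case: eqP.
by case: eqP => // ->; rewrite (negPf bc).
Qed.

Lemma espart_sum n x : espart false x + espart true x = x :> exterior k n.
Proof. by apply/ffunP => S; rewrite !ffunE; case: odd => /=; rewrite ?addr0 ?add0r. Qed.

Definition exterior_superspace n : superspace (exterior k n) :=
  Superspace (@espart_linear n) (@espartK n) (@espart_sum n).

Lemma ehomogP n b (a : exterior k n) : is_homog (exterior_superspace n) b a <->
  forall S : {set 'I_n}, odd #|S| != b -> a S = 0.
Proof.
split=> [<- S /negPf oS|H]; first by rewrite ffunE oS.
by apply/ffunP => S; rewrite ffunE; case: eqP => // /eqP/H.
Qed.

Lemma ehomog1 n : is_homog (exterior_superspace n) false 1.
Proof.
apply/ehomogP => S oS; rewrite ffunE; case: eqP => // S0.
by rewrite S0 cards0 in oS.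
Qed.

Lemma ehomogM n b c (x y : exterior k n) : is_homog (exterior_superspace n) b x ->
  is_homog (exterior_superspace n) c y -> is_homog (exterior_superspace n) (b (+) c) (x * y).
Proof.
move=> /ehomogP hx /ehomogP hy; apply/ehomogP => S oS.
rewrite emulE big1 // => T TS.
have [oT|/hx ->] := eqVneq (odd #|T|) b; last by rewrite mulr0 mul0r.
rewrite hy ?mulr0 //; apply: contraNneq oS => oST.
by rewrite -(cardsID T S) (setIidPr TS) oddD oT oST.
Qed.

Definition exterior_superalgebra n : superalgebra k :=
  Superalgebra (@ehomog1 n) (@ehomogM n).

Lemma ehomog_vec n (v : 'cV[k]_n) : is_homog (exterior_superspace n) true (evec v).
Proof.
apply/ehomogP => S oS; rewrite sum_ffunE big1 // => i _; rewrite !ffunE.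
case: eqP => [S1|_]; last exact: mulr0.
by rewrite S1 cards1 in oS.
Qed.

Lemma emap_even p n (f : 'M[k]_(n, p)) b (a : exterior k p) :
  is_homog (exterior_superspace p) b a -> is_homog (exterior_superspace n) b (emap f a).
Proof.
move=> /ehomogP ha; apply: homog_sum => S _.
have [oS|/ha ->] := eqVneq (odd #|S|) b; last by rewrite scale0r; apply: homog0.
apply: homogZ; rewrite -{}oS {ha}.
elim/set_min_ind: S => [|S i lti IH]; first by rewrite eprod0 cards0; apply: ehomog1.
have iS : i \notin S by apply/negP => /lti; rewrite ltnn.
by rewrite eprodU1l // cardsU1 iS oddS -addTb; apply: ehomogM => //; apply: ehomog_vec.
Qed.

Definition emap_hom p n (f : 'M[k]_(n, p)) :
    superalg_hom (exterior_superalgebra p) (exterior_superalgebra n) :=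
  @SuperalgHom k (exterior_superalgebra p) (exterior_superalgebra n) (emap f) (emap_even f).

Definition ecounit n (a : exterior k n) : k^o := a set0.

Lemma ecounit_linear n : linear (@ecounit n).
Proof. by move=> t a b; rewrite /ecounit !ffunE. Qed.
HB.instance Definition _ n :=
  GRing.isLinear.Build k (exterior k n) k^o _ (@ecounit n) (@ecounit_linear n).

Lemma ecounit_monoid n : monoid_morphism (@ecounit n).
Proof.
split=> [|a b]; rewrite /ecounit; first by rewrite ffunE eqxx.
rewrite emulE (bigD1 set0) ?sub0set //= big1.
  by rewrite addr0 setD0 ninv0l expr0 mul1r.
by move=> T /andP[]; rewrite subset0 => /eqP->; rewrite eqxx.
Qed.
HB.instance Definition _ n :=
  GRing.isMonoidMorphism.Build (exterior k n) k^o (@ecounit n) (@ecounit_monoid n).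

Lemma ecounit_even n b (a : exterior k n) :
  is_homog (exterior_superspace n) b a -> is_homog (base_superspace k) b (ecounit a).
Proof.
by case: b => // /ehomogP ha; rewrite /is_homog /= /ecounit ha // cards0.
Qed.

Definition exterior_counit n :
    superalg_hom (exterior_superalgebra n) (base_superalgebra k) :=
  @SuperalgHom k (exterior_superalgebra n) (base_superalgebra k)
    (@ecounit n) (@ecounit_even n).

Lemma ecounit_emap p n (f : 'M[k]_(n, p)) a : ecounit (emap f a) = ecounit a.
Proof.
rewrite /emap /elift linear_sum (bigD1 set0) //= eprod0 linearZ rmorph1 /= big1.
  by rewrite addr0 [LHS]mulr1.
move=> S; elim/set_min_ind: S => [|S i lti _ _]; first by rewrite eqxx.
rewrite linearZ eprodU1l // rmorphM /=.
have -> : ecounit (evec (col i f)) = 0 by apply/esym/(ecounit_even (ehomog_vec _)).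
by rewrite mul0r scaler0.
Qed.
End ExteriorSuper.

Section SmashSuper.
Variables (k : fieldType) (gT : finGroupType) (n : nat).
Variable rV : mx_representation k [set: gT] n.
Local Notation A := (smash rV).

Definition sspart (b : bool) (a : A) : A := [ffun g => espart b (a g)].

Lemma sspart_linear b : linear (sspart b).
Proof. by move=> t x y; apply/ffunP => g; rewrite !ffunE espart_linear. Qed.

Lemma sspartK b c x : sspart b (sspart c x) = if b == c then sspart b x else 0.
Proof. by apply/ffunP => g; rewrite !ffunE espartK; case: ifP => _; rewrite !ffunE. Qed.

Lemma sspart_sum x : sspart false x + sspart true x = x.
Proof. by apply/ffunP => g; rewrite !ffunE espart_sum. Qed.

Definition smash_superspace : superspace A :=
  Superspace sspart_linear sspartK sspart_sum.

Lemma shomogP b (a : A) : is_homog smash_superspace b a <->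
  forall g, is_homog (exterior_superspace k n) b (a g).
Proof.
split=> [<- g|H]; first by rewrite ffunE /is_homog /= espartK eqxx.
by apply/ffunP => g; rewrite ffunE; apply: H.
Qed.

Lemma shomog1 : is_homog smash_superspace false 1.
Proof.
by apply/shomogP => g; rewrite ffunE; case: ifP => _; [apply: ehomog1 | apply: homog0].
Qed.

Lemma shomogM b c (x y : A) : is_homog smash_superspace b x ->
  is_homog smash_superspace c y -> is_homog smash_superspace (b (+) c) (x * y).
Proof.
move=> /shomogP hx /shomogP hy; apply/shomogP => g; rewrite smulE.
by apply: homog_sum => h _; apply: ehomogM => //; apply: emap_even.
Qed.

Definition smash_superalgebra : superalgebra k := Superalgebra shomog1 shomogM.

Lemma sext_even b (u : exterior k n) :
  is_homog (exterior_superspace k n) b u -> is_homog smash_superspace b (sext rV u).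
Proof. by move=> hu; apply/shomogP => g; rewrite ffunE; case: ifP => // _; apply: homog0. Qed.

Definition sext_hom : superalg_hom (exterior_superalgebra k n) smash_superalgebra :=
  @SuperalgHom k (exterior_superalgebra k n) smash_superalgebra (sext rV) sext_even.

Definition scounit (a : A) : k^o := \sum_g ecounit (a g).

Lemma scounit_linear : linear scounit.
Proof.
move=> t a b; rewrite /scounit scaler_sumr -big_split; apply: eq_bigr => g _ /=.
by rewrite !ffunE linearP.
Qed.
HB.instance Definition _ := GRing.isLinear.Build k A k^o _ scounit scounit_linear.

Lemma scounit_monoid : monoid_morphism scounit.
Proof.
split=> [|a b]; rewrite /scounit.
  rewrite (bigD1 1%g) //= ffunE eqxx rmorph1 big1 ?addr0 // => g /negPf g1.
  by rewrite ffunE g1 rmorph0.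
rewrite mulr_suml.
under eq_bigr do rewrite smulE linear_sum.
rewrite exchange_big; apply: eq_bigr => h _; rewrite mulr_sumr.
rewrite (reindex (fun g => h * g)%g) /=; last first.
  by exists (fun g => h^-1 * g)%g => g _; rewrite ?mulKVg ?mulKg.
by apply: eq_bigr => g _; rewrite rmorphM /= mulKg ecounit_emap.
Qed.
HB.instance Definition _ := GRing.isMonoidMorphism.Build A k^o scounit scounit_monoid.

Lemma scounit_even b (a : A) :
  is_homog smash_superspace b a -> is_homog (base_superspace k) b (scounit a).
Proof. by move=> /shomogP ha; apply: homog_sum => g _; apply: ecounit_even. Qed.

Definition smash_counit : superalg_hom smash_superalgebra (base_superalgebra k) :=
  @SuperalgHom k smash_superalgebra (base_superalgebra k) scounit scounit_even.

End SmashSuper.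

Section Homs.
Variables (k : fieldType) (A : superalgebra k).

(* Homogeneous homomorphisms of parity p obey the sign rule
   f (a x) = (-1)^(p |a|) a f(x). *)
Definition hom_of_parity (X Y : lmodType k) (sX : supermodule A X)
    (sY : supermodule A Y) (p : bool) (f : X -> Y) : Prop :=
  [/\ linear f,
      forall b x, is_homog (sm_parity sX) b x -> is_homog (sm_parity sY) (p (+) b) (f x)
    & forall b a x, is_homog (sa_parity A) b a ->
        f (sm_act sX a x) = (-1) ^+ (p && b) *: sm_act sY a (f x)].

Definition super_hom (X Y : lmodType k) (sX : supermodule A X)
    (sY : supermodule A Y) (f : X -> Y) : Prop :=
  exists f0 f1, [/\ hom_of_parity sX sY false f0, hom_of_parity sX sY true f1
                  & forall x, f x = f0 x + f1 x].

Definition injective_supermodule (X : lmodType k) (sX : supermodule A X) : Prop :=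
  forall (Y Z : lmodType k) (sY : supermodule A Y) (sZ : supermodule A Z)
         (i : Y -> Z) (f : Y -> X),
    hom_of_parity sY sZ false i -> injective i -> hom_of_parity sY sX false f ->
    exists2 h : Z -> X, hom_of_parity sZ sX false h & forall y, h (i y) = f y.

Record injective_resolution (N : lmodType k) (sN : supermodule A N) :=
    InjectiveResolution {
  ir_obj :> nat -> lmodType k;
  ir_mod : forall i, supermodule A (ir_obj i);
  ir_d : forall i, ir_obj i -> ir_obj i.+1;
  ir_aug : N -> ir_obj 0;
  ir_injective : forall i, injective_supermodule (ir_mod i);
  ir_d_hom : forall i, hom_of_parity (ir_mod i) (ir_mod i.+1) false (ir_d (i := i));
  ir_aug_hom : hom_of_parity sN (ir_mod 0) false ir_aug;
  ir_aug_inj : injective ir_aug;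
  ir_exact0 : forall x, ir_d x = 0 <-> exists y, x = ir_aug y;
  ir_exact : forall i (x : ir_obj i.+1), ir_d x = 0 <-> exists y, x = ir_d y }.

(* Ext^n(M, N) is the n-th cohomology of the complex Hom(M, J) for an injective
   resolution J of N, i.e. ext_cocycle modulo ext_coboundary. *)
Section Ext.
Variables (M N : lmodType k) (sM : supermodule A M) (sN : supermodule A N).
Variable J : injective_resolution sN.

Definition ext_cocycle (n : nat) (f : M -> J n) : Prop :=
  super_hom sM (ir_mod J n) f /\ forall x, ir_d (f x) = 0.

Definition ext_coboundary (n : nat) : (M -> J n) -> Prop :=
  match n with
  | 0 => fun f => forall x, f x = 0
  | i.+1 => fun f => exists2 h : M -> J i,
      super_hom sM (ir_mod J i) h & forall x, f x = ir_d (h x)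
  end.
End Ext.

Section Yoneda.
Variables (N : lmodType k) (sN : supermodule A N) (J : injective_resolution sN).

(* A chain map J -> J[m]; the shifted complex has differential (-1)^m d. *)
Definition shifted_chain_map (p : bool) (m : nat) (F : forall j, J j -> J (j + m)%N) : Prop :=
  (forall j, hom_of_parity (ir_mod J j) (ir_mod J (j + m)%N) p (F j)) /\
  (forall j (x : J j), F j.+1 (ir_d x) = (-1) ^+ m *: ir_d (F j x)).

(* The algebra Ext(N, N) = (+)_n Ext^n(N, N) with the Yoneda product: if F is a
   chain map J -> J[m] extending the cocycle f : N -> J^m, the product of the
   classes of f and g is the class of F o g.  The axioms determine the algebra
   and the class maps up to a unique isomorphism. *)
Record yoneda_algebra := YonedaAlgebra {
  ya_alg :> algType k;
  ya_class : forall n, (N -> J n) -> ya_alg;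
  ya_class_linear : forall n t (f g : N -> J n),
    ext_cocycle sN f -> ext_cocycle sN g ->
    ya_class (fun x => t *: f x + g x) = t *: ya_class f + ya_class g;
  ya_class_eq0 : forall m (f : forall i, N -> J i),
    (forall i, ext_cocycle sN (f i)) ->
    (\sum_(i < m) ya_class (f i) = 0 <->
     forall i, (i < m)%N -> ext_coboundary sN (f i));
  ya_class_gen : forall h : ya_alg, exists m (f : forall i, N -> J i),
    (forall i, ext_cocycle sN (f i)) /\ h = \sum_(i < m) ya_class (f i);
  ya_class1 : 1 = @ya_class 0 (ir_aug J);
  ya_classM : forall m n p (f : N -> J m) (g : N -> J n) F,
    ext_cocycle sN f -> ext_cocycle sN g ->
    @shifted_chain_map p m F -> (forall x, F 0%N (ir_aug J x) = f x) ->
    ya_class f * ya_class g = @ya_class (n + m)%N (fun x => F n (g x)) }.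
End Yoneda.

(* Free of finite rank, which is no restriction on finite-dimensional modules. *)
Definition free_supermodule (X : lmodType k) (sX : supermodule A X) : Prop :=
  exists r (b : 'I_r -> X),
    (forall i, exists p, is_homog (sm_parity sX) p (b i)) /\
    (forall x, exists! c : {ffun 'I_r -> A}, x = \sum_i sm_act sX (c i) (b i)).

End Homs.

Section Spectrum.
Variable R : nzRingType.

Definition two_sided_ideal (K : R -> Prop) : Prop :=
  [/\ K 0, forall x y, K x -> K y -> K (x - y)
    & forall a x, K x -> K (a * x) /\ K (x * a)].

(* Max(R/I), for graded-commutative R/I: the maximal ideals of
   (R/I)/Nil(R/I), pulled back to R. *)
Definition in_Max (I K : R -> Prop) : Prop :=
  [/\ two_sided_ideal K,
      forall x m, I (x ^+ m) -> K x,
      ~ K 1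
    & forall L, two_sided_ideal L -> (forall x, K x -> L x) -> ~ L 1 ->
        forall x, L x -> K x].

Definition zero_ideal (x : R) : Prop := x = 0.
End Spectrum.

Arguments ext_coboundary {k A M N} sM {sN J n} _.
Arguments ya_class {k A N sN J} _ {n} _.
Arguments zero_ideal R x : clear implicits.

Section SupportVariety.
Variables (k : fieldType) (gT : finGroupType) (n : nat).
Variable rV : mx_representation k [set: gT] n.
Local Notation A := (smash_superalgebra rV).
Local Notation E := (exterior_superalgebra k n).
Local Notation kA := (trivial_supermodule (smash_counit rV)).
Local Notation kE := (trivial_supermodule (exterior_counit k n)).

(* The comparison of I (x) M with an injective resolution J of M, lifting
   k (x) M = M.  A linear map I^i (x) M -> J^i is given as a bilinear map; A is
   generated by V and G, so A-linearity is tested on the primitive odd elements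
   v and the group-like elements g. *)
Definition tensor_comparison (M : lmodType k) (sM : supermodule A M)
    (I : injective_resolution kA) (J : injective_resolution sM)
    (theta : forall i, I i -> M -> J i) : Prop :=
  [/\ forall i, (forall x, linear (theta i x)) /\ (forall m, linear ((theta i)^~ m)),
      forall i b c x m, is_homog (sm_parity (ir_mod I i)) b x ->
        is_homog (sm_parity sM) c m ->
        is_homog (sm_parity (ir_mod J i)) (b (+) c) (theta i x m),
      forall i b x m (v : 'cV[k]_n), is_homog (sm_parity (ir_mod I i)) b x ->
        sm_act (ir_mod J i) (sext rV (evec v)) (theta i x m) =
        theta i (sm_act (ir_mod I i) (sext rV (evec v)) x) m +
        (-1) ^+ b *: theta i x (sm_act sM (sext rV (evec v)) m),
      forall i x m (g : gT),
        sm_act (ir_mod J i) (sgrp rV g) (theta i x m) =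
        theta i (sm_act (ir_mod I i) (sgrp rV g) x) (sm_act sM (sgrp rV g) m)
    & (forall i x m, theta i.+1 (ir_d x) m = ir_d (theta i x m)) /\
      (forall c m, theta 0%N (ir_aug I c) m = ir_aug J (c *: m))].

(* I_A(M), the kernel of alpha |-> alpha (x) M : for a cocycle f : k -> I^i,
   [f] (x) M is the class of m |-> theta (f(1) (x) m) in Ext^i(M, M). *)
Definition support_ideal (M : lmodType k) (sM : supermodule A M)
    (I : injective_resolution kA) (J : injective_resolution sM)
    (theta : forall i, I i -> M -> J i) (H : yoneda_algebra I) (h : H) : Prop :=
  exists m (f : forall i, k^o -> I i),
    [/\ forall i, ext_cocycle kA (f i),
        h = \sum_(i < m) ya_class H (f i)
      & forall i, (i < m)%N -> ext_coboundary sM (fun x => theta i (f i 1) x)].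

(* The comparison of the restriction of I to Lambda(V) with an injective
   resolution over Lambda(V). *)
Definition restriction_comparison (I : injective_resolution kA)
    (L : injective_resolution kE) (tau : forall i, I i -> L i) : Prop :=
  [/\ forall i, hom_of_parity (restrict (sext_hom rV) (ir_mod I i)) (ir_mod L i) false (tau i),
      forall i x, tau i.+1 (ir_d x) = ir_d (tau i x)
    & forall c, tau 0%N (ir_aug I c) = ir_aug L c].

(* The canonical isomorphism S(V^* ) -> H(Lambda(V), k); in degree 1 it sends a
   linear form xi to the class of the extension of k by k on which v acts by
   xi(v), computed as the connecting map: if v y = xi(v) eta(1) in L^0, the class
   of 1 |-> d y. *)
Definition canonical_iso (L : injective_resolution kE) (HL : yoneda_algebra L)
    (kappa : {lrmorphism {mpoly k[n]} -> HL}) : Prop :=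
  bijective kappa /\
  forall i : 'I_n, exists2 y : L 0%N,
    forall v : 'cV[k]_n, sm_act (ir_mod L 0) (evec v) y = v i 0 *: ir_aug L 1
  & kappa 'X_i = ya_class HL (n := 1) (fun c => c *: ir_d y).

(* (g p)(v) = p (g^-1 v) *)
Definition poly_act (g : gT) (p : {mpoly k[n]}) : {mpoly k[n]} :=
  p \mPo [tuple \sum_j rV g^-1%g i j *: 'X_j | i < n].

(* The isomorphism H(Lambda(V) # kG, k) -> S(V^* )^G given by restriction to
   Lambda(V). *)
Definition restriction_iso (I : injective_resolution kA) (H : yoneda_algebra I)
    (L : injective_resolution kE) (HL : yoneda_algebra L)
    (tau : forall i, I i -> L i) (kappa : {lrmorphism {mpoly k[n]} -> HL})
    (Phi : {lrmorphism H -> {mpoly k[n]}}) : Prop :=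
  [/\ forall i (f : k^o -> I i), ext_cocycle kA f ->
        kappa (Phi (ya_class H f)) = ya_class HL (fun c => tau i (f c)),
      injective Phi
    & forall p, (exists h, p = Phi h) <-> (forall g, poly_act g p = p)].

Definition point_ideal (H : algType k) (Phi : {lrmorphism H -> {mpoly k[n]}})
    (v : 'cV[k]_n) (h : H) : Prop :=
  (Phi h).@[fun i => v i 0] = 0.

Definition same_orbit (v w : 'cV[k]_n) : Prop := exists g : gT, w = rV g *m v.

Definition zariski_closed (Z : 'cV[k]_n -> Prop) : Prop :=
  exists S : {mpoly k[n]} -> Prop,
    forall v, Z v <-> forall p, S p -> p.@[fun i => v i 0] = 0.

(* [v] |-> point_ideal Phi v is a homeomorphism from V/G (with the quotient of
   the Zariski topology) onto Max(H). *)
Definition orbit_space_homeo (H : algType k) (Phi : {lrmorphism H -> {mpoly k[n]}}) : Prop :=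
  [/\ forall v, in_Max (zero_ideal H) (point_ideal Phi v),
      forall K, in_Max (zero_ideal H) K ->
        exists v, forall h, K h <-> point_ideal Phi v h,
      forall v w, (forall h, point_ideal Phi v h <-> point_ideal Phi w h) <->
        same_orbit v w
    & forall Z : 'cV[k]_n -> Prop, (forall v w, same_orbit v w -> Z v -> Z w) ->
        (zariski_closed Z <->
         exists S : H -> Prop, forall v, Z v <-> forall h, S h -> point_ideal Phi v h)].

(* M regarded as a supermodule over k[t]/(t^2) = Lambda(k), with t acting as v. *)
Definition line_restriction (M : lmodType k) (sM : supermodule A M) (v : 'cV[k]_n) :
    supermodule (exterior_superalgebra k 1) M :=
  restrict (emap_hom v) (restrict (sext_hom rV) sM).

End SupportVariety.

Arguments support_ideal {k gT n rV M sM I J} theta H h.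

(* Main.v *)
(** A class in [Ext^j(k, k)] is carried by an invariant cocycle [z] of the
    [j]-th term of the resolution, on which the elements of [V] act by
    anticommuting operators [e_i] of square zero.  Put [D = \sum_i x_i e_i] and
    solve [z = d g_1], [D g_1 = d g_2], ..., [D g_j = eta p]: the end of this
    zigzag is a form [p] of degree [j] on [V], the symbol of [z].  The terms of
    the resolution are injective, so the [e_i] have contractions and the Koszul
    complex with differential [D] is exact in positive degrees; hence every form
    arises, and [z] is a coboundary when [p = 0].  Averaging over [G] identifies
    the image with the invariants, and the Nullstellensatz and separation of
    orbits give [Max = V/G].

    Tensored with [M], the same zigzag ends at [p] times the identity of [M] in
    [End(M)], where [D] acts by supercommutators.  If [z (x) M] is a coboundary
    and [p(v) <> 0], then the identity is the supercommutator of [v] with some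
    operator, which means that [M] is free over [<v>].  Conversely, a
    contracting homotopy [S] for [v] makes [N = D S + S D] invertible at [v], and
    [q = det N] times the identity is a [D]-boundary over the polynomial ring, so
    the class with symbol [q] lies in the support ideal and does not vanish at
    [v]. *)
Require Import Defs.
From HB Require Import structures.
From mathcomp Require Import all_boot all_order all_algebra all_fingroup all_character.
From mathcomp Require Import boolp functions.
From mathcomp Require Import mpoly.
Set Implicit Arguments. Unset Strict Implicit. Unset Printing Implicit Defensive.
Import GRing.Theory.
Local Open Scope ring_scope.

(** * Zigzags and the Koszul complex *)

(** The zigzag is used in two forms. Over formal series with coefficients in the modules, Koszul
    exactness gives the existence statements: a cocycle with a prescribed symbol, a primitive of a
    cocycle with symbol 0. At a fixed point [v] the operator [D] becomes the action of [v]; signs,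
    uniqueness and products are checked there, and a form is recovered from its values because the
    field is infinite. The given resolutions are arbitrary, so the only access to them is through
    exactness, extension of maps and contractions.

    Injectivity is about even maps, and signs depend on parity. Both are handled by the parity
    involution [eps]: a sign rule becomes an identity between linear operators, and the odd part of
    an operator [s] is [(s - eps s eps) / 2]. Besides this 2, characteristic 0 is used for the
    integers inverted in the Koszul homotopy and for the order of [G].

    The isomorphism [kappa] is constructed as the inverse of the symbol map over [Lambda(V)];
    compatibility with restriction then says that restricting a cocycle does not change its
    symbol. *)

Section Zigzag.
Variables (T : nat -> Type) (W : Type).
Variables (d : forall j, T j -> T j.+1) (D : forall j, T j -> T j) (eta : W -> T 0%N).

(* [a = d g_1], [D g_1 = d g_2], ..., [D g_j = eta w]. *)
Fixpoint zigzag j : T j -> W -> Prop :=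
  match j with
  | 0 => fun a w => a = eta w
  | i.+1 => fun a w => exists2 g, d g = a & zigzag (D g) w
  end.
End Zigzag.

(** Naturality of the symbol, to be applied to the action of a group element, to restriction to
    [Lambda(V)] and to the tensor product with [M]. *)
Lemma zigzag_map (T T' : nat -> Type) (W W' : Type)
    (d : forall j, T j -> T j.+1) (D : forall j, T j -> T j) (eta : W -> T 0%N)
    (d' : forall j, T' j -> T' j.+1) (D' : forall j, T' j -> T' j) (eta' : W' -> T' 0%N)
    (phi : forall j, T j -> T' j) (psi : W -> W') :
  (forall j a, phi j.+1 (d j a) = d' j (phi j a)) ->
  (forall j a, phi j (D j a) = D' j (phi j a)) ->
  (forall w, phi 0%N (eta w) = eta' (psi w)) ->
  forall j a w, zigzag d D eta a w -> zigzag d' D' eta' (phi j a) (psi w).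
Proof.
move=> phid phiD phieta; elim=> [a w -> //|j IH a w [g <- gw]].
by exists (phi j g) => //; rewrite -phiD; apply: IH.
Qed.

(** The two triangles cancel. It serves for [D] squared, formally, at a point and for matrices. *)
Lemma sum_alternating (V : zmodType) n (F : 'I_n -> 'I_n -> V) :
  (forall i j, F i j = - F j i) -> (forall i, F i i = 0) -> \sum_i \sum_j F i j = 0.
Proof.
move=> FN F0.
rewrite (eq_bigr (fun i : 'I_n => \sum_(j < n | (j < i)%N) F i j + \sum_(j < n | (i < j)%N) F i j)).
  rewrite big_split /= [X in _ + X](exchange_big_dep xpredT) //= -big_split /= big1 //.
  by move=> i _; rewrite -big_split big1 //= => j _; rewrite FN addNr.
move=> i _; rewrite (bigID (fun j : 'I_n => (j < i)%N)) /=; congr (_ + _).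
rewrite (bigD1 i) ?ltnn //= F0 add0r; apply: eq_bigl => j.
by rewrite -leqNgt [RHS]ltn_neqAle andbC eq_sym.
Qed.

Section Koszul.
Variables (k : fieldType) (n : nat) (X : lmodType k).
Implicit Types (c : 'X_{1..n} -> X) (m : 'X_{1..n}) (t : seq 'I_n).

(* Formal series c = \sum_m c(m) x^m with coefficients in X. *)
Definition kdiff (e : 'I_n -> {linear X -> X}) c : 'X_{1..n} -> X :=
  fun m => \sum_i if (0 < m i)%N then e i (c (m - U_(i))%MM) else 0.

Definition hdeg j c := forall m, mdeg m != j -> c m = 0.

Definition hpart j c : 'X_{1..n} -> X := fun m => if mdeg m == j then c m else 0.

Variable e : 'I_n -> {linear X -> X}.

Lemma kdiff_linear : linear (kdiff e).
Proof.
move=> a c c'; apply/funext => m.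
transitivity (a *: kdiff e c m + kdiff e c' m) => //.
rewrite /kdiff scaler_sumr -big_split; apply: eq_bigr => i _ /=.
by case: ifP => _; rewrite ?linearP // scaler0 addr0.
Qed.
HB.instance Definition _ := GRing.isLinear.Build k ('X_{1..n} -> X) ('X_{1..n} -> X) _
  (kdiff e) kdiff_linear.

Lemma mdegB1 m i : (0 < m i)%N -> mdeg (m - U_(i)) = (mdeg m).-1.
Proof.
move=> mi; have le : (U_(i) <= m)%MM by rewrite lep1mP -lt0n.
by rewrite -{2}(submK le) mdegD mdeg1 addn1.
Qed.

Lemma hpart_kdiff j c : kdiff e (hpart j c) = hpart j.+1 (kdiff e c).
Proof.
apply/funext => m; rewrite /kdiff /hpart; case: (eqVneq (mdeg m) j.+1) => mj.
  by apply: eq_bigr => i _; case: ifP => // mi; rewrite mdegB1 // mj eqxx.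
rewrite big1 // => i _; case: ifP => // mi; rewrite mdegB1 //.
case: eqP => [ej|]; last by rewrite linear0.
case/eqP: mj; rewrite -ej prednK //.
by apply: leq_trans mi _; rewrite mdegE (bigD1 i) //= leq_addr.
Qed.

Lemma hdeg_hpart j c : hdeg j (hpart j c).
Proof. by move=> m /negPf mj; rewrite /hpart mj. Qed.

Lemma hpart_hdeg j c : hdeg j c -> hpart j c = c.
Proof. by move=> hc; apply/funext => m; rewrite /hpart; case: eqP => // /eqP/hc. Qed.

Lemma hdeg_kdiff j c : hdeg j c -> hdeg j.+1 (kdiff e c).
Proof. by move=> /hpart_hdeg <-; rewrite hpart_kdiff; apply: hdeg_hpart. Qed.

Hypothesis e_anti : forall i j x, e i (e j x) = - e j (e i x).
Hypothesis e_sq : forall i x, e i (e i x) = 0.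

Lemma kdiffK c : kdiff e (kdiff e c) = 0.
Proof.
apply/funext => m; rewrite /kdiff.
(* The bound on [U_(i) + U_(j)] makes the range symmetric in [i] and [j], which the nested
   conditions are not. *)
pose F i j := if (U_(i) + U_(j) <= m)%MM then e i (e j (c (m - U_(i) - U_(j))%MM)) else 0.
transitivity (\sum_i \sum_j F i j).
  apply: eq_bigr => i _; case: ifP => mi; last first.
    rewrite big1 // => j _; rewrite /F; case: ifP => // le.
    by move/mnm_lepP/(_ i): le; rewrite !mnmE eqxx; case: (m i) mi.
  rewrite linear_sum; apply: eq_bigr => j _; rewrite /F.
  have -> : (U_(i) + U_(j) <= m)%MM = (0 < (m - U_(i))%MM j)%N.
    rewrite lt0n -lep1mP; apply/mnm_lepP/mnm_lepP => H l; have := H l; rewrite !mnmE => Hl.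
      by rewrite leq_subRL // (leq_trans _ Hl) // leq_addr.
    case: (eqVneq i l) Hl => [<-|_]; rewrite ?subn0 //=.
    by move=> h; rewrite -(subnKC mi) leq_add2l.
  by case: ifP => //= _; rewrite linear0.
apply: sum_alternating => [i j|i]; last by rewrite /F e_sq; case: ifP.
rewrite /F [(U_(j) + _)%MM]addmC; case: ifP => _; rewrite ?oppr0 // e_anti.
have -> : (m - U_(i) - U_(j) = m - U_(j) - U_(i))%MM by apply/mnmP => l; rewrite !mnmE subnAC.
by [].
Qed.

Variable iota : 'I_n -> {linear X -> X}.
Hypothesis clifford : forall i j x, e i (iota j x) + iota j (e i x) = (i == j)%:R *: x.

(** The operator [\sum_i iota_i d/dx_i]; the coefficient is the exponent brought down by
    differentiation. *)
Definition khom c : 'X_{1..n} -> X :=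
  fun m => \sum_i (m i).+1%:R *: iota i (c (m + U_(i))%MM).

Definition knum x := \sum_i iota i (e i x).

(** The [e_i], [iota_i] satisfy Clifford relations and the [x_i], [d/dx_i] Weyl relations, so only
    the terms with [i = j] survive. They give [m_i (e_i iota_i + iota_i e_i) + iota_i e_i], that is,
    the exponent [m_i] and one term of [knum]. *)
Lemma khomP c m :
  kdiff e (khom c) m + khom (kdiff e c) m = (mdeg m)%:R *: c m + knum (c m).
Proof.
rewrite /kdiff /khom.
pose F i j := (m j).+1%:R *: (if (0 < (m + U_(j))%MM i)%N then e i (iota j (c (m + U_(j) - U_(i))%MM)) else 0) : X.
transitivity (\sum_i (m i)%:R *: e i (iota i (c m)) +
  \sum_i (m i).+1%:R *: iota i (e i (c m)) : X); last first.
  rewrite mdegE natr_sum scaler_suml /knum -!big_split /=; apply: eq_bigr => i _.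
  have /esym := clifford i i (c m); rewrite eqxx scale1r => cE; rewrite [X in _ = _ *: X + _]cE.
  by rewrite scalerDr -addrA -natr1 scalerDl scale1r.
(* [G] and [G'] collect the terms with [i != j] of the two compositions; they are opposite by the
   Clifford relation. *)
pose G i j : X := if (i != j) && (0 < m i)%N then
   (m j).+1%:R *: e i (iota j (c (m + U_(j) - U_(i))%MM)) else 0.
pose G' i j : X := if (i != j) && (0 < m i)%N then
   (m j).+1%:R *: iota j (e i (c (m + U_(j) - U_(i))%MM)) else 0.
have GG i j : G i j + G' i j = 0.
  rewrite /G /G'; case: ifP => [/andP[ij _]|_]; last by rewrite addr0.
  by rewrite -scalerDr clifford (negPf ij) scale0r scaler0.
transitivity (\sum_i ((m i)%:R *: e i (iota i (c m)) + \sum_j G i j) +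
   \sum_i ((m i).+1%:R *: iota i (e i (c m)) + \sum_j G' j i) : X); last first.
  rewrite !big_split /= addrACA [X in _ + X](_ : _ = 0) ?addr0 //.
  rewrite [X in _ + X]exchange_big -big_split big1 //= => i _.
  by rewrite -big_split big1 //= => j _; rewrite GG.
congr (_ + _); apply: eq_bigr => i _.
  case: ifPn => [mi|]; last first.
    rewrite -eqn0Ngt => /eqP mi; rewrite mi scale0r add0r big1 // => j _.
    by rewrite /G mi andbF.
  have Gii : G i i = 0 by rewrite /G eqxx.
  rewrite linear_sum (bigD1 i) //= [in RHS](bigD1 i) //= Gii add0r.
  have le : (U_(i) <= m)%MM by rewrite lep1mP -lt0n.
  congr (_ + _).
    by rewrite submK // linearZ /= mnmBE mnm1E eqxx subn1 prednK.
  apply: eq_bigr => j ji; rewrite /G eq_sym ji mi /= linearZ /= mnmBE mnm1E eq_sym (negPf ji) subn0.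
  congr (_ *: e i (iota j (c _))); apply/mnmP => l; rewrite !mnmE.
  by rewrite addnBAC //; case: eqP => // <-.
have Gii : G' i i = 0 by rewrite /G' eqxx.
rewrite linear_sum scaler_sumr (bigD1 i) //= [in RHS](bigD1 i) //= Gii add0r.
congr (_ + _); first by rewrite mnmDE mnm1E eqxx addn1 /= addmK.
apply: eq_bigr => j ji; rewrite /G' ji mnmDE mnm1E eq_sym (negPf ji) addn0 /=.
by case: ifP => _; rewrite ?linear0 ?scaler0.
Qed.

Lemma knumE i x : e i (knum x) = knum (e i x) + e i x.
Proof.
have {2}-> : e i x = \sum_j (i == j)%:R *: e j x.
  rewrite (bigD1 i) //= eqxx scale1r big1 ?addr0 // => j /negPf ji.
  by rewrite eq_sym ji scale0r.
rewrite /knum linear_sum -big_split; apply: eq_bigr => j _ /=.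
by rewrite -(clifford i j (e j x)) (e_anti j i) linearN addrCA addNr addr0.
Qed.

(* Applying N - (p-1) lowers by one the length p of the products of the e_i
   that kill x, so N is a root of T (T-1) ... (T-n). *)
Definition kills p x := forall t, size t = p -> foldr (fun i => e i) x t = 0.

Lemma killsE p x : kills p.+1 x -> kills p (knum x - p%:R *: x).
Proof.
move=> kx t tp.
have E y : foldr (fun i => e i) (knum y) t =
    knum (foldr (fun i => e i) y t) + (size t)%:R *: foldr (fun i => e i) y t.
  elim: t {tp} => [|i t IH] /=; first by rewrite scale0r addr0.
  by rewrite IH linearD linearZ /= knumE -addrA -natr1 scalerDl scale1r [e i _ + _]addrC.
have F y z : foldr (fun i => e i) (y - p%:R *: z) t =
   foldr (fun i => e i) y t - p%:R *: foldr (fun i => e i) z t.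
  by elim: t {tp E} => //= i t ->; rewrite linearB linearZ.
rewrite F E tp addrK /knum big1 // => i _.
by rewrite (_ : e i _ = 0) ?linear0 //; apply: (kx (i :: t)); rewrite /= tp.
Qed.

(** A word of length [n + 1] repeats a letter, and anticommuting brings the two copies together. *)
Lemma killsn x : kills n.+1 x.
Proof.
have mem i t : i \in t -> e i (foldr (fun i => e i) x t) = 0.
  elim: t => //= j t IH; rewrite inE; case: eqP => [-> _|_ /= it]; first exact: e_sq.
  by rewrite e_anti IH // linear0 oppr0.
have nu t : ~~ uniq t -> foldr (fun i => e i) x t = 0.
  elim: t => //= j t IH; rewrite negb_and negbK => /orP[/mem//|/IH->].
  by rewrite linear0.
move=> t tn; apply: nu; apply/negP => /card_uniqP ct.
have : (#|t| <= #|{: 'I_n}|)%N by apply: max_card.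
by rewrite ct tn card_ord ltnn.
Qed.

Hypothesis char0 : [pchar k] =i pred0.

(** On a cocycle of degree [j + 1] the homotopy gives [D (khom c) = (j + 1 + N) c] with [N = knum].
    Instead of splitting [X] into eigenspaces of [N], the induction replaces [c] by [(N - p) c],
    which is killed by shorter products of the [e_i] and is still a cocycle because
    [e_i N = (N + 1) e_i]. *)
Lemma koszul_exact j c : hdeg j.+1 c -> kdiff e c = 0 ->
  exists2 b, hdeg j b & kdiff e b = c.
Proof.
have nat0 p : p.+1%:R != 0 :> k by rewrite ((pcharf0P k).1 char0).
have hd b : hdeg j.+1 (kdiff e b) -> kdiff e b = kdiff e (hpart j b).
  by move=> /hpart_hdeg; rewrite hpart_kdiff.
suff H p c' : (forall m, kills p (c' m)) -> hdeg j.+1 c' -> kdiff e c' = 0 ->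
    exists b, kdiff e b = c'.
  move=> hc c0; have [m|b be] := H n.+1 c _ hc c0; first exact: killsn.
  exists (hpart j b); first exact: hdeg_hpart.
  by rewrite -hd be.
elim: p c' {hd} => [|p IH] {}c kc hc c0.
  exists 0; rewrite linear0; apply/esym/funext => m; exact: (kc m [::]).
have khc m : kdiff e (khom c) m = j.+1%:R *: c m + knum (c m).
  have := khomP c m; rewrite c0 [X in _ + X]big1 ?addr0 => [->|i _]; last first.
    by rewrite linear0 scaler0.
  by case: (eqVneq (mdeg m) j.+1) => [->//|/hc->]; rewrite !scaler0.
pose c1 : 'X_{1..n} -> X := fun m => knum (c m) - p%:R *: c m.
have knum0 : knum 0 = 0 by rewrite /knum big1 // => i _; rewrite !linear0.
have [|||b bc] := IH c1.
- by move=> m; apply: killsE.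
- by move=> m /hc cm; rewrite /c1 cm scaler0 subr0.
- apply/funext => m; transitivity (\sum_i (knum (if (0 < m i)%N then e i (c (m - U_(i))%MM) else 0)
     + (1 - p%:R) *: (if (0 < m i)%N then e i (c (m - U_(i))%MM) else 0))).
    apply: eq_bigr => i _; case: ifP => _; last by rewrite knum0 scaler0 addr0.
    by rewrite /c1 linearB linearZ /= knumE scalerBl scale1r addrA.
  rewrite big_split /= -scaler_sumr.
  have := congr1 (@^~ m) c0; rewrite {1}/kdiff => ->; rewrite scaler0 addr0.
  rewrite /knum exchange_big; apply: big1 => i _; rewrite -linear_sum /=.
  rewrite -linear_sum; have := congr1 (@^~ m) c0; rewrite {1}/kdiff => ->.
  by rewrite !linear0.
(* [D (khom c) - D b = (j + 1 + N) c - (N - p) c = (j + 1 + p) c]. *)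
exists ((j.+1 + p)%:R^-1 *: (khom c - b)).
rewrite linearZ linearB /= bc; apply/funext => m.
transitivity ((j.+1 + p)%:R^-1 *: (kdiff e (khom c) m - c1 m)) => //.
rewrite khc /c1 opprB [p%:R *: _ - _]addrC addrA addrK -scalerDl -natrD.
by rewrite scalerA mulVf ?scale1r // addSn nat0.
Qed.
End Koszul.

(** * Existence and indeterminacy of zigzags *)

Section ExactZigzag.
Variables (k : fieldType) (T : nat -> lmodType k) (W : lmodType k).
Variables (d : forall j, {linear T j -> T j.+1}) (D : forall j, {linear T j -> T j}).
Variables (eta : {linear W -> T 0%N}) (DW : {linear W -> W}).
Local Notation zz := (@zigzag T W d D eta).

Lemma zigzag_linear j (a b : T j) u w t :
  zz a u -> zz b w -> zz (t *: a + b) (t *: u + w).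
Proof.
elim: j a b => /= [|j IH] a b; first by move=> -> ->; rewrite linearP.
case=> g <- gu [h <- hw]; exists (t *: g + h); first by rewrite linearP.
by rewrite linearP; apply: IH.
Qed.

Lemma zigzag0 j : zz (0 : T j) 0.
Proof. by elim: j => [|j IH] /=; [|exists 0]; rewrite ?linear0. Qed.

Hypothesis dD : forall j (a : T j), d j (D j a) = D j.+1 (d j a).
Hypothesis etaD : forall w, eta (DW w) = D 0%N (eta w).
Hypothesis eta_inj : injective eta.
Hypothesis exact0 : forall a, d 0%N a = 0 -> exists w, a = eta w.
Hypothesis exactS : forall j (a : T j.+1), d j.+1 a = 0 -> exists b, a = d j b.

Hypothesis DD : forall j (a : T j), D j (D j a) = 0.

(** The zigzag can always be continued: [D g] is killed by [D], whose square is 0, and by [d], since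
    [d (D g) = D a = 0]. *)
Lemma zigzag_total j (a : T j) : d j a = 0 -> D j a = 0 -> exists2 w, DW w = 0 & zz a w.
Proof.
elim: j a => [|j IH] a da Da.
  have [w aw] := exact0 da; exists w => //.
  by apply: eta_inj; rewrite etaD -aw Da linear0.
have [g ag] := exactS da.
have [||w w0 gw] := IH (D j g); first by rewrite dD -ag.
  exact: DD.
by exists w => //; exists g.
Qed.

(** A diagram chase in which a primitive of [g] absorbs one step at a time. It confines the
    indeterminacy of the endpoint to the image of [D], which is 0 on the trivial module and carries
    the information about freeness on [End(M)]. *)
Lemma zigzag_inj j w : zz (0 : T j) w -> exists s, w = DW s.
Proof.
case: j => [|j] /=.
  by move=> e0; exists 0; rewrite linear0; apply: eta_inj; rewrite -e0 linear0.
case=> g; elim: j g => [|j IH] g dg /= gw.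
  have [s gs] := exact0 dg; exists s; apply: eta_inj.
  by rewrite -gw etaD -gs.
have [g' gg'] := exactS dg; case: gw => h dh hw.
apply: (IH (h - D j g')); first by rewrite linearB /= dD dh gg' subrr.
by rewrite linearB DD subr0.
Qed.
End ExactZigzag.

Section SeriesMap.
Variables (k : fieldType) (n : nat) (X Y : lmodType k) (f : {linear X -> Y}).

Definition smap (c : 'X_{1..n} -> X) : 'X_{1..n} -> Y := fun m => f (c m).

Lemma smap_linear : linear smap.
Proof. by move=> t c c'; apply/funext => m; rewrite /smap linearP. Qed.
HB.instance Definition _ := GRing.isLinear.Build k ('X_{1..n} -> X) ('X_{1..n} -> Y) _
  smap smap_linear.

Lemma smap_kdiff (eX : 'I_n -> {linear X -> X}) (eY : 'I_n -> {linear Y -> Y}) c :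
  (forall i x, f (eX i x) = eY i (f x)) -> smap (kdiff eX c) = kdiff eY (smap c).
Proof.
move=> fe; apply/funext => m; rewrite /smap /kdiff linear_sum.
by apply: eq_bigr => i _; case: ifP => _; rewrite ?linear0 ?fe.
Qed.

Definition sconst (x : X) : 'X_{1..n} -> X := fun m => if m == 0%MM then x else 0.

Lemma sconst_linear : linear sconst.
Proof.
move=> t c c'; apply/funext => m; rewrite /sconst.
transitivity (t *: (if m == 0%MM then c else 0) + (if m == 0%MM then c' else 0)) => //.
by case: eqP => // _; rewrite scaler0 addr0.
Qed.
HB.instance Definition _ := GRing.isLinear.Build k X ('X_{1..n} -> X) _ sconst sconst_linear.

Lemma hdeg_sconst x : hdeg 0 (sconst x).
Proof. by move=> m; rewrite mdeg_eq0 /sconst => /negPf->. Qed.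

Lemma hdeg0_sconst c : hdeg 0 c -> c = sconst (c 0%MM).
Proof.
move=> hc; apply/funext => m; rewrite /sconst; case: eqP => [->//|/eqP m0].
by apply: hc; rewrite mdeg_eq0.
Qed.

Lemma kdiff_U (e : 'I_n -> {linear X -> X}) c i : kdiff e c U_(i)%MM = e i (c 0%MM).
Proof.
have U0 : (U_(i) - U_(i) = 0 :> 'X_{1..n})%MM by apply/mnmP => l; rewrite !mnmE subnn.
rewrite /kdiff (bigD1 i) //= mnm1E eqxx /= U0 big1 ?addr0 // => j ji.
by rewrite mnm1E eq_sym (negPf ji).
Qed.

Lemma kdiff_sconst (e : 'I_n -> {linear X -> X}) x i : kdiff e (sconst x) U_(i)%MM = e i x.
Proof. by rewrite kdiff_U /sconst eqxx. Qed.

Lemma kdiff_sconst0 (e : 'I_n -> {linear X -> X}) x :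
  (forall i, e i x = 0) -> kdiff e (sconst x) = 0.
Proof.
move=> ex; apply/funext => m; apply: big1 => i _; rewrite /sconst.
by case: ifP => // _; case: ifP => _; rewrite ?ex ?linear0.
Qed.
End SeriesMap.

Lemma smap_sconst (k : fieldType) n (X Y : lmodType k) (f : {linear X -> Y}) x :
  smap f (sconst x) = @sconst k n Y (f x).
Proof. by apply/funext => m; rewrite /smap /sconst; case: ifP => // _; rewrite linear0. Qed.

Lemma smap_hpart (k : fieldType) n (X Y : lmodType k) (f : {linear X -> Y}) j
    (c : 'X_{1..n} -> X) : smap f (hpart j c) = hpart j (smap f c).
Proof. by apply/funext => m; rewrite /smap /hpart; case: ifP => // _; rewrite linear0. Qed.

(* A resolution of W by modules with anticommuting operators e_i of square 0;
   the restriction of a resolution to Lambda(k^n), forgetting the gradings. *)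
Record eresolution (k : fieldType) (n : nat) := EResolution {
  er_obj :> nat -> lmodType k;
  er_base : lmodType k;
  er_d : forall j, {linear er_obj j -> er_obj j.+1};
  er_eta : {linear er_base -> er_obj 0%N};
  er_e : forall j, 'I_n -> {linear er_obj j -> er_obj j};
  er_eb : 'I_n -> {linear er_base -> er_base};
  er_anti : forall j i l x, er_e j i (er_e j l x) = - er_e j l (er_e j i x);
  er_sq : forall j i x, er_e j i (er_e j i x) = 0;
  er_d_e : forall j i x, er_d j (er_e j i x) = er_e j.+1 i (er_d j x);
  er_eta_e : forall i w, er_eta (er_eb i w) = er_e 0%N i (er_eta w);
  er_eta_inj : injective er_eta;
  er_d_eta : forall w, er_d 0%N (er_eta w) = 0;
  er_dd : forall j x, er_d j.+1 (er_d j x) = 0;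
  er_exact0 : forall x, er_d 0%N x = 0 -> exists w, x = er_eta w;
  er_exact : forall j x, er_d j.+1 x = 0 -> exists y, x = er_d j y }.

Section EResolutionTheory.
Variables (k : fieldType) (n : nat) (X : eresolution k n).
Local Notation W := (er_base X).
Local Notation series Y := ('X_{1..n} -> Y).

Definition szigzag j (a : series (X j)) (w : series W) : Prop :=
  @zigzag (fun j => series (X j)) (series W)
    (fun j => smap (er_d X j)) (fun j => kdiff (er_e X j)) (smap (er_eta X)) j a w.

Lemma ser_exact0 (a : series (X 0%N)) : smap (er_d X 0) a = 0 -> exists w, a = smap (er_eta X) w.
Proof.
move=> da; have /choice[w aw] : forall m, exists w, a m = er_eta X w.
  by move=> m; apply: er_exact0; have := congr1 (@^~ m) da.
by exists w; apply/funext.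
Qed.

Lemma ser_exact j (a : series (X j.+1)) :
  smap (er_d X j.+1) a = 0 -> exists b, a = smap (er_d X j) b.
Proof.
move=> da; have /choice[w aw] : forall m, exists w, a m = er_d X j w.
  by move=> m; apply: er_exact; have := congr1 (@^~ m) da.
by exists w; apply/funext.
Qed.

Lemma szigzag_total j (a : series (X j)) :
  smap (er_d X j) a = 0 -> kdiff (er_e X j) a = 0 ->
  exists2 w, kdiff (er_eb X) w = 0 & szigzag a w.
Proof.
apply: (@zigzag_total _ (fun j => series (X j)) (series W)
    (fun j => smap (er_d X j)) (fun j => kdiff (er_e X j)) (smap (er_eta X)) (kdiff (er_eb X))).
- by move=> i b; apply: smap_kdiff => l x; rewrite er_d_e.
- by move=> w; apply: smap_kdiff => l x; rewrite er_eta_e.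
- move=> u w uw; apply/funext => m; apply: (@er_eta_inj _ _ X).
  by have := congr1 (@^~ m) uw.
- exact: ser_exact0.
- exact: ser_exact.
- by move=> i b; apply: kdiffK; [apply: er_anti | apply: er_sq].
Qed.

(** Each of the [j] steps applies [D] once and raises the degree by one, hence the shift. *)
Lemma szigzag_hpart j i (a : series (X j)) w :
  szigzag a w -> szigzag (hpart i a) (hpart (i + j)%N w).
Proof.
elim: j i a => [|j IH] i a /=; first by rewrite addn0 => ->; rewrite smap_hpart.
case=> g <- gw; exists (hpart i g); first by rewrite smap_hpart.
by rewrite hpart_kdiff addnS -addSn; apply: IH.
Qed.

Hypothesis koszul : forall j i (c : series (X j)), hdeg i.+1 c -> kdiff (er_e X j) c = 0 ->
  exists2 b, hdeg i b & kdiff (er_e X j) b = c.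

(** The zigzag is climbed from its end: [D g = a] is solved by Koszul exactness and [a] is replaced
    by [d g]. The degree drops by one each time, so after [j] steps the series is constant, and
    being killed by [D] then means being killed by every [e_i]. *)
Lemma szigzag_surj j w : hdeg j w -> kdiff (er_eb X) w = 0 ->
  exists z : X j, [/\ er_d X j z = 0, forall i, er_e X j i z = 0 & szigzag (sconst z) w].
Proof.
move=> hw w0.
suff H i : (i <= j)%N -> exists a : series (X i),
    [/\ hdeg (j - i)%N a, smap (er_d X i) a = 0, kdiff (er_e X i) a = 0 & szigzag a w].
  have [a [ha da ea aw]] := H j (leqnn j); rewrite subnn in ha.
  move: da ea aw; rewrite (hdeg0_sconst ha) => da ea aw; exists (a 0%MM); split=> // [|i].
    by have := congr1 (@^~ 0%MM) da; rewrite /smap /sconst eqxx.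
  by have := congr1 (@^~ U_(i)%MM) ea; rewrite kdiff_sconst.
elim: i => [_|i IH ij].
  exists (smap (er_eta X) w); split=> //.
  - by rewrite subn0 => m /hw; rewrite /smap => ->; rewrite linear0.
  - by apply/funext => m; rewrite /smap er_d_eta.
  - by rewrite -(@smap_kdiff _ _ _ _ _ (er_eb X)) ?w0 ?linear0 // => l x; rewrite er_eta_e.
have [a [ha da ea aw]] := IH (ltnW ij).
have ji : (j - i = (j - i.+1).+1)%N by rewrite subnS prednK // subn_gt0.
rewrite ji in ha; have [g hg ga] := koszul ha ea.
exists (smap (er_d X i) g); split.
- by move=> m /hg; rewrite /smap => ->; rewrite linear0.
- by apply/funext => m; rewrite /smap er_dd.
- by rewrite -(@smap_kdiff _ _ _ _ _ (er_e X i)) ?ga // => l x; rewrite er_d_e.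
- by exists g => //; rewrite ga.
Qed.

(* If w = D s, the zigzag can be shifted, column by column, into the image of
   D, which is 0 in the last column. *)
Lemma szigzag_boundary j (z : X j.+1) w s : szigzag (sconst z) w -> w = kdiff (er_eb X) s ->
  exists2 h : X j, z = er_d X j h & forall i, er_e X j i h = 0.
Proof.
move=> zw ws.
(* In positive degree, a series whose zigzag ends in a boundary is [D y] with [d y = 0]. Applied to
   [D g'], this corrects [g'] to a constant series that [D] kills and [d] still sends to [z]. *)
suff H l i (a : series (X l)) s' : hdeg i.+1 a -> szigzag a (kdiff (er_eb X) s') ->
    exists2 y, smap (er_d X l) y = 0 & kdiff (er_e X l) y = a.
  case: zw => g dg gw; pose g' := hpart 0 g.
  have dg' : smap (er_d X j) g' = sconst z.
    by rewrite smap_hpart dg hpart_hdeg //; apply: hdeg_sconst.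
  have g'w : szigzag (kdiff (er_e X j) g') (kdiff (er_eb X) (hpart j s)).
    by rewrite !hpart_kdiff -ws -add1n; apply: szigzag_hpart.
  have [|y dy yg] := H _ 0%N _ _ _ g'w; first exact/hdeg_kdiff/hdeg_hpart.
  pose h := hpart 0 (g' - y).
  have hh : hdeg 0 h by apply: hdeg_hpart.
  have dh : smap (er_d X j) h = sconst z.
    by rewrite smap_hpart linearB /= dy subr0 dg' hpart_hdeg //; apply: hdeg_sconst.
  have eh : kdiff (er_e X j) h = 0.
    rewrite hpart_kdiff linearB /= yg subrr.
    by apply/funext => m; rewrite /hpart; case: ifP.
  move: dh eh; rewrite (hdeg0_sconst hh) => dh eh; exists (h 0%MM) => [|i].
    by have := congr1 (@^~ 0%MM) dh; rewrite /smap /sconst eqxx.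
  by have := congr1 (@^~ U_(i)%MM) eh; rewrite kdiff_sconst.
elim: l i a s' {z w s zw ws} => [|l IH] i a s ha /=.
  move=> ->; exists (smap (er_eta X) s).
    by apply/funext => m; rewrite /smap er_d_eta.
  by rewrite -(@smap_kdiff _ _ _ _ _ (er_eb X)) // => l x; rewrite er_eta_e.
case=> g0 dg0 gs0; pose g := hpart i.+1 g0.
have dg : smap (er_d X l) g = a by rewrite smap_hpart dg0 hpart_hdeg.
have gs : szigzag (kdiff (er_e X l) g) (kdiff (er_eb X) (hpart (i.+1 + l)%N s)).
  by rewrite !hpart_kdiff -addSn; apply: szigzag_hpart.
have [|y0 dy0 yg0] := IH i.+1 _ _ _ gs; first exact/hdeg_kdiff/hdeg_hpart.
pose y := hpart i.+1 y0.
have dy : smap (er_d X l) y = 0.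
  by rewrite smap_hpart dy0; apply/funext => m; rewrite /hpart; case: ifP.
have yg : kdiff (er_e X l) y = kdiff (er_e X l) g.
  by rewrite hpart_kdiff yg0 hpart_hdeg //; apply/hdeg_kdiff/hdeg_hpart.
have [||h hh hgy] := @koszul l i (g - y).
- move=> m mi; transitivity (g m - y m) => //.
  have hg0 : g m = 0 by apply: hdeg_hpart mi.
  have hy0 : y m = 0 by apply: hdeg_hpart mi.
  by rewrite hg0 hy0 subrr.
- by rewrite linearB /= yg subrr.
(* Here [g - y = D h], so [D (d h) = d (g - y) = a]. *)
exists (smap (er_d X l) h); first by apply/funext => m; rewrite /smap er_dd.
rewrite -(@smap_kdiff _ _ _ _ _ (er_e X l)) ?hgy; last by move=> p x; rewrite er_d_e.
by rewrite linearB /= dy subr0.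
Qed.

End EResolutionTheory.

(** * Evaluation of series and zigzags at a point of V *)

Section Evaluation.
Variables (k : fieldType) (n : nat) (v : 'I_n -> k).
Local Notation series Y := ('X_{1..n} -> Y).

Definition vact (X : lmodType k) (e : 'I_n -> {linear X -> X}) (x : X) : X :=
  \sum_i v i *: e i x.

Lemma vact_linear X e : linear (@vact X e).
Proof.
move=> t x y; rewrite /vact scaler_sumr -big_split; apply: eq_bigr => i _ /=.
by rewrite linearP scalerDr !scalerA mulrC.
Qed.
HB.instance Definition _ (X : lmodType k) e := GRing.isLinear.Build k X X _ (@vact X e) (@vact_linear X e).

Lemma vactK (X : lmodType k) (e : 'I_n -> {linear X -> X}) x :
  (forall i j x, e i (e j x) = - e j (e i x)) -> (forall i x, e i (e i x) = 0) ->
  vact e (vact e x) = 0.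
Proof.
move=> e_anti e_sq; rewrite /vact.
under eq_bigr => i _ do rewrite linear_sum scaler_sumr.
apply: sum_alternating => [i j|i]; rewrite !linearZ /= ?e_sq ?scaler0 //.
by rewrite e_anti !scalerN !scalerA mulrC.
Qed.

(* The component of degree j of c, evaluated at v. *)
Definition kev (X : lmodType k) j (c : series X) : X :=
  \sum_(m : 'X_{1..n < j.+1} | mdeg m == j) (\prod_i v i ^+ m i) *: c m.

Lemma kev_linear X j : linear (@kev X j).
Proof.
move=> t x y; rewrite /kev scaler_sumr -big_split; apply: eq_bigr => i _ /=.
transitivity ((\prod_l v l ^+ i l) *: (t *: x i + y i)) => //.
by rewrite scalerDr !scalerA mulrC.
Qed.
HB.instance Definition _ (X : lmodType k) j :=
  GRing.isLinear.Build k (series X) X _ (@kev X j) (@kev_linear X j).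

Lemma kev_smap (X Y : lmodType k) (f : {linear X -> Y}) j c :
  kev j (smap f c) = f (kev j c).
Proof. by rewrite /kev linear_sum; apply: eq_bigr => m _; rewrite linearZ. Qed.

Lemma kev_sconst (X : lmodType k) (x : X) : kev 0 (sconst x) = x.
Proof.
have lt0 : (mdeg (0%MM : 'X_{1..n}) < 1)%N by rewrite mdeg0.
rewrite /kev (bigD1 (BMultinom lt0)) /= ?mdeg0 //.
rewrite /sconst eqxx big1 => [|i _]; last by rewrite mnm0E.
rewrite scale1r big1 ?addr0 // => m /andP[]; rewrite mdeg_eq0 => /eqP m0 /eqP[].
by apply/val_inj.
Qed.

Lemma kev_kdiff (X : lmodType k) (e : 'I_n -> {linear X -> X}) j c :
  kev j.+1 (kdiff e c) = vact e (kev j c).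
Proof.
rewrite /kev /vact /kdiff.
under eq_bigr => m _ do rewrite scaler_sumr.
rewrite exchange_big; apply: eq_bigr => i _.
rewrite linear_sum scaler_sumr /=.
rewrite (bigID (fun m : 'X_{1..n < j.+2} => 0 < m i)%N) /= [X in _ + X]big1 ?addr0; last first.
  by move=> m /andP[_ /negPf->]; rewrite scaler0.
have up (m : 'X_{1..n < j.+1}) : (mdeg (m + U_(i))%MM < j.+2)%N.
  by rewrite mdegD mdeg1 addn1 ltnS bmdeg.
have lt0 : (mdeg (0%MM : 'X_{1..n}) < j.+1)%N by rewrite mdeg0.
(* Division by [x_i]; the default value is irrelevant on monomials of degree [j + 1] divisible by
   [x_i]. *)
pose dn (m : 'X_{1..n < j.+2}) : 'X_{1..n < j.+1} := insubd (BMultinom lt0) (m - U_(i))%MM.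
rewrite (reindex_onto (fun m => BMultinom (up m)) dn) /=; last first.
  move=> m /andP[/eqP mj mi]; apply/val_inj => /=.
  by rewrite val_insubd mdegB1 // mj ltnSn submK // lep1mP -lt0n.
apply: eq_big => m.
  rewrite mdegD mdeg1 addn1 eqSS mnmDE mnm1E eqxx addn1 andbT.
  case: eqP => //= mj; apply/eqP/val_inj; rewrite val_insubd /= addmK.
  by rewrite bmdeg.
move=> _; rewrite mnmDE mnm1E eqxx addn1 /= addmK linearZ /= scalerA; congr (_ *: _).
under eq_bigr => l _ do rewrite mnmDE exprD mulrC.
rewrite big_split /= (bigD1 i) //= mnm1E eqxx expr1 big1 ?mulr1 //= => l li.
by rewrite mnm1E eq_sym (negPf li).
Qed.
End Evaluation.

Section EvaluatedZigzag.
Variables (k : fieldType) (n : nat) (X : eresolution k n) (v : 'I_n -> k).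

Definition vzigzag j (a : X j) (w : er_base X) : Prop :=
  @zigzag (fun j => X j) (er_base X) (fun j => er_d X j)
    (fun j => vact v (er_e X j)) (er_eta X) j a w.

Lemma szigzag_kev j i (a : 'X_{1..n} -> X j) w :
  szigzag a w -> vzigzag (kev v i a) (kev v (i + j)%N w).
Proof.
elim: j i a => [|j IH] i a /=; first by rewrite addn0 => ->; rewrite kev_smap.
case=> g <- gw; exists (kev v i g); first by rewrite kev_smap.
by rewrite -kev_kdiff addnS -addSn; apply: IH.
Qed.

Lemma vact_comm (Y Z : lmodType k) (f : {linear Y -> Z}) (eY : 'I_n -> {linear Y -> Y})
    (eZ : 'I_n -> {linear Z -> Z}) y :
  (forall i x, f (eY i x) = eZ i (f x)) -> f (vact v eY y) = vact v eZ (f y).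
Proof.
by move=> fe; rewrite linear_sum; apply: eq_bigr => i _; rewrite linearZ /= fe.
Qed.

Lemma vzigzag_inj j w : vzigzag (0 : X j) w -> exists s, w = vact v (er_eb X) s.
Proof.
apply: (@zigzag_inj k X (er_base X) (er_d X) (fun j => vact v (er_e X j)) (er_eta X)
  (vact v (er_eb X))).
- by move=> i b; apply: vact_comm => l x; rewrite er_d_e.
- by move=> u; apply: vact_comm => l x; rewrite er_eta_e.
- exact: er_eta_inj.
- exact: er_exact0.
- exact: er_exact.
- by move=> i b; apply: vactK; [apply: er_anti | apply: er_sq].
Qed.

Lemma vzigzag_linear j (a b : X j) u w t :
  vzigzag a u -> vzigzag b w -> vzigzag (t *: a + b) (t *: u + w).
Proof.
exact: (@zigzag_linear k X (er_base X) (er_d X) (fun j => vact v (er_e X j)) (er_eta X)).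
Qed.

Lemma vzigzag0 j : vzigzag (0 : X j) 0.
Proof.
exact: (@zigzag0 k X (er_base X) (er_d X) (fun j => vact v (er_e X j)) (er_eta X)).
Qed.
End EvaluatedZigzag.

Section PolynomialSeries.
Variables (k : fieldType) (n : nat).

Definition pser (X : lmodType k) (p : {mpoly k[n]}) (x : X) : 'X_{1..n} -> X :=
  fun m => p@_m *: x.

Lemma dhomog_msize_le j (p : {mpoly k[n]}) : p \is j.-homog -> (msize p <= j.+1)%N.
Proof.
move/dhomogP => hp; rewrite msizeE; elim: (msupp p) hp => [|m s IH] hp; first by rewrite big_nil.
rewrite big_cons geq_max hp ?mem_head // leqnn IH // => m' ms.
by apply: hp; rewrite inE ms orbT.
Qed.

Lemma kev_pser (X : lmodType k) (v : 'I_n -> k) j (p : {mpoly k[n]}) (x : X) :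
  p \is j.-homog -> kev v j (pser p x) = p.@[v] *: x.
Proof.
move=> hp; rewrite (mpolywE (dhomog_msize_le hp)) raddf_sum /= scaler_suml.
rewrite [RHS](bigID (fun m : 'X_{1..n < j.+1} => mdeg m == j)) /= [X in _ + X]big1 ?addr0.
  by apply: eq_bigr => m _; rewrite mevalZ mevalX -mpolywE ?dhomog_msize_le // mulrC scalerA.
by move=> m mj; rewrite (dhomog_nemf_coeff hp mj) scale0r meval0 scale0r.
Qed.

Lemma hdeg_pser (X : lmodType k) j (p : {mpoly k[n]}) (x : X) :
  p \is j.-homog -> hdeg j (pser p x).
Proof. by move=> hp m mj; rewrite /pser (dhomog_nemf_coeff hp mj) scale0r. Qed.

Lemma series_poly j (w : 'X_{1..n} -> k^o) : hdeg j w ->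
  exists2 p : {mpoly k[n]}, p \is j.-homog & w = pser p (1 : k^o).
Proof.
move=> hw; exists (\sum_(m : 'X_{1..n < j.+1} | mdeg m == j) w m *: 'X_[m]).
  by apply: rpred_sum => m mj; apply: rpredZ; rewrite dhomogX.
apply/funext => m; rewrite /pser raddf_sum /=.
under eq_bigr => m' _ do rewrite mcoeffZ mcoeffX.
have [mj|mj] := eqVneq (mdeg m) j; last first.
  rewrite hw // big1 ?scale0r // => m' /eqP m'j.
  by case: eqP => [mm|_]; rewrite ?mulr0 //; rewrite -mm m'j eqxx in mj.
have lt : (mdeg m < j.+1)%N by rewrite mj.
rewrite (bigD1 (BMultinom lt)) /= ?mj // eqxx mulr1 big1 ?addr0; first by rewrite [RHS]mulr1.
move=> m' /andP[_ /eqP nm]; case: eqP => [mm|]; rewrite ?mulr0 //.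
by case: nm; apply: val_inj.
Qed.
End PolynomialSeries.

(** * The Nullstellensatz in characteristic zero *)

Lemma natr_inj_char0 (k : fieldType) : [pchar k] =i pred0 -> injective (fun m : nat => m%:R : k).
Proof.
move=> char0; have H a b : (a <= b)%N -> a%:R = b%:R :> k -> a = b.
  move=> ab /esym/eqP; rewrite -subr_eq0 -natrB // ((pcharf0P k).1 char0) subn_eq0 => ba.
  by apply/eqP; rewrite eqn_leq ab ba.
by move=> a b ab; case/orP: (leq_total a b) => /H; [apply | move=> E; apply/esym/E].
Qed.

Lemma poly_eq0_eval (k : fieldType) (p : {poly k}) : [pchar k] =i pred0 ->
  (forall t, p.[t] = 0) -> p = 0.
Proof.
move=> char0 p0; apply/eqP/negPn/negP => pn0.
have := max_poly_roots pn0 (rs := [seq i%:R | i <- iota 0 (size p)]).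
rewrite size_map size_iota ltnn => H; apply/notF/H.
  by apply/allP => x _; apply/eqP/p0.
by rewrite map_inj_uniq ?iota_uniq //; apply: natr_inj_char0.
Qed.

(* The linear change of variables X_j |-> X_j + a_j X_n, after which p is monic
   in X_n up to a scalar for suitable a (Noether normalisation). *)
Section Twist.
Variables (k : fieldType) (n : nat) (a : 'I_n -> k).

Definition twist_var (i : 'I_n.+1) : {poly {mpoly k[n]}} :=
  if unlift ord_max i is Some j then ('X_j)%:P + (a j)%:MP *: 'X else 'X.

Definition twist (p : {mpoly k[n.+1]}) : {poly {mpoly k[n]}} :=
  mmap (polyC \o @mpolyC n k) twist_var p.

Definition twist_point (b : 'I_n -> k) t (i : 'I_n.+1) :=
  if unlift ord_max i is Some j then b j + a j * t else t.

Local Notation untwist_coef :=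
  (comp_mpoly [tuple ('X_(lift ord_max j) - a j *: 'X_ord_max : {mpoly k[n.+1]}) | j < n]).

Definition untwist (P : {poly {mpoly k[n]}}) : {mpoly k[n.+1]} :=
  (map_poly untwist_coef P).['X_ord_max].

Lemma untwist_monoid : monoid_morphism untwist.
Proof. by split => [|P Q]; rewrite /untwist ?rmorph1 ?hornerE // rmorphM hornerM. Qed.

Lemma untwist_zmod : zmod_morphism untwist.
Proof. by move=> P Q; rewrite /untwist rmorphB hornerE hornerN. Qed.
HB.instance Definition _ := GRing.isZmodMorphism.Build _ _ untwist untwist_zmod.
HB.instance Definition _ := GRing.isMonoidMorphism.Build _ _ untwist untwist_monoid.

Lemma untwistK p : untwist (twist p) = p.
Proof.
rewrite /twist /mmap rmorph_sum [RHS]mpolyE; apply: eq_bigr => m _.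
rewrite rmorphM /= /untwist map_polyC hornerC /= comp_mpolyC -mul_mpolyC; congr (_ * _).
rewrite -/(untwist _) rmorph_prod [RHS]mpolyXE_id; apply: eq_bigr => i _.
rewrite rmorphXn /=; congr (_ ^+ _); rewrite /twist_var.
case: unliftP => [j ->|->]; rewrite /untwist; last by rewrite map_polyX hornerX.
rewrite rmorphD /= map_polyC map_polyZ map_polyX /= !hornerE comp_mpolyXU comp_mpolyC.
by rewrite -tnth_nth tnth_mktuple mul_mpolyC subrK.
Qed.

Lemma twist_eval p b t : (map_poly (meval b) (twist p)).[t] = p.@[twist_point b t].
Proof.
rewrite -[LHS]/(horner_eval t (map_poly (meval b) (twist p))).
rewrite /twist /mmap !rmorph_sum mevalE; apply: eq_bigr => m _.
rewrite !rmorphM /= map_polyC horner_evalE hornerC /= mevalC; congr (_ * _).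
rewrite !rmorph_prod; apply: eq_bigr => i _; rewrite !rmorphXn /=; congr (_ ^+ _).
rewrite /twist_var /twist_point horner_evalE.
case: unliftP => [j _|_]; last by rewrite map_polyX hornerX.
by rewrite rmorphD /= map_polyC map_polyZ map_polyX /= !hornerE mevalXU mevalC.
Qed.

(** The value [c = 0] is allowed, so that leading terms multiply without any condition. *)
Definition top d (P : {poly {mpoly k[n]}}) c := (size P <= d.+1)%N /\ P`_d = c%:MP.

Lemma topM d e P Q c c' : top d P c -> top e Q c' -> top (d + e)%N (P * Q) (c * c').
Proof.
case=> sP cP [sQ cQ]; split.
  apply: leq_trans (size_polyMleq _ _) _.
  by rewrite -subn1 leq_subLR add1n -addnS -addSn; apply: leq_add.
have ltd : (d < (d + e).+1)%N by rewrite ltnS leq_addr.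
rewrite coefM (bigD1 (Ordinal ltd)) //= addKn cP cQ -mpolyCM big1 ?addr0 // => i ni.
case: (ltngtP d i) => [di|id|eid].
- by rewrite nth_default ?mul0r // (leq_trans sP).
- rewrite [Q`__]nth_default ?mulr0 // (leq_trans sQ) //.
  by rewrite ltn_subRL ltn_add2r.
- by case/eqP: ni; apply: val_inj.
Qed.

(** [twist_point (fun=> 0) 1] is the point with coordinates [a_j] and last coordinate 1. Each
    twisted variable has its coordinate there as coefficient of [X]. *)
Lemma top_mmap1 m : top (mdeg m) (mmap1 twist_var m) (\prod_i twist_point (fun=> 0) 1 i ^+ m i).
Proof.
rewrite mdegE /mmap1.
elim/big_rec3: _ => [|i d P c _]; first by split; rewrite ?size_poly1 // coef1.
apply: topM.
have var : top 1 (twist_var i) (twist_point (fun=> 0) 1 i).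
  rewrite /twist_var /twist_point; case: unliftP => [j _|_]; last first.
    by split; rewrite ?size_polyX // coefX.
  split; last by rewrite coefD coefC coefZ coefX /= add0r !mulr1 add0r.
  rewrite addrC -mul_polyC size_MXaddC; case: ifP => // _.
  by rewrite ltnS size_polyC_leq1.
elim: (m i) => [|q IH]; first by split; rewrite ?size_poly1 // coef1.
by rewrite !exprS -add1n; apply: topM.
Qed.

Lemma twist_top p d : (msize p <= d.+1)%N ->
  top d (twist p) (pihomog mdeg d p).@[twist_point (fun=> 0) 1].
Proof.
move=> sp.
have ltm m : m \in msupp p -> (mdeg m <= d)%N.
  by move=> /msize_mdeg_lt /leq_trans/(_ sp).
rewrite /twist /mmap /top; split.
  apply: leq_trans (size_sum _ _ _) _; apply/bigmax_leqP_seq => m mp _ /=.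
  rewrite mul_polyC; apply: leq_trans (size_scale_leq _ _) _.
  by have [sm _] := top_mmap1 m; apply: leq_trans sm _; rewrite ltnS ltm.
rewrite coef_sum pihomogE [in RHS]big_mkcond [X in X%:MP]raddf_sum [RHS]raddf_sum /=.
rewrite [LHS]big_seq [RHS]big_seq; apply: eq_bigr => m mp; rewrite mul_polyC coefZ.
have [sm cm] := top_mmap1 m; case: eqP => [<-|/eqP md].
  by rewrite cm mevalZ mevalX mpolyCM.
by rewrite nth_default ?mulr0 ?meval0 ?mpolyC0 // (leq_trans sm) // ltn_neqAle md ltm.
Qed.
End Twist.

Lemma mpoly_eq0_eval (k : fieldType) n (p : {mpoly k[n]}) : [pchar k] =i pred0 ->
  (forall v, p.@[v] = 0) -> p = 0.
Proof.
move=> char0; elim: n p => [|n IH] p p0.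
  by have := p0 (fun=> 0); rewrite (nvar0_mpolyC p) mevalC => ->; rewrite mpolyC0.
(* With [a = 0] the twist merely reads [p] as a polynomial in the last variable. *)
have tw0 : twist (fun=> 0) p = 0.
  apply/polyP => i; rewrite coef0; apply: IH => v.
  have P0 : map_poly (meval v) (twist (fun=> 0) p) = 0.
    by apply: (poly_eq0_eval char0) => t; rewrite twist_eval p0.
  by have := congr1 (fun P : {poly k} => P`_i) P0; rewrite coef_map coef0.
by rewrite -(untwistK (fun=> 0) p) tw0 rmorph0.
Qed.

Lemma mpoly_eval_inj (k : fieldType) n (p q : {mpoly k[n]}) : [pchar k] =i pred0 ->
  (forall v, p.@[v] = q.@[v]) -> p = q.
Proof.
move=> char0 pq; apply/eqP; rewrite -subr_eq0; apply/eqP/(mpoly_eq0_eval char0) => v.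
by rewrite mevalB pq subrr.
Qed.

Lemma exists_twist_monic (k : fieldType) n (p : {mpoly k[n.+1]}) : [pchar k] =i pred0 ->
  p != 0 -> exists a c, c != 0 /\ top (msize p).-1 (twist a p) c.
Proof.
move=> char0 p0; set d := (msize p).-1.
have sp : msize p = d.+1 by rewrite prednK // lt0n msize_poly_eq0.
pose q := pihomog mdeg d p.
have q0 : q != 0.
  apply/eqP => /(congr1 (mcoeff (mlead p))).
  rewrite mcoeff0 /q (pihomogwE _ _ (leqnn (msize p))) raddf_sum /=.
  have lt := mlead_deg p0; have ltm : (mdeg (mlead p) < msize p)%N by rewrite lt.
  rewrite (bigD1 (BMultinom ltm)) /=; last by rewrite /d -lt.
  rewrite mcoeffZ mcoeffX eqxx mulr1 big1 ?addr0.
    by apply/eqP; rewrite -mcoeff_msupp mlead_supp.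
  move=> m /andP[_ nm]; rewrite mcoeffZ mcoeffX; case: eqP => [E|]; rewrite ?mulr0 //.
  by case/eqP: nm; apply: val_inj.
(* Multiplying the top form by the last variable also forces the last coordinate of [x] to be
   nonzero. Then [x] can be scaled to last coordinate 1, and homogeneity of [q] preserves
   nonvanishing. *)
have [x] : exists x, (q * 'X_ord_max).@[x] != 0.
  have X0 : ('X_ord_max : {mpoly k[n.+1]}) != 0.
    by apply/eqP => /(congr1 (mcoeff U_(ord_max)%MM)); rewrite mcoeffX eqxx mcoeff0 => /eqP; rewrite oner_eq0.
  apply: contrapT => nx; have := mulf_neq0 q0 X0.
  case/eqP; apply: (mpoly_eq0_eval char0) => v; apply/eqP/negPn/negP => h.
  by apply: nx; exists v.
rewrite mevalM mevalXU mulf_eq0 negb_or => /andP[qx x0].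
pose a j := x (lift ord_max j) / x ord_max.
exists a, q.@[twist_point a (fun=> 0) 1].
split; last by apply: twist_top; rewrite sp.
apply: contra qx => /eqP qx; apply/eqP.
have -> : q.@[x] = x ord_max ^+ d * q.@[twist_point a (fun=> 0) 1].
  rewrite !mevalE mulr_sumr [LHS]big_seq [RHS]big_seq; apply: eq_bigr => m mq.
  rewrite mulrCA; congr (_ * _).
  have md : mdeg m = d by have /dhomogP/(_ m mq) := pihomogP mdeg d p.
  rewrite -[X in _ ^+ X]md.
  rewrite mdegE -prodrXr -big_split; apply: eq_bigr => i _ /=.
  rewrite -exprMn; congr (_ ^+ _); rewrite /twist_point.
  by case: unliftP => [j ->|->]; rewrite ?mulr1 // add0r mulrC divfK.
by rewrite qx mulr0.
Qed.

Definition cideal (R : comNzRingType) (J : R -> Prop) :=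
  [/\ J 0, forall x y, J x -> J y -> J (x + y) & forall r x, J x -> J (r * x)].

Lemma cideal_sum (R : comNzRingType) (J : R -> Prop) (T : Type) (r : seq T) (F : T -> R) :
  cideal J -> (forall i, J (F i)) -> J (\sum_(i <- r) F i).
Proof. by case=> J0 JD _ JF; elim/big_rec: _ => // i x _; apply: JD. Qed.

Section Fibre.
Variables (k : closedFieldType) (S : comNzRingType) (J : {poly S} -> Prop).
Variables (ev : {rmorphism S -> k}) (g : {poly S}).
Variable lift : {rmorphism k -> S}.
Hypothesis liftK : forall x, ev (lift x) = x.
Hypothesis idJ : cideal J.
Hypothesis Jg : J g.
Hypothesis g_monic : g \is monic.
Hypothesis ev0 : forall s, J s%:P -> ev s = 0.

(* The determinant trick: if f reduces to 1 in the fibre, multiplication by f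
   on S[X]/(g) has a matrix reducing to the identity, and its determinant
   lies in J. *)
Lemma fibre_proper f : J f -> map_poly ev f <> 1.
Proof.
move=> Jf f1; have [J0 JD JM] := idJ.
have J1 : ~ J 1 by move=> J1; have := ev0 J1; rewrite rmorph1 => /eqP; rewrite oner_eq0.
case sg : (size g).-1 => [|d].
  have gC : g = (g`_0)%:P by apply: size1_polyC; rewrite -sg leqSpred.
  by apply: J1; move: (monicP g_monic) Jg; rewrite gC lead_coefC => ->.
have sgE : size g = d.+2 by rewrite -sg prednK // lt0n size_poly_eq0 monic_neq0.
pose P (i : 'I_d.+1) := Pdiv.Ring.rmodp ('X^i * f) g.
have PE (i : 'I_d.+1) : 'X^i * f = Pdiv.Ring.rdivp ('X^i * f) g * g + P i.
  exact: Pdiv.RingMonic.rdivp_eq.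
have JP i : J (P i).
  have -> : P i = 'X^i * f + (- Pdiv.Ring.rdivp ('X^i * f) g) * g.
    by rewrite mulNr; apply/esym/eqP; rewrite subr_eq addrC -PE.
  by apply: JD; apply: JM.
have sP i : (size (P i) <= d.+1)%N.
  by have := Pdiv.Ring.ltn_rmodpN0 ('X^i * f) (monic_neq0 g_monic); rewrite sgE ltnS.
pose B := \matrix_(i < d.+1, j < d.+1) (P i)`_j.
have evB : map_mx ev B = 1%:M.
  apply/matrixP => i j; rewrite !mxE -coef_map.
  suff -> : map_poly ev (P i) = 'X^i by rewrite coefXn eq_sym.
  have g'm : map_poly ev g \is monic by apply: monic_map.
  have sg' : size (map_poly ev g) = d.+2.
    by rewrite size_map_poly_id0 // (monicP g_monic) rmorph1 oner_eq0.
  have E : 'X^i = map_poly ev (Pdiv.Ring.rdivp ('X^i * f) g) * map_poly ev g + map_poly ev (P i).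
    have := congr1 (map_poly ev) (PE i); rewrite rmorphD !rmorphM /= f1 mulr1.
    by rewrite map_polyXn.
  have small (q : {poly k}) : (size q <= d.+1)%N -> q %% map_poly ev g = q.
    by move=> sq; apply: modp_small; rewrite sg' ltnS.
  rewrite -[RHS]small ?size_polyXn ?ltn_ord // E modpD modp_mull add0r small //.
  by apply: leq_trans (size_poly _ _) (sP i).
have evdet : ev (\det B) = 1 by rewrite -det_map_mx evB det1.
have : J (\det B)%:P.
  have -> : (\det B)%:P = \sum_i ((\adj B) 0 i)%:P * P i.
    (* Row 0 of [\adj B *m B] is [(\det B, 0, ..., 0)]; read as the coefficients of a polynomial, it
       is the constant [\det B]. *)
    have -> : (\det B)%:P = \sum_j ((\adj B *m B) 0 j)%:P * 'X^j.
      rewrite mul_adj_mx (bigD1 0) //= mxE eqxx mulr1n expr0 mulr1 big1 ?addr0 // => j j0.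
      by rewrite mxE eq_sym (negPf j0) mulr0n polyC0 mul0r.
    under eq_bigr => j _ do rewrite mxE rmorph_sum mulr_suml.
    rewrite exchange_big; apply: eq_bigr => i _ /=.
    have -> : P i = \poly_(j < d.+1) (P i)`_j.
      by apply/polyP => j; rewrite coef_poly; case: ltnP => // dj; rewrite nth_default ?(leq_trans (sP i)).
    rewrite poly_def mulr_sumr; apply: eq_bigr => j _.
    by rewrite polyCM -mulrA [B i j]mxE [X in _ * X]mul_polyC.
  by apply: cideal_sum => // i; apply: JM.
by move/ev0; rewrite evdet => /eqP; rewrite oner_eq0.
Qed.

(** The image of [J] in [k[X]] is an ideal, [lift] providing preimages of the multipliers, and it is
    nonzero as [g] is monic. Its generator, a nonzero element of minimal size, is not a constant by
    [fibre_proper]; any root of it works. *)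
Lemma fibre_root : exists t, forall f, J f -> (map_poly ev f).[t] = 0.
Proof.
have [J0 JD JM] := idJ.
pose N d := `[< exists f, [/\ J f, map_poly ev f != 0 & size (map_poly ev f) = d] >].
have g'0 : map_poly ev g != 0 by apply/monic_neq0/monic_map.
have exN : exists d, N d by exists (size (map_poly ev g)); apply/asboolP; exists g.
have liftPK q : map_poly ev (map_poly lift q) = q.
  by apply/polyP => i; rewrite !coef_map /= liftK.
case: (ex_minnP exN) => d /asboolP[u [Ju u0 su]] min_d.
have dvd f : J f -> map_poly ev u %| map_poly ev f.
  move=> Jf; rewrite /dvdp; apply: contrapT => /negP r0.
  suff /min_d : N (size (map_poly ev f %% map_poly ev u)).
    by rewrite -su leqNgt ltn_modp u0.
  apply/asboolP; exists (f + (- map_poly lift (map_poly ev f %/ map_poly ev u)) * u).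
  have -> : map_poly ev (f + (- map_poly lift (map_poly ev f %/ map_poly ev u)) * u)
      = map_poly ev f %% map_poly ev u.
    rewrite rmorphD rmorphM rmorphN /= liftPK {1}(divp_eq (map_poly ev f) (map_poly ev u)).
    by rewrite mulNr addrAC subrr add0r.
  by split=> //; apply: JD => //; apply: JM.
have su1 : size (map_poly ev u) != 1%N.
  apply/negP => /size_poly1P[c c0 uc]; apply: (@fibre_proper ((lift c^-1)%:P * u)).
    exact: JM.
  by rewrite rmorphM /= map_polyC /= liftK uc -polyCM mulVf.
have [t ut] := closed_rootP _ su1; exists t => f /dvd /dvdpP[q ->].
by rewrite hornerM (rootP ut) mulr0.
Qed.
End Fibre.

(** Extension of zeros: the elimination ideal has a zero by induction on the number of variables,
    and a monic element of the twisted ideal ensures that this zero lifts. *)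
Theorem nullstellensatz (k : closedFieldType) n (J : {mpoly k[n]} -> Prop) :
  [pchar k] =i pred0 -> cideal J -> ~ J 1 -> exists v, forall p, J p -> p.@[v] = 0.
Proof.
move=> char0; elim: n J => [|n IH] J idJ J1.
  exists (fun=> 0) => p Jp; rewrite (nvar0_mpolyC p) mevalC; apply: contrapT => /eqP p0.
  apply: J1; have [_ _ JM] := idJ; have := JM (p@_0%MM)^-1%:MP _ Jp.
  by rewrite {2}(nvar0_mpolyC p) -mpolyCM mulVf // mpolyC1.
have [J0 JD JM] := idJ.
have [[p Jp p0]|nz] := pselect (exists2 p, J p & p != 0); last first.
  exists (fun=> 0) => p Jp; have [->|p0] := eqVneq p 0; first exact: meval0.
  by case: nz; exists p.
have [a [c [c0 [sP cP]]]] := exists_twist_monic char0 p0.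
pose JU (P : {poly {mpoly k[n]}}) := J (untwist a P).
have idJU : cideal JU.
  by split=> [|P Q|P Q]; rewrite /JU ?rmorph0 ?rmorphD ?rmorphM; [|apply: JD|apply: JM].
pose g := (c^-1)%:MP%:P * twist a p.
have Jg : JU g by rewrite /JU rmorphM /= untwistK; apply: JM.
have gm : g \is monic.
  have gd : g`_(msize p).-1 = 1 by rewrite coefCM cP -mpolyCM mulVf // mpolyC1.
  have sg : (size g <= (msize p).-1.+1)%N.
    by rewrite /g mul_polyC; apply: leq_trans (size_scale_leq _ _) sP.
  have sgE : size g = (msize p).-1.+1.
    apply/eqP; rewrite eqn_leq sg ltnNge; apply/negP => h.
    by move/eqP: gd; rewrite nth_default // eq_sym oner_eq0.
  by rewrite monicE lead_coefE sgE /= gd.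
have [||b Jb] := IH (fun s => JU s%:P).
- have [? JUD JUM] := idJU; split=> [//|s t Js Jt|s t Jt]; first by rewrite polyCD; apply: JUD.
  by rewrite polyCM; apply: JUM.
- by rewrite /JU rmorph1.
have [t Jt] := fibre_root (lift := @mpolyC n k) (fun x => mevalC b x) idJU Jg gm Jb.
exists (twist_point a b t) => q Jq; rewrite -twist_eval; apply: Jt.
by rewrite /JU untwistK.
Qed.

(** * Injective supermodules *)

HB.instance Definition _ (k : fieldType) (X : lmodType k) (sX : superspace X) b :=
  GRing.isLinear.Build k X X _ (spart sX b) (spart_linear sX b).
HB.instance Definition _ (k : fieldType) (A : superalgebra k) (X : lmodType k)
  (sX : supermodule A X) a := GRing.isLinear.Build k X X _ (sm_act sX a) (sm_linear_r sX a).

Section Involution.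
Variables (k : fieldType) (X : lmodType k) (sX : superspace X).

(* The parity involution x |-> (-1)^|x| x. *)
Definition eps x := spart sX false x - spart sX true x.

Lemma eps_linear : linear eps.
Proof. by move=> t x y; rewrite /eps !linearP /= scalerDr addrACA. Qed.
HB.instance Definition _ := GRing.isLinear.Build k X X _ eps eps_linear.

Lemma homog_spart b x : is_homog sX b (spart sX b x).
Proof. by rewrite /is_homog spartK eqxx. Qed.

Lemma spart_homog b c x : is_homog sX c x -> spart sX b x = if b == c then x else 0.
Proof. by move=> <-; rewrite spartK; case: eqP => // ->. Qed.

Lemma eps_homog b x : is_homog sX b x -> eps x = (-1) ^+ b *: x.
Proof.
move=> hx; rewrite /eps !(spart_homog _ hx); case: b {hx} => /=.
  by rewrite expr1 scaleN1r sub0r.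
by rewrite expr0 scale1r subr0.
Qed.

Lemma epsK : involutive eps.
Proof.
move=> x; rewrite {2}/eps linearB /= !(eps_homog (homog_spart _ _)).
by rewrite expr0 expr1 scale1r scaleN1r opprK spart_sum.
Qed.

Lemma spart_eps b x : 2%:R *: spart sX b x = x + (-1) ^+ b *: eps x.
Proof.
rewrite -{2}(spart_sum sX x) /eps scaler_nat mulr2n; case: b.
  by rewrite expr1 scaleN1r opprB [X in _ = X + _]addrC addrACA subrr addr0.
by rewrite expr0 scale1r addrACA subrr addr0.
Qed.

Lemma homog_eps (b : bool) x : [pchar k] =i pred0 -> eps x = (-1) ^+ b *: x -> is_homog sX b x.
Proof.
move=> char0 ex; apply: (scalerI (a := 2%:R)); first by rewrite ((pcharf0P k).1 char0).
by rewrite spart_eps ex scalerA -signr_addb addbb scale1r scaler_nat mulr2n.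
Qed.

Lemma homog_ind (P : X -> Prop) : (forall x y, P x -> P y -> P (x + y)) ->
  (forall b x, is_homog sX b x -> P x) -> forall x, P x.
Proof. by move=> PD Ph x; rewrite -(spart_sum sX x); apply: PD; apply: Ph (homog_spart _ _). Qed.
End Involution.

Section BundleLinear.
Variables (k : fieldType) (X Y : lmodType k) (f : X -> Y).

Definition lin (lf : linear f) : {linear X -> Y} := HB.pack f (GRing.isLinear.Build k X Y _ f lf).

Hypothesis lf : linear f.

Lemma lin0 : f 0 = 0. Proof. exact: (linear0 (lin lf)). Qed.
Lemma linD x y : f (x + y) = f x + f y. Proof. exact: (linearD (lin lf)). Qed.
Lemma linB x y : f (x - y) = f x - f y. Proof. exact: (linearB (lin lf)). Qed.
Lemma linZ a x : f (a *: x) = a *: f x. Proof. exact: (linearZ_LR (lin lf)). Qed.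
End BundleLinear.

Section HomOfParity.
Variables (k : fieldType) (A : superalgebra k) (X Y : lmodType k).
Variables (sX : supermodule A X) (sY : supermodule A Y).
Notation epsX := (eps (sm_parity sX)).
Notation epsY := (eps (sm_parity sY)).

Lemma hom_eps p (f : X -> Y) x : hom_of_parity sX sY p f -> epsY (f x) = (-1) ^+ p *: f (epsX x).
Proof.
case=> lf pf _; elim/(@homog_ind _ _ (sm_parity sX)): x => [x y hx hy|b x hx].
  by rewrite (linD lf x y) linearD /= hx hy linearD /= (linD lf (epsX x)) scalerDr.
by rewrite (eps_homog (pf _ _ hx)) (eps_homog hx) (linZ lf) scalerA -signr_addb.
Qed.

Lemma act_eps b a x : is_homog (sa_parity A) b a ->
  epsX (sm_act sX a x) = (-1) ^+ b *: sm_act sX a (epsX x).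
Proof.
move=> ha; elim/(@homog_ind _ _ (sm_parity sX)): x => [x y hx hy|c x hx].
  rewrite (linD (sm_linear_r sX a) x y) (linD (eps_linear _)) hx hy.
  by rewrite (linD (eps_linear _) x y) (linD (sm_linear_r sX a) (epsX x)) scalerDr.
by rewrite (eps_homog (sm_act_homog ha hx)) (eps_homog hx) linearZ scalerA -signr_addb.
Qed.

Lemma hom_act p f b a x : hom_of_parity sX sY p f -> is_homog (sa_parity A) b a ->
  f (sm_act sX a x) = (-1) ^+ (p && b) *: sm_act sY a (f x).
Proof. by case=> _ _; apply. Qed.

Lemma hom_even_act f a x : hom_of_parity sX sY false f -> f (sm_act sX a x) = sm_act sY a (f x).
Proof.
move=> hf; have [lf _ _] := hf; elim/(@homog_ind _ _ (sa_parity A)): a => [a b ha hb|b a ha].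
  have E (Z : lmodType k) (sZ : supermodule A Z) z :
      sm_act sZ (a + b) z = sm_act sZ a z + sm_act sZ b z.
    by have := sm_linear_l sZ z 1 a b; rewrite !scale1r.
  by rewrite !E (linD lf) ha hb.
by rewrite (hom_act _ hf ha) scale1r.
Qed.

Lemma eps_anti_parity (p : bool) (f : X -> Y) b x : [pchar k] =i pred0 -> linear f ->
  (forall x, epsY (f x) = (-1) ^+ p *: f (epsX x)) ->
  is_homog (sm_parity sX) b x -> is_homog (sm_parity sY) (p (+) b) (f x).
Proof.
move=> char0 lf ef hx; apply: homog_eps => //.
by rewrite ef (eps_homog hx) (linZ lf) scalerA -signr_addb.
Qed.
End HomOfParity.

Section Shift.
Variables (k : fieldType) (A : superalgebra k) (X : lmodType k) (sX : supermodule A X).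

Lemma shift_spartK b c x : spart (sm_parity sX) (~~ b) (spart (sm_parity sX) (~~ c) x) =
  if b == c then spart (sm_parity sX) (~~ b) x else 0.
Proof. by rewrite spartK; case: b c => [] []. Qed.

Lemma shift_spart_sum x : spart (sm_parity sX) true x + spart (sm_parity sX) false x = x.
Proof. by rewrite addrC spart_sum. Qed.

Definition shift_superspace : superspace X :=
  @Superspace k X (fun b => spart (sm_parity sX) (~~ b))
    (fun b => spart_linear (sm_parity sX) (~~ b)) shift_spartK shift_spart_sum.

Lemma shift_act_homog b c a x : is_homog (sa_parity A) b a -> is_homog shift_superspace c x ->
  is_homog shift_superspace (b (+) c) (sm_act sX a x).
Proof.
by move=> ha /(sm_act_homog ha); rewrite /is_homog /= addbN.
Qed.

Definition shift : supermodule A X :=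
  @Supermodule k A X shift_superspace (sm_act sX) (sm_linear_r sX) (sm_linear_l sX)
    (sm_act1 sX) (@sm_actM _ _ _ sX) shift_act_homog.
End Shift.

Section Image.
Variables (k : fieldType) (A : superalgebra k) (Y Z : lmodType k).
Variables (sY : supermodule A Y) (sZ : supermodule A Z) (psi : Y -> Z).
Hypothesis psi_hom : hom_of_parity sY sZ false psi.

Let psi_lin : linear psi. Proof. by case: psi_hom. Qed.

(** To become a supermodule: injectivity extends maps along injections only, so a map that vanishes
    on the kernel of [psi] is first pushed to the image. *)
Definition image_pred : {pred Z} := fun z => `[< exists y, z = psi y >].

Lemma image_predP z : reflect (exists y, z = psi y) (z \in image_pred).
Proof. exact: asboolP. Qed.

Lemma image_submod : submod_closed image_pred.
Proof.
split; first by apply/image_predP; exists 0; rewrite (lin0 psi_lin).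
move=> t _ _ /image_predP[x ->] /image_predP[y ->]; apply/image_predP.
by exists (t *: x + y); rewrite psi_lin.
Qed.
HB.instance Definition _ := GRing.isSubmodClosed.Build k Z image_pred image_submod.

Record image := Image { image_val :> Z; image_valP : image_val \in image_pred }.
HB.instance Definition _ := [isSub for image_val].
HB.instance Definition _ := [Choice of image by <:].
HB.instance Definition _ := [SubChoice_isSubLmodule of image by <:].

Lemma image_spartP b (z : image) : spart (sm_parity sZ) b (val z) \in image_pred.
Proof.
case: z => z /=; case/image_predP => y ->; apply/image_predP; exists (spart (sm_parity sY) b y).
rewrite -(spart_sum (sm_parity sY) y) !(linD psi_lin) linearD /=.
have [_ par _] := psi_hom.
by rewrite !(spart_homog _ (par _ _ (homog_spart _ _ _))) linearD /= !spartK; case: b => /=;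
  rewrite ?(linD psi_lin) ?(lin0 psi_lin) ?addr0 ?add0r.
Qed.

Definition image_spart b (z : image) := Image (image_spartP b z).

Lemma image_spart_linear b : linear (image_spart b).
Proof. by move=> t x y; apply: val_inj; rewrite /= !linearP. Qed.

Lemma image_spartK b c z :
  image_spart b (image_spart c z) = if b == c then image_spart b z else 0.
Proof. by apply: val_inj; rewrite /= spartK; case: eqP. Qed.

Lemma image_spart_sum z : image_spart false z + image_spart true z = z.
Proof. by apply: val_inj; rewrite /= spart_sum. Qed.

Definition image_superspace := Superspace image_spart_linear image_spartK image_spart_sum.

Lemma image_actP a (z : image) : sm_act sZ a (val z) \in image_pred.
Proof.
case: z => z /=; case/image_predP => y ->; apply/image_predP; exists (sm_act sY a y).
by rewrite (hom_even_act _ _ psi_hom).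
Qed.

Definition image_act a (z : image) := Image (image_actP a z).

Lemma image_linear_r a : linear (image_act a).
Proof. by move=> t x y; apply: val_inj; rewrite /= !linearP. Qed.

Lemma image_linear_l z : linear (image_act^~ z).
Proof. by move=> t x y; apply: val_inj; rewrite /= (sm_linear_l sZ). Qed.

Lemma image_act1 z : image_act 1 z = z.
Proof. by apply: val_inj; rewrite /= sm_act1. Qed.

Lemma image_actM a b z : image_act (a * b) z = image_act a (image_act b z).
Proof. by apply: val_inj; rewrite /= sm_actM. Qed.

Lemma image_homogE b (z : image) : is_homog image_superspace b z <-> is_homog (sm_parity sZ) b (val z).
Proof. by split=> [/(congr1 val)|h]; [|apply: val_inj]. Qed.

Lemma image_act_homog b c a z : is_homog (sa_parity A) b a -> is_homog image_superspace c z ->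
  is_homog image_superspace (b (+) c) (image_act a z).
Proof. by move=> ha /image_homogE hz; apply/image_homogE; apply: sm_act_homog. Qed.

Definition image_module : supermodule A image :=
  Supermodule image_linear_r image_linear_l image_act1 image_actM image_act_homog.

Lemma image_lift_hom (X : lmodType k) (sX : supermodule A X) (f : Y -> X) :
  hom_of_parity sY sX false f -> (forall y, psi y = 0 -> f y = 0) ->
  exists2 h : image -> X, hom_of_parity image_module sX false h &
    forall z y, val z = psi y -> h z = f y.
Proof.
move=> hf ker; have [lf pf af] := hf; have [_ pp _] := psi_hom.
have fE x y : psi x = psi y -> f x = f y.
  move=> xy; apply/eqP; rewrite -subr_eq0 -(linB lf); apply/eqP/ker.
  by rewrite (linB psi_lin) xy subrr.
have /choice[u uE] : forall z : image, exists y, val z = psi y.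
  by case=> z /= /image_predP.
have hE z y : val z = psi y -> f (u z) = f y by rewrite uE => /fE.
exists (fun z => f (u z)) => //; split.
- move=> t x y; rewrite -lf; apply: hE.
  by rewrite psi_lin -!uE.
- move=> b x /image_homogE hx.
  rewrite (hE _ (spart (sm_parity sY) b (u x))); first exact/pf/homog_spart.
  rewrite -hx uE -{1}(spart_sum (sm_parity sY) (u x)) (linD psi_lin) linearD /=.
  by rewrite !(spart_homog _ (pp _ _ (homog_spart _ _ _))); case: (b); rewrite ?addr0 ?add0r.
- move=> b a x ha; rewrite scale1r -(hom_even_act _ _ hf); apply: hE.
  by rewrite (hom_even_act _ _ psi_hom) -uE.
Qed.
End Image.

Section InjectiveExtension.
Variables (k : fieldType) (A : superalgebra k) (X : lmodType k) (sX : supermodule A X).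
Hypothesis injX : injective_supermodule sX.

Lemma injective_extend_even (Y Z : lmodType k) (sY : supermodule A Y) (sZ : supermodule A Z)
    (psi : Y -> Z) (f : Y -> X) :
  hom_of_parity sY sZ false psi -> hom_of_parity sY sX false f ->
  (forall y, psi y = 0 -> f y = 0) ->
  exists2 h : Z -> X, hom_of_parity sZ sX false h & forall y, h (psi y) = f y.
Proof.
move=> hpsi hf ker; have [f' hf' f'E] := image_lift_hom hpsi hf ker.
have hval : hom_of_parity (image_module hpsi) sZ false (fun z : image psi => val z).
  split=> [t x y|b x /image_homogE //|b a x _]; last by rewrite scale1r.
  by rewrite linearP.
have [h hh hE] := injX hval val_inj hf'.
exists h => // y; have yP : psi y \in image_pred psi by apply/image_predP; exists y.
by rewrite -(f'E (Image yP) y erefl) -hE.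
Qed.

(** An odd [f] becomes the even homomorphism [f \o eps] on the parity shift, whose action is
    unchanged: [eps] supplies the sign in the rule for odd maps. Composing the extension with [eps]
    undoes it. *)
Lemma injective_extend p (Y Z : lmodType k) (sY : supermodule A Y) (sZ : supermodule A Z)
    (psi : Y -> Z) (f : Y -> X) :
  hom_of_parity sY sZ false psi -> hom_of_parity sY sX p f ->
  (forall y, psi y = 0 -> f y = 0) ->
  exists2 h : Z -> X, hom_of_parity sZ sX p h & forall y, h (psi y) = f y.
Proof.
case: p; last exact: injective_extend_even.
move=> hpsi hf ker; have [lf pf af] := hf; have [lp pp ap] := hpsi.
have hpsi' : hom_of_parity (shift sY) (shift sZ) false psi.
  by split=> // b x hx; apply: pp.
have hf' : hom_of_parity (shift sY) sX false (fun y => f (eps (sm_parity sY) y)).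
  split=> [t x y|b x hx|b a x ha]; first by rewrite linearP lf.
    have {}hx : is_homog (sm_parity sY) (~~ b) x := hx.
    by rewrite (eps_homog hx) (linZ lf); apply: homogZ; have := pf _ _ hx; rewrite /= negbK.
  by rewrite (act_eps _ _ ha) (linZ lf) (af b) // scalerA -signr_addb addbb.
have psi_eps y : psi (eps (sm_parity sY) y) = eps (sm_parity sZ) (psi y).
  by rewrite (hom_eps _ hpsi) scale1r.
have [y y0|h hh hE] := injective_extend_even hpsi' hf'.
  by apply: ker; rewrite psi_eps y0 linear0.
have [lh ph ah] := hh; exists (fun z => h (eps (sm_parity sZ) z)) => [|y]; last first.
  by rewrite -psi_eps hE epsK.
split=> [t x y|b x hx|b a x ha]; first by rewrite linearP lh.
  rewrite (eps_homog hx) (linZ lh); apply/homogZ/ph.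
  by rewrite /is_homog /= negbK.
by rewrite (act_eps _ _ ha) (linZ lh) (ah b) // scale1r.
Qed.
End InjectiveExtension.

Section HomOperations.
Variables (k : fieldType) (A : superalgebra k) (X Y Z : lmodType k).
Variables (sX : supermodule A X) (sY : supermodule A Y) (sZ : supermodule A Z).

Lemma hom_comp p q f g : hom_of_parity sX sY p f -> hom_of_parity sY sZ q g ->
  hom_of_parity sX sZ (q (+) p) (fun x => g (f x)).
Proof.
move=> [lf pf af] [lg pg ag]; split=> [t x y|b x hx|b a x ha].
- by rewrite lf lg.
- by rewrite -addbA; apply/pg/pf.
- rewrite (af b) // (linZ lg) (ag b) // scalerA -signr_addb.
  by rewrite andb_addl addbC.
Qed.

Lemma hom_scale p c f : hom_of_parity sX sY p f -> hom_of_parity sX sY p (fun x => c *: f x).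
Proof.
move=> [lf pf af]; split=> [t x y|b x hx|b a x ha].
- by rewrite lf scalerDr !scalerA [t * c]mulrC.
- exact/homogZ/pf.
- by rewrite (af b) // (linZ (sm_linear_r sY a)) !scalerA mulrC.
Qed.
End HomOperations.

Section Resolution.
Variables (k : fieldType) (A : superalgebra k) (N : lmodType k) (sN : supermodule A N).
Variable J : injective_resolution sN.

Lemma ir_d_linear i : linear (@ir_d _ _ _ _ J i).
Proof. by case: (ir_d_hom J i). Qed.
HB.instance Definition _ i := GRing.isLinear.Build k (J i) (J i.+1) _
  (@ir_d _ _ _ _ J i) (@ir_d_linear i).

Lemma ir_aug_linear : linear (ir_aug J).
Proof. by case: (ir_aug_hom J). Qed.
HB.instance Definition _ := GRing.isLinear.Build k N (J 0%N) _ (ir_aug J) ir_aug_linear.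

Lemma ir_d_aug y : ir_d (ir_aug J y) = 0.
Proof. by apply/ir_exact0; exists y. Qed.

Lemma ir_dd i (x : J i) : ir_d (ir_d x) = 0.
Proof. by apply/ir_exact; exists x. Qed.

Lemma chain_map_exists p m (f : N -> J m) : hom_of_parity sN (ir_mod J m) p f ->
  (forall x, ir_d (f x) = 0) ->
  exists F : forall j, J j -> J (j + m)%N,
    shifted_chain_map p F /\ forall x, F 0%N (ir_aug J x) = f x.
Proof.
move=> hf df.
(* A stage must also send cocycles to cocycles: [d \o G] then vanishes on the kernel of [d], as the
   extension to the next stage requires. *)
pose good j (G : J j -> J (j + m)%N) := hom_of_parity (ir_mod J j) (ir_mod J (j + m)%N) p G /\
  forall y, ir_d y = 0 -> ir_d (G y) = 0.
have step j (G : {G | good j G}) : {G' : {G' | good j.+1 G'} |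
    forall x, sval G' (ir_d x) = (-1) ^+ m *: ir_d (sval G x)}.
  apply: cid; case: G => G [hG dG] /=.
  have hdG := hom_scale ((-1) ^+ m) (hom_comp hG (ir_d_hom J (j + m)%N)).
  have [y /dG ->|G' hG' G'E] := injective_extend (@ir_injective _ _ _ _ J (j + m).+1) (ir_d_hom J j) hdG.
    by rewrite scaler0.
  have gG' : good j.+1 G'.
    by split=> // _ /ir_exact[y ->]; rewrite G'E linearZ /= ir_dd scaler0.
  by exists (exist _ G' gG').
have init : {G : {G | good 0%N G} | forall x, sval G (ir_aug J x) = f x}.
  apply: cid.
  have [y y0|G hG GE] := injective_extend (@ir_injective _ _ _ _ J m) (ir_aug_hom J) hf.
    rewrite (_ : y = 0) ?(lin0 (let: And3 l _ _ := hf in l)) //.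
    by apply: (@ir_aug_inj _ _ _ _ J); rewrite y0 linear0.
  have gG : good 0%N G.
    by split=> // _ /ir_exact0[y ->]; rewrite GE df.
  by exists (exist _ G gG).
pose F := nat_rect (fun j => {G | good j G}) (sval init) (fun j G => sval (step j G)).
exists (fun j => sval (F j)); split; last exact: (svalP init).
split=> [j|j x]; first by case: (svalP (F j)).
exact: (svalP (step j (F j))).
Qed.
End Resolution.

(* A homogeneous basis of B, with right contractions against the e_i. *)
Record contraction_basis (k : fieldType) (B : superalgebra k) n (e : 'I_n -> B) := ContractionBasis {
  cb_index : finType;
  cb_elt : cb_index -> B;
  cb_coord : cb_index -> {linear B -> k^o};
  cb_par : cb_index -> bool;
  cb_contr : 'I_n -> {linear B -> B};
  cb_expand : forall b, b = \sum_t cb_coord t b *: cb_elt t;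
  cb_dual : forall t s, cb_coord t (cb_elt s) = (t == s)%:R;
  cb_homog : forall t, is_homog (sa_parity B) (cb_par t) (cb_elt t);
  cb_coord_homog : forall b u t, is_homog (sa_parity B) b u -> cb_par t != b -> cb_coord t u = 0;
  cb_contrM : forall i j b, cb_contr j (b * e i) + cb_contr j b * e i = (i == j)%:R *: b }.

Arguments cb_coord {k B n e} c t.
Arguments cb_elt {k B n e} c t.
Arguments cb_par {k B n e} c t.
Arguments cb_contr {k B n e} c j.

(** * Contractions on injective modules *)

Section Coinduced.
Variables (k : fieldType) (B : superalgebra k) (n : nat) (e : 'I_n -> B).
Variables (C : contraction_basis e) (X : lmodType k) (sX : supermodule B X).
Local Notation T := (cb_index C).

(* Hom_k(B, X), a map being given by its values on the basis. *)
Local Notation coind := {ffun T -> X}.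

Definition ceval (phi : coind) (b : B) : X := \sum_t cb_coord C t b *: phi t.

Lemma ceval_linear phi : linear (ceval phi).
Proof.
move=> t a b; rewrite /ceval scaler_sumr -big_split; apply: eq_bigr => s _ /=.
by rewrite linearP scalerDl scalerA.
Qed.
HB.instance Definition _ phi := GRing.isLinear.Build k B X _ (ceval phi) (ceval_linear phi).

Lemma ceval_linear_l b : linear (ceval^~ b).
Proof.
move=> t a c; rewrite /ceval scaler_sumr -big_split; apply: eq_bigr => s _ /=.
by rewrite !ffunE scalerDr !scalerA mulrC.
Qed.

Lemma ceval_elt phi t : ceval phi (cb_elt C t) = phi t.
Proof.
rewrite /ceval (bigD1 t) //= cb_dual eqxx scale1r big1 ?addr0 // => s /negPf st.
by rewrite cb_dual st scale0r.
Qed.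

Definition cpre (f : B -> B) (phi : coind) : coind := [ffun t => ceval phi (f (cb_elt C t))].

Lemma ceval_cpre (f : {linear B -> B}) phi b : ceval (cpre f phi) b = ceval phi (f b).
Proof.
rewrite [b in RHS](cb_expand C) !linear_sum /=; apply: eq_bigr => t _.
by rewrite ffunE !linearZ.
Qed.

Lemma cpre_linear f : linear (cpre f).
Proof. by move=> t x y; apply/ffunP => s; rewrite !ffunE ceval_linear_l. Qed.
HB.instance Definition _ f := GRing.isLinear.Build k coind coind _ (cpre f) (cpre_linear f).

Lemma rmul_linear (a : B) : linear (fun b : B => b * a).
Proof. by move=> t x y; rewrite mulrDl scalerAl. Qed.

Definition cact (a : B) : coind -> coind := cpre (fun b => b * a).

Lemma ceval_cact a phi b : ceval (cact a phi) b = ceval phi (b * a).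
Proof. exact: (ceval_cpre (lin (rmul_linear a))). Qed.

Definition cspart b (phi : coind) : coind :=
  [ffun t => spart (sm_parity sX) (b (+) cb_par C t) (phi t)].

Lemma cspart_linear b : linear (cspart b).
Proof. by move=> t x y; apply/ffunP => s; rewrite !ffunE linearP. Qed.

Lemma cspartK b c x : cspart b (cspart c x) = if b == c then cspart b x else 0.
Proof.
apply/ffunP => s; rewrite !ffunE spartK.
by case: b c => [] []; rewrite !ffunE; case: cb_par.
Qed.

Lemma cspart_sum x : cspart false x + cspart true x = x.
Proof.
by apply/ffunP => s; rewrite !ffunE; case: cb_par; rewrite ?spart_sum // addrC spart_sum.
Qed.

Definition coind_superspace := Superspace cspart_linear cspartK cspart_sum.

Lemma ceval_homog b c phi a : is_homog coind_superspace c phi -> is_homog (sa_parity B) b a ->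
  is_homog (sm_parity sX) (c (+) b) (ceval phi a).
Proof.
move=> hphi ha; apply: homog_sum => t _.
have [<-|nb] := eqVneq (cb_par C t) b; last first.
  by rewrite (cb_coord_homog ha nb) scale0r; apply: homog0.
by apply: homogZ; rewrite -hphi ffunE; apply: homog_spart.
Qed.

Lemma cact_homog b c a phi : is_homog (sa_parity B) b a -> is_homog coind_superspace c phi ->
  is_homog coind_superspace (b (+) c) (cact a phi).
Proof.
move=> ha hphi; apply/ffunP => t; rewrite !ffunE.
have -> : b (+) c (+) cb_par C t = c (+) (cb_par C t (+) b) by case: b c cb_par {ha hphi} => [] [] [].
exact: (ceval_homog hphi (sa_mul (cb_homog t) ha)).
Qed.

Lemma cact_linear_l phi : linear (cact^~ phi).
Proof.
by move=> t a b; apply/ffunP => s; rewrite !ffunE mulrDr -scalerAr linearP.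
Qed.

Lemma cact1 phi : cact 1 phi = phi.
Proof. by apply/ffunP => s; rewrite !ffunE mulr1 ceval_elt. Qed.

Lemma cactM a b phi : cact (a * b) phi = cact a (cact b phi).
Proof. by apply/ffunP => s; rewrite [RHS]ffunE ceval_cact ffunE mulrA. Qed.

Definition coind_module : supermodule B coind :=
  Supermodule (fun a => cpre_linear (fun b => b * a)) cact_linear_l cact1 cactM cact_homog.

Definition cembed (x : X) : coind := [ffun t => sm_act sX (cb_elt C t) x].

Lemma cembedE x b : ceval (cembed x) b = sm_act sX b x.
Proof.
have lx := sm_linear_l sX x.
rewrite [b in RHS](cb_expand C) -[RHS]/(lin lx _) linear_sum; apply: eq_bigr => t _.
by rewrite ffunE linearZ.
Qed.

Lemma cembed_hom : hom_of_parity sX coind_module false cembed.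
Proof.
split=> [t x y|b x hx|b a x ha].
- by apply/ffunP => s; rewrite !ffunE linearP.
- by apply/ffunP => s; rewrite !ffunE /= addbC; apply: (sm_act_homog (cb_homog s) hx).
- by rewrite scale1r; apply/ffunP => s; rewrite !ffunE cembedE sm_actM.
Qed.

Lemma cembed_inj : injective cembed.
Proof. by move=> x y /(congr1 (ceval^~ 1)); rewrite !cembedE !sm_act1. Qed.

(* X is a retract of Hom_k(B, X), where the contractions act. *)
Lemma injective_clifford : injective_supermodule sX ->
  exists iota : 'I_n -> {linear X -> X}, forall i j x,
    sm_act sX (e i) (iota j x) + iota j (sm_act sX (e i) x) = (i == j)%:R *: x.
Proof.
move=> injX; have hid : hom_of_parity sX sX false id by split=> // b a x _; rewrite scale1r.
have [r hr rE] := injX _ _ _ _ _ _ cembed_hom cembed_inj hid.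
have [lr _ _] := hr; have [lc _ _] := cembed_hom.
have li j : linear (fun x => r (cpre (cb_contr C j) (cembed x))).
  by move=> t x y; rewrite lc linearP lr.
(* [iota_j] embeds, precomposes with the contraction and retracts. The embedding and the retraction
   commute with [e_i], which acts on [Hom_k(B, X)] through right multiplication on [B]; so the
   relation [cb_contrM] on [B] passes to [X]. *)
exists (fun j => lin (li j)) => i j x /=.
rewrite -(hom_even_act _ _ hr) (hom_even_act (e i) x cembed_hom) -(linD lr).
rewrite -[X in _ *: X]rE -(linZ lr); congr (r _); apply/ffunP => t.
rewrite [LHS]ffunE [RHS]ffunE /cembed -/(cembed x) /= [X in X + _]ffunE ceval_cpre.
rewrite [X in _ + X]ffunE ceval_cact -linearD /= cb_contrM linearZ /= ceval_elt.
by [].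
Qed.
End Coinduced.

Section ExteriorContraction.
Variables (k : fieldType) (n : nat).
Implicit Types (a : exterior k n) (S T : {set 'I_n}) (i j : 'I_n).

Lemma emul_gen a i S : (a * ebasis k [set i]) S =
  if i \in S then (-1) ^+ ninv (S :\ i) [set i] * a (S :\ i) else 0.
Proof.
rewrite emulE; case: ifP => [iS|iS]; last first.
  rewrite big1 // => T TS; rewrite ffunE; case: eqP => [E|_]; last by rewrite mulr0.
  have : i \in S :\: T by rewrite E set11.
  by rewrite inE iS andbF.
have SD : S :\: (S :\ i) = [set i] by rewrite setDDr setDv set0U; apply/setIidPr; rewrite sub1set.
rewrite (bigD1 (S :\ i)) ?subD1set //= SD ffunE eqxx mulr1 big1 ?addr0 // => T /andP[TS nT].
rewrite ffunE; case: eqP => [E|_]; last by rewrite mulr0.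
by case/eqP: nT; rewrite -E setDDr setDv set0U; apply/esym/setIidPr.
Qed.

(** Contraction from the right: in the monomial of [j |: T], the factor [e_j] is moved to the end,
    past the elements of [T] greater than [j], and removed. *)
Definition econtr j a : exterior k n :=
  [ffun T : {set 'I_n} => if j \in T then 0 else (-1) ^+ ninv T [set j] * a (j |: T)].

Lemma econtrE j a T :
  econtr j a T = if j \in T then 0 else (-1) ^+ ninv T [set j] * a (j |: T).
Proof. by rewrite ffunE. Qed.

Lemma econtr_linear j : linear (econtr j).
Proof.
move=> t a b; apply/ffunP => T; rewrite !ffunE; case: ifP => _; first by rewrite scaler0 addr0.
by rewrite mulrDr -[t *: a _]/(t * _) mulrCA.
Qed.
HB.instance Definition _ j := GRing.isLinear.Build k (exterior k n) (exterior k n) _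
  (econtr j) (econtr_linear j).

Lemma econtrM i j a :
  econtr j (a * ebasis k [set i]) + econtr j a * ebasis k [set i] = (i == j)%:R *: a.
Proof.
apply/ffunP => T; rewrite [LHS]ffunE emul_gen !econtrE emul_gen [RHS]ffunE.
have [<-|ij] := eqVneq i j.
  rewrite scale1r !inE eqxx /=; case: (boolP (i \in T)) => iT.
    by rewrite add0r setD1K // mulrA -exprD addnn -signr_odd odd_double mul1r.
  by rewrite addr0 setU1K // mulrA -exprD addnn -signr_odd odd_double mul1r.
rewrite scale0r !inE (negPf ij) /= eq_sym (negPf ij) /=.
case: (boolP (j \in T)) => jT; case: (boolP (i \in T)) => iT; rewrite ?mulr0 ?addr0 //.
have -> : (j |: T) :\ i = j |: (T :\ i).
  by rewrite setDUl; congr (_ :|: _); apply/setDidPl; rewrite disjoints1 inE eq_sym.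
have dj : [disjoint [set j] & T :\ i] by rewrite disjoints1 !inE negb_and jT orbT.
have di : [disjoint [set i] & T :\ i] by rewrite disjoints1 !inE eqxx.
rewrite ninvUl // -{1}(setD1K iT) ninvUl // !mulrA -mulrDl -!exprD.
suff -> : (-1) ^+ (ninv [set i] [set j] + ninv (T :\ i) [set j] +
    (ninv [set j] [set i] + ninv (T :\ i) [set i])) =
    - (-1) ^+ (ninv (T :\ i) [set i] + ninv (T :\ i) [set j]) :> k by rewrite addNr mul0r.
rewrite addnACA exprD.
(* Exactly one of [i < j] and [j < i] holds, whence the single sign between the two terms. *)
have -> : (-1) ^+ (ninv [set i] [set j] + ninv [set j] [set i]) = -1 :> k.
  rewrite /ninv !big_set1; case: ltngtP => [||/val_inj E]; rewrite ?expr1 //.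
  by rewrite E eqxx in ij.
by rewrite mulN1r addnC.
Qed.

Definition ecoord S a : k^o := a S.

Lemma ecoord_linear S : linear (ecoord S).
Proof. by move=> t a b; rewrite /ecoord !ffunE. Qed.
HB.instance Definition _ S := GRing.isLinear.Build k (exterior k n) k^o _
  (ecoord S) (ecoord_linear S).

Lemma ehomog_basis S : is_homog (exterior_superspace k n) (odd #|S|) (ebasis k S).
Proof. by apply/ehomogP => T oT; rewrite ffunE; case: eqP => // ET; rewrite ET eqxx in oT. Qed.

Lemma ecoord_basis S T : ecoord S (ebasis k T) = (S == T)%:R.
Proof. by rewrite /ecoord ffunE. Qed.

Lemma ecoord_homog c a S : is_homog (exterior_superspace k n) c a -> odd #|S| != c -> ecoord S a = 0.
Proof. by move=> /ehomogP ha; apply: ha. Qed.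

Definition exterior_contraction_basis :
  contraction_basis (fun i => ebasis k [set i] : exterior_superalgebra k n) :=
  @ContractionBasis k (exterior_superalgebra k n) n _ {set 'I_n} (@ebasis k n)
    (fun S => ecoord S) (fun S => odd #|S|) (fun j => econtr j)
    (@exteriorE k n) ecoord_basis ehomog_basis ecoord_homog econtrM.
End ExteriorContraction.

Section SmashContraction.
Variables (k : fieldType) (gT : finGroupType) (n : nat).
Variable rV : mx_representation k [set: gT] n.
Local Notation A := (smash_superalgebra rV).
Implicit Types (a b : smash rV).

Lemma smul_sext b u g : (b * sext rV u) g = b g * emap (rV g) u.
Proof.
rewrite smulE (bigD1 g) //= ffunE mulVg eqxx big1 ?addr0 // => h hg.
by rewrite ffunE -eq_mulVg1 (negPf hg) linear0 mulr0.
Qed.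

Lemma emap_rVK g u : emap (rV g) (emap (rV g^-1%g) u) = u.
Proof. by rewrite emap_comp -rV_mul mulgV repr_mx1 emap_id. Qed.

Lemma emap_rVVK g u : emap (rV g^-1%g) (emap (rV g) u) = u.
Proof. by rewrite emap_comp -rV_mul mulVg repr_mx1 emap_id. Qed.

Lemma saddE a b g : (a + b) g = a g + b g. Proof. by rewrite ffunE. Qed.

Lemma sscaleE (t : k) a g : (t *: a) g = t *: a g. Proof. by rewrite ffunE. Qed.

Definition smap_fun (F : gT -> exterior k n -> exterior k n) b : smash rV := [ffun g => F g (b g)].

Lemma smap_funE F b g : smap_fun F b g = F g (b g).
Proof. by rewrite ffunE. Qed.

Lemma smap_fun_linear F : (forall g, linear (F g)) -> linear (smap_fun F).
Proof.
move=> lF t a b; apply/ffunP => g; rewrite smap_funE saddE sscaleE lF.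
by rewrite [RHS]saddE sscaleE !smap_funE.
Qed.

(** Since [(u # g) e_i = u (g . e_i) # g], the contraction on the component at [g] is conjugated by
    the action of [g]. *)
Definition scontr j := smap_fun (fun g u => emap (rV g) (econtr j (emap (rV g^-1%g) u))).

Lemma scontr_linear j : linear (scontr j).
Proof.
apply: smap_fun_linear => g t u w.
by rewrite (linD (emap_linear _)) (linZ (emap_linear _)) (econtr_linear j) (emap_linear (rV g)).
Qed.
HB.instance Definition _ j := GRing.isLinear.Build k (smash rV) (smash rV) _
  (scontr j) (scontr_linear j).

Lemma scontrM i j b : scontr j (b * sext rV (ebasis k [set i])) +
  scontr j b * sext rV (ebasis k [set i]) = (i == j)%:R *: b.
Proof.
rewrite /scontr; set F := fun g u => _.
have FM g u : F g (u * emap (rV g) (ebasis k [set i])) + F g u * emap (rV g) (ebasis k [set i]) =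
    (i == j)%:R *: u.
  rewrite /F (emapM (rV g^-1%g)) emap_rVVK -(emapM (rV g)) -(linD (emap_linear _)) econtrM.
  by rewrite (linZ (emap_linear _)) emap_rVK.
move: F FM => F FM; apply/ffunP => g.
by rewrite saddE smul_sext !smap_funE smul_sext FM sscaleE.
Qed.

Definition sbasis (t : (gT * {set 'I_n})%type) : smash rV := [ffun g => if g == t.1 then ebasis k t.2 else 0].

Definition scoord (t : (gT * {set 'I_n})%type) b : k^o := b t.1 t.2.

Lemma scoord_linear t : linear (scoord t).
Proof. by move=> c a b; rewrite /scoord !ffunE. Qed.
HB.instance Definition _ t := GRing.isLinear.Build k (smash rV) k^o _ (scoord t) (scoord_linear t).

Lemma smash_expand (b : smash rV) : b = \sum_t scoord t b *: sbasis t.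
Proof.
apply/ffunP => g; rewrite sum_ffunE.
transitivity (\sum_(t : (gT * {set 'I_n})%type) (if g == t.1 then (b t.1 t.2 : k) *: ebasis k t.2 else 0)).
  rewrite -(pair_bigA _ (fun h S => if g == h then (b h S : k) *: ebasis k S else 0)) /=.
  rewrite (bigD1 g) //= eqxx [X in _ + X]big1 ?addr0; first exact: exteriorE.
  by move=> h hg; rewrite eq_sym (negPf hg) big1.
by apply: eq_bigr => t _; rewrite !ffunE; case: ifP => _; rewrite ?scaler0.
Qed.

Lemma scoord_basis t s : scoord t (sbasis s) = (t == s)%:R.
Proof.
case: t s => [g S] [h T]; rewrite /scoord ffunE /= xpair_eqE.
by case: eqP => _; rewrite ffunE.
Qed.

Lemma shomog_basis (t : (gT * {set 'I_n})%type) : is_homog (smash_superspace rV) (odd #|t.2|) (sbasis t).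
Proof.
apply/shomogP => h; rewrite ffunE; case: eqP => _; last exact: homog0.
exact: ehomog_basis.
Qed.

Lemma scoord_homog c u (t : (gT * {set 'I_n})%type) :
  is_homog (smash_superspace rV) c u -> odd #|t.2| != c -> scoord t u = 0.
Proof. by move=> /shomogP/(_ t.1)/ehomogP ha; apply: ha. Qed.

Definition smash_contraction_basis :
  contraction_basis (fun i => sext rV (ebasis k [set i]) : A) :=
  @ContractionBasis k A n _ (gT * {set 'I_n})%type sbasis
    (fun t => scoord t) (fun t : (gT * {set 'I_n})%type => odd #|t.2|) (fun j => scontr j)
    smash_expand scoord_basis shomog_basis scoord_homog scontrM.
End SmashContraction.

(** * The symbol of a cohomology class *)

Section ResolutionOperators.
Variables (k : fieldType) (B : superalgebra k) (n : nat) (e : 'I_n -> B).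
Hypothesis e_sq : forall i, e i * e i = 0.
Hypothesis e_anti : forall i j, e i * e j = - (e j * e i).
Variables (N : lmodType k) (sN : supermodule B N) (J : injective_resolution sN).

Lemma actN (X : lmodType k) (sX : supermodule B X) a x : sm_act sX (- a) x = - sm_act sX a x.
Proof. exact: (linearN (lin (sm_linear_l sX x))). Qed.

Lemma act0 (X : lmodType k) (sX : supermodule B X) x : sm_act sX 0 x = 0.
Proof. exact: (lin0 (sm_linear_l sX x)). Qed.

Lemma act_anti (X : lmodType k) (sX : supermodule B X) i j x :
  sm_act sX (e i) (sm_act sX (e j) x) = - sm_act sX (e j) (sm_act sX (e i) x).
Proof. by rewrite -!sm_actM e_anti actN. Qed.

Lemma act_sq (X : lmodType k) (sX : supermodule B X) i x :
  sm_act sX (e i) (sm_act sX (e i) x) = 0.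
Proof. by rewrite -!sm_actM e_sq act0. Qed.

Definition eresolution_of : eresolution k n.
Proof.
apply: (@EResolution k n J N (fun j => @ir_d _ _ _ _ J j) (ir_aug J)
  (fun j i => sm_act (ir_mod J j) (e i)) (fun i => sm_act sN (e i))).
- by move=> j i l x; apply: act_anti.
- by move=> j i x; apply: act_sq.
- by move=> j i x; apply: hom_even_act (ir_d_hom J j).
- by move=> i w; apply: hom_even_act (ir_aug_hom J).
- exact: ir_aug_inj.
- exact: ir_d_aug.
- exact: ir_dd.
- by move=> x /ir_exact0.
- by move=> j x /ir_exact.
Defined.

Lemma injective_koszul (C : contraction_basis e) (X : lmodType k) (sX : supermodule B X) :
  [pchar k] =i pred0 -> injective_supermodule sX ->
  forall i (c : 'X_{1..n} -> X), hdeg i.+1 c -> kdiff (fun i => sm_act sX (e i)) c = 0 ->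
  exists2 b, hdeg i b & kdiff (fun i => sm_act sX (e i)) b = c.
Proof.
move=> char0 /(injective_clifford C)[iota cl] i c hc c0.
apply: (@koszul_exact k n X (fun i => sm_act sX (e i)) _ _ iota) => //.
- by move=> *; apply: act_anti.
- by move=> *; apply: act_sq.
Qed.
End ResolutionOperators.

Section TrivialResolution.
Variables (k : fieldType) (B : superalgebra k) (n : nat) (e : 'I_n -> B).
Hypothesis e_odd : forall i, is_homog (sa_parity B) true (e i).
Hypothesis e_sq : forall i, e i * e i = 0.
Hypothesis e_anti : forall i j, e i * e j = - (e j * e i).
Variable aug : superalg_hom B (base_superalgebra k).
Local Notation kB := (trivial_supermodule aug).
Variable I : injective_resolution kB.
Hypothesis char0 : [pchar k] =i pred0.
Local Notation X := (eresolution_of e_sq e_anti I).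

Lemma aug_odd a : is_homog (sa_parity B) true a -> aug a = 0.
Proof. by move=> /(sah_even aug); rewrite /is_homog /= => <-. Qed.

Lemma trivial_act a (c : k^o) : sm_act kB a c = aug a * c.
Proof. by []. Qed.

Lemma trivial_e i (c : k^o) : sm_act kB (e i) c = 0.
Proof. by rewrite trivial_act aug_odd // mul0r. Qed.

Lemma two_neq0 : 2%:R != 0 :> k.
Proof. by rewrite ((pcharf0P k).1 char0). Qed.

(* The form p is the symbol of z. *)
Definition cls j (z : I j) (p : {mpoly k[n]}) := forall v, @vzigzag k n X v j z p.@[v].

Lemma cls_linear j (z w : I j) p q t : cls z p -> cls w q -> cls (t *: z + w) (t *: p + q).
Proof. by move=> zp wq v; rewrite mevalD mevalZ; apply: (@vzigzag_linear k n X). Qed.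

Lemma cls0 j : @cls j 0 0.
Proof. by move=> v; rewrite meval0; apply: (@vzigzag0 k n X). Qed.

Lemma vact_trivial v (c : k^o) : vact v (er_eb X) c = 0.
Proof. by apply: big1 => i _; rewrite [er_eb _ _ _]trivial_e scaler0. Qed.

(** A zigzag from 0 ends in the image of [D], which is 0 because odd elements kill [k]. *)
Lemma cls0_eq0 j p : @cls j 0 p -> p = 0.
Proof.
move=> zp; apply: (mpoly_eq0_eval char0) => v.
by have [s ->] := @vzigzag_inj k n X v j _ (zp v); rewrite vact_trivial.
Qed.

Lemma cls_uniq j (z : I j) p q : cls z p -> cls z q -> p = q.
Proof.
move=> zp zq; apply/eqP; rewrite -subr_eq0; apply/eqP; apply: (@cls0_eq0 j).
by have := cls_linear (-1) zq zp; rewrite !scaleN1r addNr addrC.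
Qed.

Lemma szigzag_cls j (z : I j) p : p \is j.-homog ->
  @szigzag k n X j (sconst z) (pser p (1 : k^o)) -> cls z p.
Proof.
move=> hp zp v; have := szigzag_kev v 0 zp.
by rewrite kev_sconst kev_pser // [p.@[v] *: _]mulr1.
Qed.

Lemma cls_exists j (z : I j) : ir_d z = 0 -> (forall i, sm_act (ir_mod I j) (e i) z = 0) ->
  exists p, [/\ p \is j.-homog, @szigzag k n X j (sconst z) (pser p (1 : k^o)) & cls z p].
Proof.
move=> dz ez.
have [||w _ /(@szigzag_hpart _ _ X _ 0)] := @szigzag_total k n X j (sconst z).
- by rewrite smap_sconst [er_d _ _ _]dz linear0.
- exact: kdiff_sconst0.
rewrite add0n hpart_hdeg; last exact: hdeg_sconst.
have [p hp ->] := series_poly (@hdeg_hpart _ _ _ j w) => zp.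
by exists p; split=> //; apply: szigzag_cls.
Qed.

Hypothesis C : contraction_basis e.

Lemma resolution_koszul j i (c : 'X_{1..n} -> X j) : hdeg i.+1 c -> kdiff (er_e X j) c = 0 ->
  exists2 b, hdeg i b & kdiff (er_e X j) b = c.
Proof. exact: (injective_koszul e_sq e_anti C char0 (@ir_injective _ _ _ _ I j)). Qed.

Lemma cls_surj j p : p \is j.-homog -> exists z : I j,
  [/\ ir_d z = 0, forall i, sm_act (ir_mod I j) (e i) z = 0,
      @szigzag k n X j (sconst z) (pser p (1 : k^o)) & cls z p].
Proof.
move=> hp; have [||z [dz ez zp]] := @szigzag_surj k n X resolution_koszul j (pser p (1 : k^o)).
- exact: hdeg_pser.
- apply/funext => m; apply: big1 => i _; case: ifP => // _; exact: trivial_e.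
by exists z; split=> //; apply: szigzag_cls.
Qed.

Lemma cls0_boundary j (z : I j.+1) : ir_d z = 0 ->
  (forall i, sm_act (ir_mod I j.+1) (e i) z = 0) -> cls z 0 ->
  exists2 h : I j, z = ir_d h & forall i, sm_act (ir_mod I j) (e i) h = 0.
Proof.
move=> dz ez z0; have [p [hp zp /cls_uniq/(_ z0) p0]] := cls_exists dz ez.
apply: (@szigzag_boundary k n X resolution_koszul j z _ 0 zp).
by rewrite p0 linear0; apply/funext => m; rewrite /pser mcoeff0 scale0r.
Qed.

Lemma cls0_deg0 (z : I 0%N) : cls z 0 -> z = 0.
Proof. by move=> /(_ (fun=> 0)) /= ->; rewrite meval0 linear0. Qed.

(** The zigzag that begins with [g_1 = h] continues with zeros, as [D h = 0]. *)
Lemma cls_boundary j (h : I j) p :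
  (forall i, sm_act (ir_mod I j) (e i) h = 0) -> cls (ir_d h : I j.+1) p -> p = 0.
Proof.
move=> eh hp; apply: cls_uniq hp _ => v; exists h => //; rewrite meval0.
have -> : vact v (er_e X j) h = 0 by apply: big1 => i _; rewrite [er_e _ _ _ _]eh scaler0.
exact: (@vzigzag0 k n X).
Qed.

(** [eps] commutes with [d] and anticommutes with [v], so each of the [j] steps costs a sign. *)
Lemma vzigzag_eps v j (a : I j) (c : k^o) : @vzigzag k n X v j a c ->
  @vzigzag k n X v j (eps (sm_parity (ir_mod I j)) a) ((-1) ^+ j *: c).
Proof.
elim: j a => [|j IH] a /= => [->|[g <- gc]].
  rewrite scale1r (hom_eps _ (ir_aug_hom I)) scale1r; congr (ir_aug I _).
  by rewrite /eps /= /base_spart subr0.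
exists (eps (sm_parity (ir_mod I j)) g); first by rewrite (hom_eps _ (ir_d_hom I j)) scale1r.
have -> : vact v (er_e X j) (eps (sm_parity (ir_mod I j)) g) =
   - 1 *: eps (sm_parity (ir_mod I j)) (vact v (er_e X j) g) + 0.
  rewrite addr0 linear_sum scaler_sumr; apply: eq_bigr => i _.
  rewrite -[X in _ = _ *: X]/(eps (sm_parity (ir_mod I j)) (v i *: sm_act (ir_mod I j) (e i) g)).
  by rewrite (linZ (eps_linear _)) (act_eps _ _ (e_odd i)) !scalerA mulrAC mulN1r opprK mul1r.
rewrite exprS -scalerA -[X in _ _ X]addr0; apply: (@vzigzag_linear k n X); first exact: IH.
exact: (@vzigzag0 k n X).
Qed.

(** Applying [eps] multiplies the symbol both by [(-1)^b] and by [(-1)^j]. So parity and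
    cohomological degree agree wherever the symbol is nonzero, which removes the signs from
    products. *)
Lemma cls_parity j (z : I j) b p : is_homog (sm_parity (ir_mod I j)) b z -> cls z p ->
  b != odd j -> p = 0.
Proof.
move=> hz zp bj.
have zp' : cls ((-1) ^+ b *: z + 0) ((-1) ^+ j *: p + 0).
  by rewrite !addr0 -(eps_homog hz) => v; rewrite mevalZ; apply: vzigzag_eps.
have zp'' : cls ((-1) ^+ b *: z + 0) ((-1) ^+ b *: p + 0) by apply: cls_linear => //; apply: cls0.
have := cls_uniq zp' zp''; rewrite !addr0 -signr_odd.
have -> : odd j = ~~ b by case: b bj {hz zp' zp''}; case: odd.
have H : (1 : k) *: p = -1 *: p -> p = 0.
  move/eqP; rewrite -subr_eq0 -scalerBl opprK scaler_eq0 => /orP[|/eqP//].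
  by rewrite -mulr2n (negPf two_neq0).
case: b {bj hz zp' zp''}; rewrite expr0 expr1; first by move/H.
by move/esym/H.
Qed.

(** [F] is applied along the zigzag of [a]: passing [d] costs [(-1)^m] and passing [v] costs
    [(-1)^b], once in each of the [j] steps. At its end [F] meets the image of the augmentation,
    where the zigzag ending at [c] takes over. *)
Lemma vzigzag_mul v m (b : bool) (F : forall j, I j -> I (j + m)%N) (c : k^o) :
  shifted_chain_map b F -> @vzigzag k n X v m (F 0%N (ir_aug I 1)) c ->
  forall j (a : I j) (c' : k^o), @vzigzag k n X v j a c' ->
  @vzigzag k n X v (j + m)%N (F j a) (((-1) ^+ (m + b)) ^+ j * (c * c')).
Proof.
move=> [hF dF] Fc.
have vz t j (a : I j) c' : @vzigzag k n X v j a c' -> @vzigzag k n X v j (t *: a) (t *: c').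
  move=> ac; rewrite -[t *: a]addr0 -[t *: c']addr0; apply: (@vzigzag_linear k n X) => //.
  exact: (@vzigzag0 k n X).
elim=> [|j IH] a c'.
  move=> /= ->; rewrite expr0 mul1r mulrC.
  have [lF _ _] := hF 0%N; have -> : ir_aug I c' = c' *: ir_aug I 1.
    by rewrite -linearZ /=; congr (ir_aug I _); rewrite /GRing.scale /= mulr1.
  by rewrite (linZ lF); apply: vz.
case=> g <- gc; exists ((-1) ^+ m *: F j g); first by rewrite linearZ /= dF.
have [lF _ aF] := hF j.
have -> : vact v (er_e X (j + m)%N) ((-1) ^+ m *: F j g) =
    (-1) ^+ (m + b) *: F j (vact v (er_e X j) g).
  have -> : F j (vact v (er_e X j) g) = \sum_i v i *: F j (sm_act (ir_mod I j) (e i) g).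
    rewrite -[LHS]/(lin lF (\sum_i v i *: sm_act (ir_mod I j) (e i) g)) linear_sum.
    by apply: eq_bigr => i _; exact: (linZ lF).
  rewrite scaler_sumr; apply: eq_bigr => i _.
  rewrite -[er_e X (j + m)%N i _]/(sm_act (ir_mod I (j + m)%N) (e i) _) (linZ (sm_linear_r _ _)).
  rewrite (aF true) // andbT !scalerA [v i * _]mulrC exprD; congr (_ *: _).
  by rewrite [RHS]mulrAC -[X in _ = X * _]mulrA -signr_addb addbb mulr1.
by rewrite exprS -mulrA; apply/vz/IH.
Qed.
End TrivialResolution.

Section Invariants.
Variables (k : fieldType) (B : superalgebra k).
Variable aug : superalg_hom B (base_superalgebra k).
Local Notation kB := (trivial_supermodule aug).
Variables (X : lmodType k) (sX : supermodule B X).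

Definition invariant (z : X) := forall a, sm_act sX a z = aug a *: z.

Lemma hom_trivial_invariant p (f : k^o -> X) : hom_of_parity kB sX p f -> invariant (f 1).
Proof.
case=> lf _ af a; elim/(@homog_ind _ _ (sa_parity B)): a => [a b ha hb|b a ha].
  by rewrite (linD (sm_linear_l sX _)) ha hb rmorphD scalerDl.
have := af b a 1 ha; rewrite [sm_act kB a 1]mulr1 => E.
case: b ha E => ha; last by rewrite andbF scale1r => <-; rewrite -(linZ lf) [_ *: 1]mulr1.
rewrite (aug_odd _ ha) (lin0 lf) scale0r => /esym/eqP.
by rewrite scaler_eq0 signr_eq0 => /eqP.
Qed.

Lemma super_hom_invariant (f : k^o -> X) : super_hom kB sX f -> invariant (f 1).
Proof.
case=> f0 [f1 [h0 h1 fE]] a; rewrite fE (linD (sm_linear_r sX a)).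
by rewrite (hom_trivial_invariant h0) (hom_trivial_invariant h1) scalerDr.
Qed.

Lemma super_hom_trivialE (f : k^o -> X) : super_hom kB sX f -> f = fun c => c *: f 1.
Proof.
case=> f0 [f1 [[l0 _ _] [l1 _ _] fE]]; apply/funext => c.
by rewrite !fE scalerDr -(linZ l0) -(linZ l1) [c *: 1]mulr1.
Qed.

Lemma invariant_part b z : invariant z -> invariant (spart (sm_parity sX) b z).
Proof.
move=> iz a; elim/(@homog_ind _ _ (sa_parity B)): a => [a c ha hc|c a ha].
  by rewrite (linD (sm_linear_l sX _)) ha hc rmorphD scalerDl.
have E := iz a.
have P d : spart (sm_parity sX) (c (+) d) (sm_act sX a z) =
    sm_act sX a (spart (sm_parity sX) d z).
  rewrite -{1}(spart_sum (sm_parity sX) z) (linD (sm_linear_r sX a)) linearD /=.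
  rewrite !(spart_homog _ (sm_act_homog ha (homog_spart _ _ _))).
  by case: c d {ha} => [] [] /=; rewrite ?addr0 ?add0r.
rewrite -P E linearZ /=; case: c ha P => ha P; last by rewrite addFb.
by rewrite (aug_odd _ ha) !scale0r.
Qed.

Lemma invariant_hom b z : invariant z ->
  hom_of_parity kB sX b (fun c : k^o => c *: spart (sm_parity sX) b z).
Proof.
move=> /(invariant_part b) iz; split=> [t x y|c x hx|c a x ha].
- by rewrite scalerDl scalerA.
- case: c hx => hx; last by rewrite addbF; apply/homogZ/homog_spart.
  by rewrite (_ : x = 0) ?scale0r; [apply: homog0 | move: hx; rewrite /is_homog /= => <-].
- rewrite (linZ (sm_linear_r sX a)) iz trivial_act !scalerA.
  case: c ha => ha; last by rewrite andbF mul1r mulrC.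
  by rewrite (aug_odd _ ha) !mul0r !mulr0.
Qed.

Lemma invariant_super_hom z : invariant z -> super_hom kB sX (fun c : k^o => c *: z).
Proof.
move=> iz; exists (fun c : k^o => c *: spart (sm_parity sX) false z).
exists (fun c : k^o => c *: spart (sm_parity sX) true z).
by split; [exact: invariant_hom | exact: invariant_hom | move=> x; rewrite -scalerDr spart_sum].
Qed.
End Invariants.

Section Phi.
Variables (k : fieldType) (B : superalgebra k) (n : nat) (e : 'I_n -> B).
Hypothesis e_odd : forall i, is_homog (sa_parity B) true (e i).
Hypothesis e_sq : forall i, e i * e i = 0.
Hypothesis e_anti : forall i j, e i * e j = - (e j * e i).
Variable aug : superalg_hom B (base_superalgebra k).
Local Notation kB := (trivial_supermodule aug).
Variable I : injective_resolution kB.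
Hypothesis char0 : [pchar k] =i pred0.
Variable H : yoneda_algebra I.
Local Notation cls := (cls e_sq e_anti).
Local Notation inv j := (@invariant k B aug (I j) (ir_mod I j)).

Lemma invariant_e j (z : I j) : inv j z -> forall i, sm_act (ir_mod I j) (e i) z = 0.
Proof. by move=> iz i; rewrite iz (aug_odd _ (e_odd i)) scale0r. Qed.

Lemma cocycle_invariant j (f : k^o -> I j) : ext_cocycle kB f ->
  [/\ inv j (f 1), ir_d (f 1) = 0 & f = fun c => c *: f 1].
Proof.
case=> hf df; split; [exact: super_hom_invariant hf | exact: df|].
exact: super_hom_trivialE hf.
Qed.

Lemma invariant_cocycle j (z : I j) : inv j z -> ir_d z = 0 ->
  ext_cocycle kB (fun c : k^o => c *: z).
Proof.
by move=> iz dz; split=> [|x]; [apply: invariant_super_hom | rewrite linearZ /= dz scaler0].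
Qed.

Lemma cocycle0 j : ext_cocycle kB (fun=> 0 : I j).
Proof.
have i0 : inv j 0 by move=> a; rewrite scaler0 (lin0 (sm_linear_r _ a)).
have := invariant_cocycle i0 (linear0 (@ir_d _ _ _ _ I j)).
by rewrite (_ : (fun c : k^o => c *: 0) = fun=> 0) //; apply/funext => c; rewrite scaler0.
Qed.

Lemma cocycle_linear j t (f g : k^o -> I j) : ext_cocycle kB f -> ext_cocycle kB g ->
  ext_cocycle kB (fun x => t *: f x + g x).
Proof.
move=> /cocycle_invariant[fi df ->] /cocycle_invariant[gi dg ->].
rewrite (_ : (fun x => _) = fun c : k^o => c *: (t *: f 1 + g 1)); last first.
  by apply/funext => c; rewrite scalerDr !scalerA mulrC.
apply: invariant_cocycle; last by rewrite linearP /= df dg scaler0 addr0.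
by move=> a; rewrite (sm_linear_r (ir_mod I j) a) fi gi scalerDr !scalerA mulrC.
Qed.

Lemma cocycle_cls_exists j (f : k^o -> I j) : ext_cocycle kB f -> exists p, cls (f 1) p.
Proof.
move=> /cocycle_invariant[fi df _].
by have [p [_ _ zp]] := cls_exists e_sq e_anti df (invariant_e fi); exists p.
Qed.

Lemma coboundary_cls j (f : k^o -> I j) p : ext_coboundary kB f -> cls (f 1) p -> p = 0.
Proof.
case: j f => [|j] f /= => [-> /(cls0_eq0 e_odd char0)//|[h hh fE]].
rewrite fE; apply: (cls_boundary e_odd char0).
exact/invariant_e/(super_hom_invariant hh).
Qed.

Lemma ya_class0 j : ya_class H (fun=> 0 : I j) = 0.
Proof.
have := ya_class_linear H (-1) (cocycle0 j) (cocycle0 j).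
by rewrite scaler0 addr0 scaleN1r addNr.
Qed.

(** A relation at first, since [h] is a sum of classes in many ways. *)
Definition rel_phi (h : H) (p : {mpoly k[n]}) := exists m f P,
  [/\ forall i, ext_cocycle kB (f i : k^o -> I i), h = \sum_(i < m) ya_class H (f i),
      forall i, cls (f i 1) (P i) & p = \sum_(i < m) P i].

Lemma rel_phi_pad h p : rel_phi h p -> exists m f P,
  [/\ forall i, ext_cocycle kB (f i : k^o -> I i),
      forall m', (m <= m')%N -> h = \sum_(i < m') ya_class H (f i),
      forall i, cls (f i 1) (P i) & forall m', (m <= m')%N -> p = \sum_(i < m') P i].
Proof.
move=> [m [f [P [hf hE fP pE]]]].
exists m, (fun i => if (i < m)%N then f i else fun=> 0), (fun i => if (i < m)%N then P i else 0).
split=> //.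
- by move=> i; case: ifP => _; [apply: hf | apply: cocycle0].
- move=> m' mm; rewrite hE (big_ord_widen m' (fun i => ya_class H (f i))) // big_mkcond.
  by apply: eq_bigr => i _; case: ifP => _ //; rewrite ya_class0.
- by move=> i; case: ifP => _; [apply: fP | apply: cls0].
- move=> m' mm; rewrite pE (big_ord_widen m' P) // big_mkcond.
  by apply: eq_bigr => i _; case: ifP.
Qed.

Lemma rel_phi_linear h h' p p' t : rel_phi h p -> rel_phi h' p' -> rel_phi (t *: h + h') (t *: p + p').
Proof.
move=> /rel_phi_pad[m [f [P [hf hE fP pE]]]] /rel_phi_pad[m' [f' [P' [hf' hE' fP' pE']]]].
exists (maxn m m'), (fun i x => t *: f i x + f' i x), (fun i => t *: P i + P' i); split.
- by move=> i; apply: cocycle_linear.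
- rewrite (hE _ (leq_maxl m m')) (hE' _ (leq_maxr m m')) scaler_sumr -big_split.
  by apply: eq_bigr => i _; rewrite ya_class_linear.
- by move=> i; apply: cls_linear.
- by rewrite (pE _ (leq_maxl m m')) (pE' _ (leq_maxr m m')) scaler_sumr -big_split.
Qed.

Lemma rel_phi_exists h : exists p, rel_phi h p.
Proof.
have [m [f [hf hE]]] := ya_class_gen h.
have /choice[P fP] : forall i, exists p, cls (f i 1) p by move=> i; apply: cocycle_cls_exists.
by exists (\sum_(i < m) P i), m, f, P.
Qed.

Lemma rel_phi0 p : rel_phi 0 p -> p = 0.
Proof.
move=> [m [f [P [hf hE fP ->]]]]; apply: big1 => i _.
have /(ya_class_eq0 H m hf) bd := esym hE.
exact: (coboundary_cls (bd i (ltn_ord i)) (fP i)).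
Qed.

Definition phi_fun (h : H) : {mpoly k[n]} := sval (cid (rel_phi_exists h)).

Lemma phi_rel h : rel_phi h (phi_fun h). Proof. exact: svalP. Qed.

Lemma rel_phiE h p : rel_phi h p -> phi_fun h = p.
Proof.
move=> hp; apply/eqP; rewrite -subr_eq0; apply/eqP; apply: rel_phi0.
by have := rel_phi_linear (-1) hp (phi_rel h); rewrite !scaleN1r addNr addrC.
Qed.

Lemma phi_fun_linear : linear phi_fun.
Proof. by move=> t x y; apply/rel_phiE/rel_phi_linear; apply: phi_rel. Qed.

Lemma phi_class_rel j (f : k^o -> I j) p : ext_cocycle kB f -> cls (f 1) p ->
  rel_phi (ya_class H f) p.
Proof.
move=> hf fp.
(* The family that is [f] in degree [j] and 0 in all other degrees. *)
pose f' := dfwith (fun j => (fun=> 0 : I j) : k^o -> I j) f.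
have f'j : f' j = f by rewrite /f' dfwith_in.
have f'i i : i != j -> f' i = fun=> 0 by move=> ij; rewrite /f' dfwith_out // eq_sym.
exists j.+1, f', (fun i => if i == j then p else 0); split.
- move=> i; have [->|ij] := eqVneq i j; first by rewrite f'j.
  by rewrite f'i //; apply: cocycle0.
- rewrite big_ord_recr /= f'j big1 ?add0r // => i _.
  by rewrite f'i ?ya_class0 // ltn_eqF.
- move=> i; case: (eqVneq i j) => [->|ij]; first by rewrite f'j.
  by rewrite f'i //; apply: cls0.
- by rewrite big_ord_recr /= eqxx big1 ?add0r // => i _; rewrite ltn_eqF.
Qed.

Lemma phi_class j (f : k^o -> I j) p : ext_cocycle kB f -> cls (f 1) p ->
  phi_fun (ya_class H f) = p.
Proof. by move=> hf fp; apply/rel_phiE/phi_class_rel. Qed.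

Lemma phi_classM m j (f : k^o -> I m) (g : k^o -> I j) : ext_cocycle kB f -> ext_cocycle kB g ->
  phi_fun (ya_class H f * ya_class H g) = phi_fun (ya_class H f) * phi_fun (ya_class H g).
Proof.
move=> hf hg.
(* Chain maps are built from cocycles of a definite parity, so [f] is split into its even and odd
   parts, which are again cocycles. *)
wlog [b hb] : f hf / exists b, hom_of_parity kB (ir_mod I m) b f.
  move=> W; have [fi df fE] := cocycle_invariant hf.
  pose fb b := fun c : k^o => c *: spart (sm_parity (ir_mod I m)) b (f 1).
  have hfb b : hom_of_parity kB (ir_mod I m) b (fb b) by apply: invariant_hom.
  have cfb b : ext_cocycle kB (fb b).
    apply: invariant_cocycle; first exact: invariant_part.
    have [_ dp _] := ir_d_hom I m.
    have dsp c : ir_d (spart (sm_parity (ir_mod I m)) c (f 1)) =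
        spart (sm_parity (ir_mod I m.+1)) c (ir_d (f 1)).
      rewrite -{2}(spart_sum (sm_parity (ir_mod I m)) (f 1)) !linearD /=.
      rewrite !(spart_homog _ (dp _ _ (homog_spart _ _ _))).
      by case: c => /=; rewrite ?addr0 ?add0r.
    by rewrite dsp df linear0.
  have fS : ya_class H f = ya_class H (fb false) + ya_class H (fb true).
    rewrite -[X in _ = X + _]scale1r -ya_class_linear //; congr (ya_class H _).
    by apply/funext => c; rewrite scale1r /fb -scalerDr spart_sum {1}fE.
  have phD x y : phi_fun (x + y) = phi_fun x + phi_fun y := linD phi_fun_linear x y.
  by rewrite fS mulrDl !phD mulrDl !W //; [exists true | exists false].
have [fi df fE] := cocycle_invariant hf; have [gi dg gE] := cocycle_invariant hg.
have [p fp] := cocycle_cls_exists hf; have [q gq] := cocycle_cls_exists hg.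
have [_ hdf] := hf; have [F [hF F0]] := chain_map_exists hb hdf.
rewrite (ya_classM H hf hg hF F0) (phi_class hf fp) (phi_class hg gq).
have [hFj dF] := hF; have [lF _ _] := hFj j.
have hFg : ext_cocycle kB (fun x => F j (g x)).
  split=> [|x]; last first.
    have := dF j (g x); have [_ ->] := hg; have [lF1 _ _] := hFj j.+1.
    rewrite (lin0 lF1) => /esym/eqP; rewrite scaler_eq0 signr_eq0 => /eqP.
    exact.
  have [[g0 [g1 [h0 h1 gS]]] _] := hg.
  have c0 := hom_comp h0 (hFj j); have c1 := hom_comp h1 (hFj j).
  by case: b {hb hF hFj} c0 c1 => /= c0 c1; [exists (fun x => F j (g1 x)), (fun x => F j (g0 x))
    | exists (fun x => F j (g0 x)), (fun x => F j (g1 x))]; split=> // x; rewrite gS (linD lF) // addrC.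
apply: (phi_class hFg) => v; rewrite mevalM.
have Fp : @vzigzag k n (eresolution_of e_sq e_anti I) v m (F 0%N (ir_aug I 1)) p.@[v].
  by rewrite F0; apply: fp.
have := vzigzag_mul e_odd hF Fp (gq v).
(* If [b] is the parity of [m] the sign is 1; otherwise the symbol of [f] is 0 by [cls_parity]. *)
have [bm|bm] := eqVneq b (odd m).
  by rewrite bm -signr_odd oddD oddb addbb expr0 expr1n mul1r.
have p0 : p = 0.
  apply: cls_parity fp bm => //.
  have [_ pf _] := hb; rewrite -[b]addbF; apply: pf.
  by [].
by rewrite p0 meval0 !mul0r mulr0.
Qed.

Lemma phi_fun_monoid : monoid_morphism phi_fun.
Proof.
split.
  rewrite ya_class1; apply: phi_class.
    have -> : ir_aug I = fun c : k^o => c *: ir_aug I 1.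
      by apply/funext => c; rewrite -linearZ; congr (ir_aug I _); rewrite /GRing.scale /= mulr1.
    apply: invariant_cocycle; last exact: ir_d_aug.
    move=> a; rewrite -(hom_even_act _ _ (ir_aug_hom I)) trivial_act -linearZ.
    by congr (ir_aug I _).
  by move=> v /=; rewrite meval1.
pose L : {linear H -> {mpoly k[n]}} := lin phi_fun_linear.
move=> h h'; have [m [f [hf ->]]] := ya_class_gen h; have [m' [f' [hf' ->]]] := ya_class_gen h'.
rewrite -![phi_fun _]/(L _) mulr_suml !linear_sum /= mulr_suml; apply: eq_bigr => i _.
rewrite mulr_sumr -[LHS]/(L _) linear_sum mulr_sumr; apply: eq_bigr => i' _.
exact: phi_classM.
Qed.

Definition phi : {lrmorphism H -> {mpoly k[n]}} :=
  HB.pack phi_fun (GRing.isLinear.Build k H {mpoly k[n]} _ phi_fun phi_fun_linear)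
    (GRing.isMonoidMorphism.Build H {mpoly k[n]} phi_fun phi_fun_monoid).

Lemma phiE j (f : k^o -> I j) p : ext_cocycle kB f -> cls (f 1) p -> phi (ya_class H f) = p.
Proof. exact: phi_class. Qed.

Lemma phi_sum m (f : forall i, k^o -> I i) (P : nat -> {mpoly k[n]}) :
  (forall i, ext_cocycle kB (f i)) -> (forall i, cls (f i 1) (P i)) ->
  phi (\sum_(i < m) ya_class H (f i)) = \sum_(i < m) P i.
Proof. by move=> hf fP; rewrite linear_sum; apply: eq_bigr => i _; apply: phiE. Qed.

(** The primitive of a cocycle with symbol 0 must itself be invariant. The Koszul argument achieves
    this over [Lambda(V)], whereas the smash product also takes an average over [G]; whence the
    hypothesis. *)
Lemma phi_injective :
  (forall j (z : I j), inv j z -> ir_d z = 0 -> cls z 0 ->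
     ext_coboundary kB (fun c : k^o => c *: z)) -> injective phi.
Proof.
move=> bd; apply: raddf_inj => h; have [m [f [hf ->]]] := ya_class_gen h.
have /choice[P fP] : forall i, exists p, p \is i.-homog /\ cls (f i 1) p.
  move=> i; have [fi df _] := cocycle_invariant (hf i).
  by have [p [hp _ zp]] := cls_exists e_sq e_anti df (invariant_e fi); exists p.
move=> P0; have {}P0 : \sum_(i < m) P i = 0.
  by rewrite -(phi_sum m hf (fun i => (fP i).2)); exact: P0.
apply/ya_class_eq0 => // i im; have [fi df fE] := cocycle_invariant (hf i).
rewrite fE; apply: bd => //.
suff <- : P i = 0 by case: (fP i).
(* The symbols have distinct degrees, so their sum vanishes only if each of them does. *)
have := congr1 (pihomog mdeg i) P0; rewrite linear0 linear_sum /= => <-.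
rewrite (bigD1 (Ordinal im)) //= pihomog_dE ?(fP i).1 // big1 ?addr0 // => j ji.
by rewrite (pihomog_ne0 _ (fP j).1).
Qed.
End Phi.

(** * Cohomology of the exterior algebra *)

Section ExteriorInvariants.
Variables (k : fieldType) (n : nat).
Local Notation E := (exterior_superalgebra k n).
Local Notation kE := (trivial_supermodule (exterior_counit k n)).

Definition egen (i : 'I_n) : E := ebasis k [set i].

Lemma egen_odd i : is_homog (sa_parity E) true (egen i).
Proof. by have := ehomog_basis k [set i]; rewrite cards1. Qed.

Lemma egen_sq i : egen i * egen i = 0.
Proof. exact: ebasis1_sq. Qed.

Lemma egen_anti i j : egen i * egen j = - (egen j * egen i).
Proof. exact: ebasis1_anti. Qed.

Variables (X : lmodType k) (sX : supermodule E X).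

Lemma exterior_invariant (z : X) : (forall i, sm_act sX (egen i) z = 0) ->
  invariant (exterior_counit k n) sX z.
Proof.
move=> ez a.
have eS (S : {set 'I_n}) : sm_act sX (ebasis k S : E) z = (S == set0)%:R *: z.
  elim/set_max_ind: S => [|S i lti _].
    by rewrite eqxx scale1r -[ebasis k set0]/(1 : E) sm_act1.
  have -> : ebasis k (i |: S) = (ebasis k S * ebasis k [set i] : exterior k n).
    by rewrite -!(eprod_ebasis k) eprodU1r // [in RHS]/eprod enum_set1 big_seq1.
  rewrite (sm_actM sX (ebasis k S : E) (egen i)) ez linear0.
  by rewrite (_ : (i |: S == set0) = false) ?scale0r //; apply/negbTE/set0Pn; exists i; rewrite setU11.
rewrite [a]exteriorE -[LHS]/(lin (sm_linear_l sX z) _) linear_sum /=.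
rewrite (bigD1 set0) //= big1 ?addr0 => [|S S0].
  by rewrite (linZ (sm_linear_l sX z)) eS eqxx scale1r -exteriorE.
by rewrite (linZ (sm_linear_l sX z)) eS (negPf S0) scale0r scaler0.
Qed.
End ExteriorInvariants.

Section ExteriorCohomology.
Variables (k : fieldType) (n : nat).
Local Notation E := (exterior_superalgebra k n).
Local Notation kE := (trivial_supermodule (exterior_counit k n)).
Variables (L : injective_resolution kE) (HL : yoneda_algebra L).
Hypothesis char0 : [pchar k] =i pred0.
Local Notation ecls := (cls (@egen_sq k n) (@egen_anti k n)).

Definition exterior_phi : {lrmorphism HL -> {mpoly k[n]}} :=
  phi (@egen_odd k n) (@egen_sq k n) (@egen_anti k n) char0 HL.

Lemma invariant_coboundary (B : superalgebra k) (aug : superalg_hom B (base_superalgebra k))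
    (I : injective_resolution (trivial_supermodule aug)) j (h : I j) :
  invariant aug (ir_mod I j) h ->
  ext_coboundary (J := I) (n := j.+1) (trivial_supermodule aug) (fun c : k^o => c *: ir_d h).
Proof.
move=> ih; exists (fun c : k^o => c *: h); first exact: invariant_super_hom.
by move=> x; rewrite linearZ.
Qed.

Lemma exterior_phi_inj : injective exterior_phi.
Proof.
apply: phi_injective => -[|j] z iz dz z0.
  by move=> x; rewrite (cls0_deg0 z0) scaler0.
have [h -> eh] := cls0_boundary (@egen_odd k n) char0 (exterior_contraction_basis k n) dz
  (invariant_e (@egen_odd k n) iz) z0.
exact/invariant_coboundary/exterior_invariant.
Qed.

Lemma exterior_cls_surj j p : p \is j.-homog -> exists z : L j,
  [/\ ext_cocycle kE (fun c : k^o => c *: z), ecls z p &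
   @szigzag k n (eresolution_of (@egen_sq k n) (@egen_anti k n) L) j (sconst z) (pser p (1 : k^o))].
Proof.
move=> hp; have [z [dz ez zz zp]] := cls_surj (@egen_odd k n) (@egen_sq k n) (@egen_anti k n) L
  char0 (exterior_contraction_basis k n) hp.
by exists z; split=> //; apply: invariant_cocycle => //; apply: exterior_invariant.
Qed.

Lemma exterior_phi_surj p : exists h, exterior_phi h = p.
Proof.
have ex j : exists z : L j, ext_cocycle kE (fun c : k^o => c *: z) /\ ecls z (pihomog mdeg j p).
  by have [z [? ? _]] := exterior_cls_surj (pihomogP mdeg j p); exists z.
pose z j := sval (cid (ex j)); have zP j := svalP (cid (ex j)); rewrite -/(z _) in zP.
exists (\sum_(j < msize p) ya_class HL (fun c : k^o => c *: z j)).
rewrite [RHS](pihomog_partitionE (leqnn (msize p))).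
apply: (@phi_sum _ _ _ _ (@egen_odd k n) (@egen_sq k n) (@egen_anti k n) _ _ char0 HL _
    (fun j (c : k^o) => c *: z j) (fun j => pihomog mdeg j p)) => i.
  by case: (zP i).
by rewrite scale1r; case: (zP i).
Qed.

Definition exterior_kappa_fun p : HL := sval (cid (exterior_phi_surj p)).

Lemma exterior_kappa_funK : cancel exterior_kappa_fun exterior_phi.
Proof. by move=> p; exact: (svalP (cid (exterior_phi_surj p))). Qed.

Lemma exterior_phiK : cancel exterior_phi exterior_kappa_fun.
Proof. by move=> h; apply: exterior_phi_inj; rewrite exterior_kappa_funK. Qed.

Lemma exterior_kappa_linear : linear exterior_kappa_fun.
Proof. move=> t p q; apply: exterior_phi_inj; rewrite exterior_kappa_funK linearP.
by congr (_ *: _ + _); apply/esym/exterior_kappa_funK.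
Qed.

Lemma exterior_kappa_monoid : monoid_morphism exterior_kappa_fun.
Proof.
split=> [|p q]; apply: exterior_phi_inj; rewrite exterior_kappa_funK ?rmorph1 // rmorphM.
by congr (_ * _); apply/esym/exterior_kappa_funK.
Qed.

Definition exterior_kappa : {lrmorphism {mpoly k[n]} -> HL} :=
  HB.pack exterior_kappa_fun
    (GRing.isLinear.Build k {mpoly k[n]} HL _ exterior_kappa_fun exterior_kappa_linear)
    (GRing.isMonoidMorphism.Build {mpoly k[n]} HL exterior_kappa_fun exterior_kappa_monoid).

Lemma exterior_kappaE j (f : k^o -> L j) p : ext_cocycle kE f -> ecls (f 1) p ->
  exterior_kappa p = ya_class HL f.
Proof.
move=> hf fp; apply: exterior_phi_inj; transitivity p; first exact: exterior_kappa_funK.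
exact/esym/(phiE (@egen_odd k n) char0 HL hf fp).
Qed.

Lemma vact_evec j v (y : L j) :
  vact v (fun i => sm_act (ir_mod L j) (egen k i)) y = sm_act (ir_mod L j) (evec (\col_i v i) : E) y.
Proof.
rewrite /evec -[RHS]/(lin (sm_linear_l _ y) _) linear_sum; apply: eq_bigr => i _.
by rewrite mxE; apply/esym/(linZ (sm_linear_l _ y)).
Qed.

(** In degree 1 the zigzag is the connecting map: given [z = d g] and [D g = eta X_i], the constant
    term [y] of [g] satisfies [d y = z], and the coefficient of [x_l] reads
    [e_l y = (l == i) eta(1)]. *)
Lemma exterior_canonical_iso : canonical_iso exterior_kappa.
Proof.
split; first by exists exterior_phi; [apply: exterior_kappa_funK | apply: exterior_phiK].
move=> i; have hX : ('X_i : {mpoly k[n]}) \is 1%N.-homog by rewrite dhomogX /= mdeg1.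
have [z [hz zp]] := exterior_cls_surj hX.
case=> g dg gX; pose y : L 0%N := g 0%MM.
have zy : z = ir_d y.
  have := congr1 (@^~ 0%MM) dg; rewrite /smap /sconst eqxx => <-.
  by [].
have gy l : sm_act (ir_mod L 0) (egen k l) y = (l == i)%:R *: ir_aug L 1.
  have := congr1 (@^~ U_(l)%MM) gX; rewrite kdiff_U /smap /pser mcoeffX => ->.
  by rewrite eq_mnm1 eq_sym; exact: (linZ (ir_aug_linear L)).
exists y => [v|]; last first.
  by rewrite (exterior_kappaE hz) ?scale1r // zy.
have -> : evec v = evec (\col_i v i 0) :> exterior k n.
  by congr (evec _); apply/colP => l; rewrite mxE.
rewrite -(vact_evec (j := 0%N)) /vact (bigD1 i) //= gy eqxx scale1r big1 ?addr0 // => l li.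
by rewrite gy (negPf li) scale0r scaler0.
Qed.
End ExteriorCohomology.

(** * Invariants of G and the spectrum *)

Section SmashActions.
Variables (k : fieldType) (gT : finGroupType) (n : nat).
Variable rV : mx_representation k [set: gT] n.
Local Notation A := (smash_superalgebra rV).

Definition sgen (i : 'I_n) : A := sext rV (ebasis k [set i]).

Lemma sgen_odd i : is_homog (sa_parity A) true (sgen i).
Proof. exact/sext_even/egen_odd. Qed.

Lemma sgen_sq i : sgen i * sgen i = 0.
Proof. by rewrite -(rmorphM (sext rV)) /= ebasis1_sq linear0. Qed.

Lemma sgen_anti i j : sgen i * sgen j = - (sgen j * sgen i).
Proof. by rewrite -!(rmorphM (sext rV)) /= ebasis1_anti linearN. Qed.

Lemma smash_decomp (a : smash rV) : a = \sum_g sext rV (a g) * sgrp rV g.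
Proof.
have E u h g : (sext rV u * sgrp rV h) g = if g == h then u else 0.
  rewrite smulE (bigD1 1%g) //= big1 ?addr0 => [|x /negPf x1]; last by rewrite ffunE x1 mul0r.
  rewrite invg1 mul1g ffunE eqxx ffunE; case: (g == h); last by rewrite linear0 mulr0.
  by rewrite emap1 mulr1.
apply/ffunP => g; rewrite sum_ffunE (bigD1 g) //= E eqxx big1 ?addr0 // => h hg.
by rewrite E eq_sym (negPf hg).
Qed.

Lemma scounit_sgrp g : scounit (sgrp rV g) = 1.
Proof.
rewrite /scounit (bigD1 g) //= ffunE eqxx rmorph1 big1 ?addr0 // => h /negPf hg.
by rewrite ffunE hg rmorph0.
Qed.

Lemma scounit_sext u : scounit (sext rV u) = ecounit u.
Proof.
rewrite /scounit (bigD1 1%g) //= ffunE eqxx big1 ?addr0 // => h /negPf hg.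
by rewrite ffunE hg rmorph0.
Qed.

Lemma sgrp_even g : is_homog (sa_parity A) false (sgrp rV g).
Proof.
apply/shomogP => h; rewrite ffunE; case: (h == g); last exact: homog0.
exact: ehomog1.
Qed.

Variables (X : lmodType k) (sX : supermodule A X).
Local Notation gact g := (sm_act sX (sgrp rV g)).
Local Notation vec v := (sm_act sX (sext rV (evec v))).

Lemma gact1 x : gact 1%g x = x. Proof. by rewrite sgrp1 sm_act1. Qed.

Lemma gactM g h x : gact (g * h)%g x = gact g (gact h x).
Proof. by rewrite sgrpM sm_actM. Qed.

Lemma gactK g x : gact g^-1%g (gact g x) = x.
Proof. by rewrite -gactM mulVg gact1. Qed.

Lemma gactVK g x : gact g (gact g^-1%g x) = x.
Proof. by rewrite -gactM mulgV gact1. Qed.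

Lemma gact_vec g v x : gact g (vec v x) = vec (rV g *m v) (gact g x).
Proof. by rewrite -!sm_actM sgrp_sext emap_vec. Qed.

Lemma vec_sum v x : vec v x = \sum_i v i 0 *: sm_act sX (sgen i) x.
Proof.
rewrite /evec linear_sum -[LHS]/(lin (sm_linear_l sX x) _) linear_sum; apply: eq_bigr => i _.
by rewrite linearZ /= (linZ (sm_linear_l sX x)).
Qed.

Lemma evec_delta (i : 'I_n) : evec (delta_mx i 0) = ebasis k [set i].
Proof.
rewrite /evec (bigD1 i) //= mxE !eqxx scale1r big1 ?addr0 // => j /negPf ji.
by rewrite mxE ji scale0r.
Qed.

Lemma smash_invariant (z : X) : (forall i, sm_act sX (sgen i) z = 0) ->
  (forall g, gact g z = z) -> invariant (smash_counit rV) sX z.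
Proof.
move=> ez gz a; have /= iE := exterior_invariant (sX := Defs.restrict (sext_hom rV) sX) ez.
rewrite {1}[a]smash_decomp -[LHS]/(lin (sm_linear_l sX z) _) linear_sum /= /scounit scaler_suml.
by apply: eq_bigr => g _; rewrite sm_actM gz; exact: (iE (a g)).
Qed.

Lemma invariant_gact (z : X) : invariant (smash_counit rV) sX z -> forall g, gact g z = z.
Proof. by move=> iz g; rewrite iz /= scounit_sgrp scale1r. Qed.

Definition average (z : X) : X := #|gT|%:R^-1 *: \sum_g gact g z.

Lemma average_linear : linear average.
Proof.
move=> t x y; rewrite /average !scaler_sumr -big_split; apply: eq_bigr => g _ /=.
by rewrite linearP scalerDr !scalerA mulrC.
Qed.
HB.instance Definition _ := GRing.isLinear.Build k X X _ average average_linear.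

Lemma gact_average h z : gact h (average z) = average z.
Proof.
rewrite /average linearZ linear_sum /=; congr (_ *: _).
rewrite [RHS](reindex_inj (mulgI h)); apply: eq_bigr => g _.
by rewrite gactM.
Qed.

Lemma average_e z : (forall i, sm_act sX (sgen i) z = 0) ->
  forall i, sm_act sX (sgen i) (average z) = 0.
Proof.
move=> ez i; rewrite /average (linZ (sm_linear_r sX _)).
have -> : sm_act sX (sgen i) (\sum_g gact g z) = \sum_g sm_act sX (sgen i) (gact g z).
  exact: linear_sum.
rewrite big1 ?scaler0 // => g _.
(* [e_i g z = g (g^-1 e_i) z], and every vector of [V] kills [z]. *)
rewrite /sgen -evec_delta -[delta_mx i 0]mul1mx -(repr_mx1 rV) -(mulgV g) rV_mul -mulmxA.
by rewrite -gact_vec vec_sum big1 ?linear0 // => j _; rewrite ez scaler0.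
Qed.

Hypothesis char0 : [pchar k] =i pred0.

Lemma average_id z : (forall g, gact g z = z) -> average z = z.
Proof.
move=> gz; rewrite /average (eq_bigr (fun=> z)) // sumr_const.
rewrite -scaler_nat scalerA mulVf ?scale1r // ((pcharf0P k).1 char0) -lt0n.
by rewrite -cardsT cardG_gt0.
Qed.
End SmashActions.

Section PolyAct.
Variables (k : fieldType) (gT : finGroupType) (n : nat).
Variable rV : mx_representation k [set: gT] n.

Definition gpoint (g : gT) (v : 'I_n -> k) : 'I_n -> k := fun i => \sum_j rV g i j * v j.

Lemma gpoint_mulmx g v i : gpoint g v i = (rV g *m (\col_i v i)) i 0.
Proof. by rewrite mxE; apply: eq_bigr => j _; rewrite mxE. Qed.

Lemma gpointM g h v : gpoint (g * h)%g v = gpoint g (gpoint h v).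
Proof.
apply/funext => i; rewrite !gpoint_mulmx rV_mul -mulmxA.
by congr ((_ *m _) i 0); apply/colP => j; rewrite !mxE; apply: eq_bigr => l _; rewrite mxE.
Qed.

Lemma gpoint1 v : gpoint 1%g v = v.
Proof. by apply/funext => i; rewrite gpoint_mulmx repr_mx1 mul1mx mxE. Qed.

Lemma poly_act_eval g p v : (poly_act rV g p).@[v] = p.@[gpoint g^-1%g v].
Proof.
rewrite /poly_act comp_mpoly_meval; apply: meval_eq => i.
rewrite tnth_mktuple raddf_sum; apply: eq_bigr => j _ /=.
by rewrite mevalZ mevalXU.
Qed.

Lemma poly_act_linear g : linear (poly_act rV g).
Proof. by move=> t p q; rewrite /poly_act linearP. Qed.

End PolyAct.

(** * Cohomology of the smash product *)

Section SmashCohomology.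
Variables (k : fieldType) (gT : finGroupType) (n : nat).
Variable rV : mx_representation k [set: gT] n.
Local Notation A := (smash_superalgebra rV).
Local Notation kA := (trivial_supermodule (smash_counit rV)).
Local Notation E := (exterior_superalgebra k n).
Local Notation kE := (trivial_supermodule (exterior_counit k n)).
Variables (I : injective_resolution kA) (H : yoneda_algebra I).
Hypothesis char0 : [pchar k] =i pred0.
Local Notation scls := (cls (sgen_sq rV) (sgen_anti rV)).
Local Notation ecls := (cls (@egen_sq k n) (@egen_anti k n)).
Local Notation gact g := (sm_act (ir_mod I _) (sgrp rV g)).
Local Notation poly_act := (poly_act rV).

Definition smash_phi : {lrmorphism H -> {mpoly k[n]}} :=
  phi (sgen_odd rV) (sgen_sq rV) (sgen_anti rV) char0 H.

Lemma gact_d g j (z : I j) : gact g (ir_d z) = ir_d (gact g z).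
Proof. exact/esym/(hom_even_act _ _ (ir_d_hom I j)). Qed.

Lemma gact_aug g c : gact g (ir_aug I c) = ir_aug I c.
Proof.
rewrite -(hom_even_act _ _ (ir_aug_hom I)) trivial_act.
by congr (ir_aug I _); rewrite /= scounit_sgrp mul1r.
Qed.

(** As [v g = g (g^-1 v)] in the smash product, [g] carries a zigzag for [g^-1 v] to one for [v]. *)
Lemma cls_gact g j (z : I j) p : scls z p -> scls (gact g z) (poly_act g p).
Proof.
move=> zp v; rewrite poly_act_eval; move: (zp (gpoint rV g^-1%g v)).
pose X := eresolution_of (sgen_sq rV) (sgen_anti rV) I.
apply: (@zigzag_map (fun j => I j) (fun j => I j) k^o k^o
  (fun j => er_d X j) (fun j => vact (gpoint rV g^-1%g v) (er_e X j)) (er_eta X)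
  (fun j => er_d X j) (fun j => vact v (er_e X j)) (er_eta X) (fun j => gact g) (fun c => c)).
- by move=> i a; apply: gact_d.
- move=> i a.
  have vE w (y : I i) : vact w (fun i' => sm_act (ir_mod I i) (sgen rV i')) y =
      sm_act (ir_mod I i) (sext rV (evec (\col_l w l))) y.
    by rewrite vec_sum; apply: eq_bigr => l _; rewrite mxE.
  rewrite [LHS](congr1 (gact g) (vE _ a)) [RHS]vE gact_vec.
  congr (sm_act (ir_mod I i) _ _); congr (sext rV (evec _)).
  apply/colP => l; rewrite -gpoint_mulmx -gpointM mulgV gpoint1 mxE.
  by [].
- exact: gact_aug.
Qed.

Lemma cls_average j (z : I j) p : scls z p ->
  scls (average (ir_mod I j) z) (#|gT|%:R^-1 *: \sum_g poly_act g p).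
Proof.
move=> zp; rewrite /average -[X in scls X]addr0 -[X in scls _ X]addr0.
apply: cls_linear; last exact: cls0.
elim/big_rec2: _ => [|g y x _ xy]; first exact: cls0.
by rewrite -[gact g z]scale1r -[poly_act g p]scale1r; apply: cls_linear => //; apply: cls_gact.
Qed.

Lemma average_d j (h : I j) : average (ir_mod I j.+1) (ir_d h) = ir_d (average (ir_mod I j) h).
Proof.
rewrite /average [RHS](linZ (@ir_d_linear _ _ _ _ I j)); congr (_ *: _).
rewrite [RHS](linear_sum (@ir_d _ _ _ _ I j)); apply: eq_bigr => g _; exact: gact_d.
Qed.

(** The Koszul argument yields a primitive killed by [V] only. Its average is also fixed by [G], and
    still bounds [z] because [z] is fixed already. *)
Lemma smash_phi_inj : injective smash_phi.
Proof.
apply: phi_injective => -[|j] z iz dz z0.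
  by move=> x; rewrite (cls0_deg0 z0) scaler0.
have [h zh eh] := cls0_boundary (sgen_odd rV) char0 (smash_contraction_basis rV) dz
  (invariant_e (sgen_odd rV) iz) z0.
have -> : z = ir_d (average (ir_mod I j) h).
  by rewrite -average_d -zh average_id //; apply: invariant_gact.
apply/invariant_coboundary/smash_invariant; first exact: average_e.
by move=> g; apply: gact_average.
Qed.

Lemma smash_phi_classE j (f : k^o -> I j) p : ext_cocycle kA f -> scls (f 1) p ->
  smash_phi (ya_class H f) = p.
Proof. exact: phiE. Qed.

Lemma smash_phi_invariant h g : poly_act g (smash_phi h) = smash_phi h.
Proof.
have [m [f [hf ->]]] := ya_class_gen h.
have /choice[P fP] : forall i, exists p, scls (f i 1) p.
  by move=> i; apply: (cocycle_cls_exists (sgen_odd rV)).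
have -> : smash_phi (\sum_(i < m) ya_class H (f i)) = \sum_(i < m) P i by apply: phi_sum.
rewrite -[LHS]/(lin (poly_act_linear rV g) _) linear_sum; apply: eq_bigr => i _ /=.
apply: (cls_uniq (sgen_odd rV) char0 _ (fP i)).
have [fi _ _] := cocycle_invariant (hf i).
by rewrite -(invariant_gact fi g); apply: cls_gact.
Qed.

Definition reynolds (p : {mpoly k[n]}) := #|gT|%:R^-1 *: \sum_g poly_act g p.

Lemma card_gT_neq0 : #|gT|%:R != 0 :> k.
Proof. by rewrite ((pcharf0P k).1 char0) -lt0n -cardsT cardG_gt0. Qed.

Lemma reynolds_id p : (forall g, poly_act g p = p) -> reynolds p = p.
Proof.
move=> gp; rewrite /reynolds (eq_bigr (fun=> p)) // sumr_const -scaler_nat scalerA.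
by rewrite mulVf ?scale1r // card_gT_neq0.
Qed.

Lemma reynolds_linear : linear reynolds.
Proof.
move=> t p q; rewrite /reynolds !scaler_sumr -big_split; apply: eq_bigr => g _ /=.
by rewrite (poly_act_linear rV g t) scalerDr !scalerA mulrC.
Qed.

Lemma poly_act_comp g h p : poly_act g (poly_act h p) = poly_act (g * h)%g p.
Proof.
by apply: (mpoly_eval_inj char0) => v; rewrite !poly_act_eval -gpointM invMg.
Qed.

Lemma reynolds_invariant p h : poly_act h (reynolds p) = reynolds p.
Proof.
have lh := poly_act_linear rV h.
rewrite /reynolds (linZ lh) [X in _ *: X](linear_sum (lin lh)); congr (_ *: _).
by rewrite [RHS](reindex_inj (mulgI h)); apply: eq_bigr => g _; apply: poly_act_comp.
Qed.

(** Instead of showing that the homogeneous parts of [p] are invariant, [reynolds] is applied to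
    each of them; their sum is [reynolds p = p]. *)
Lemma smash_phi_surj p : (forall g, poly_act g p = p) -> exists h, smash_phi h = p.
Proof.
move=> gp.
have ex j : exists z : I j, ext_cocycle kA (fun c : k^o => c *: z) /\ scls z (reynolds (pihomog mdeg j p)).
  have [z [dz ez _ zp]] := cls_surj (sgen_odd rV) (sgen_sq rV) (sgen_anti rV) I
    char0 (smash_contraction_basis rV) (pihomogP mdeg j p).
  exists (average (ir_mod I j) z); split; last exact: cls_average.
  apply: invariant_cocycle; last by rewrite -average_d dz linear0.
  by apply: smash_invariant; [exact: average_e | move=> g; apply: gact_average].
pose z j := sval (cid (ex j)); have zP j := svalP (cid (ex j)); rewrite -/(z _) in zP.
exists (\sum_(j < msize p) ya_class H (fun c : k^o => c *: z j)).
transitivity (\sum_(j < msize p) reynolds (pihomog mdeg j p)).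
  apply: (@phi_sum _ _ _ _ (sgen_odd rV) (sgen_sq rV) (sgen_anti rV) _ _ char0 H _
    (fun j (c : k^o) => c *: z j) (fun j => reynolds (pihomog mdeg j p))) => i.
    by case: (zP i).
  by rewrite scale1r; case: (zP i).
rewrite -[RHS](reynolds_id gp) [in RHS](pihomog_partitionE (leqnn (msize p))).
by rewrite -[RHS]/(lin reynolds_linear _) linear_sum.
Qed.

Variables (L : injective_resolution kE) (HL : yoneda_algebra L).
Variable tau : forall i, I i -> L i.
Hypothesis tau_res : restriction_comparison tau.

Lemma restriction_cls j (z : I j) p : scls z p -> ecls (tau z : L j) p.
Proof.
case: tau_res => htau taud taua zp v; move: (zp v).
pose X := eresolution_of (sgen_sq rV) (sgen_anti rV) I.
pose Y := eresolution_of (@egen_sq k n) (@egen_anti k n) L.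
apply: (@zigzag_map (fun j => I j) (fun j => L j) k^o k^o
  (fun j => er_d X j) (fun j => vact v (er_e X j)) (er_eta X)
  (fun j => er_d Y j) (fun j => vact v (er_e Y j)) (er_eta Y) tau (fun c => c)).
- by move=> i a; apply: taud.
- move=> i a; have [l _ _] := htau i.
  rewrite -[LHS]/(lin l _) linear_sum; apply: eq_bigr => l' _.
  rewrite linearZ; congr (_ *: _).
  exact: (hom_even_act (egen k l') a (htau i)).
- exact: taua.
Qed.

Lemma restriction_cocycle j (f : k^o -> I j) : ext_cocycle kA f -> ext_cocycle kE (fun c => tau (f c) : L j).
Proof.
case: tau_res => htau taud _ /cocycle_invariant[fi df fE]; have [l _ _] := htau j.
have -> : (fun c => tau (f c)) = fun c : k^o => c *: tau (f 1).
  by apply/funext => c; rewrite fE /= scale1r (linZ l).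
apply: invariant_cocycle; last by rewrite -taud df; have [l' _ _] := htau j.+1; rewrite (lin0 l').
move=> a; rewrite -(hom_even_act a _ (htau j)) -(linZ l).
by congr (tau _); rewrite -[LHS]/(sm_act (ir_mod I j) (sext rV a) (f 1)) fi /= scounit_sext.
Qed.

Lemma smash_restriction_iso :
  restriction_iso tau (exterior_kappa HL char0) smash_phi.
Proof.
split=> [i f hf||p].
- have [p fp] := cocycle_cls_exists (sgen_odd rV) (sgen_sq rV) (sgen_anti rV) hf.
  rewrite (smash_phi_classE hf fp); apply: exterior_kappaE; first exact: restriction_cocycle.
  exact: restriction_cls.
- exact: smash_phi_inj.
split=> [[h ->] g|/smash_phi_surj[h <-]]; first exact: smash_phi_invariant.
by exists h.
Qed.
End SmashCohomology.

(** * Orbits and maximal ideals *)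

Section Separation.
Variables (k : fieldType) (n : nat).

Lemma separating_poly (T : finType) (w : T -> 'I_n -> k) (v : 'I_n -> k) :
  exists r : {mpoly k[n]}, r.@[v] = 1 /\ forall t, w t <> v -> r.@[w t] = 0.
Proof.
have /choice[r rP] : forall t, exists r : {mpoly k[n]}, r.@[v] = 1 /\ (w t <> v -> r.@[w t] = 0).
  move=> t; have [wv|/eqP wv] := pselect (w t = v); first by exists 1; split=> //; rewrite meval1.
  have [i wi] : exists i, w t i != v i.
    apply: contrapT => h; case/eqP: wv; apply/funext => i.
    by apply/eqP/negPn/negP => hi; apply: h; exists i.
  exists ((v i - w t i)^-1 *: ('X_i - (w t i)%:MP)).
  by rewrite !mevalZ !mevalB !mevalXU !mevalC subrr mulr0 mulVf // subr_eq0 eq_sym.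
exists (\prod_t r t); split.
  by rewrite rmorph_prod big1 // => t _; case: (rP t).
move=> t wt; rewrite rmorph_prod (bigD1 t) //= (rP t).2 // mul0r.
by [].
Qed.
End Separation.

Section OrbitSpace.
Variables (k : closedFieldType) (gT : finGroupType) (n : nat).
Variable rV : mx_representation k [set: gT] n.
Local Notation A := (smash_superalgebra rV).
Local Notation kA := (trivial_supermodule (smash_counit rV)).
Variables (I : injective_resolution kA) (H : yoneda_algebra I).
Hypothesis char0 : [pchar k] =i pred0.
Local Notation Phi := (smash_phi H char0).
Local Notation pt v := (fun i => v i 0).

Lemma pt_mulmx g (v : 'cV[k]_n) : pt (rV g *m v) = gpoint rV g (pt v).
Proof. by apply/funext => i; rewrite mxE. Qed.

Lemma reynolds_eval p v :
  (reynolds rV p).@[v] = #|gT|%:R^-1 * \sum_g p.@[gpoint rV g^-1%g v].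
Proof.
rewrite /reynolds mevalZ raddf_sum; congr (_ * _); apply: eq_bigr => g _.
exact: poly_act_eval.
Qed.

(** [r] is 1 at [v] and 0 at the other points of its orbit. Only the stabiliser of [v] contributes
    to the average, which is [p(v)] times the order of the stabiliser divided by that of [G]. *)
Lemma reynolds_nonvanishing p v : p.@[v] != 0 ->
  exists r : {mpoly k[n]}, (reynolds rV (r * p)).@[v] != 0.
Proof.
move=> pv; have [r [rv rg]] := separating_poly (fun g => gpoint rV g^-1%g v) v.
exists r; rewrite reynolds_eval mulf_neq0 ?invr_eq0 ?card_gT_neq0 //.
pose S := [pred g : gT | `[< gpoint rV g^-1%g v = v >]].
rewrite (bigID S) /= [X in _ + X]big1 ?addr0; last first.
  by move=> g /asboolP gv; rewrite mevalM rg // mul0r.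
rewrite (eq_bigr (fun=> p.@[v])) => [|g /asboolP gv]; last by rewrite mevalM gv rv mul1r.
rewrite sumr_const -mulr_natl mulf_neq0 // ((pcharf0P k).1 char0) -lt0n.
by apply/card_gt0P; exists 1%g; apply/asboolP; rewrite invg1 gpoint1.
Qed.

Lemma smash_phi_gpoint h g v : (Phi h).@[gpoint rV g v] = (Phi h).@[v].
Proof.
by rewrite -{1}(smash_phi_invariant char0 h g) poly_act_eval -gpointM mulVg gpoint1.
Qed.

Lemma reynoldsM h q : reynolds rV (q * Phi h) = reynolds rV q * Phi h.
Proof.
apply: (mpoly_eval_inj char0) => v; rewrite mevalM !reynolds_eval -mulrA mulr_suml.
by congr (_ * _); apply: eq_bigr => g _; rewrite mevalM smash_phi_gpoint.
Qed.

Lemma point_ideal_two_sided v : two_sided_ideal (point_ideal Phi v).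
Proof.
rewrite /point_ideal; split=> [|x y Kx Ky|a x Kx]; first by rewrite linear0 meval0.
  by rewrite linearB mevalB; rewrite [X in X - _]Kx [X in _ - X]Ky subrr.
by split; rewrite rmorphM mevalM; [rewrite [X in _ * X]Kx mulr0 | rewrite [X in X * _]Kx mul0r].
Qed.

Lemma point_ideal1 v : ~ point_ideal Phi v 1.
Proof. by rewrite /point_ideal rmorph1 meval1 => /eqP; rewrite oner_eq0. Qed.

(** The residue ring is [k]: with [c] the value of [x] at [v], the point ideal contains [x - c], so
    [L] contains [c] and, when [c != 0], also 1. *)
Lemma point_ideal_max v (L : H -> Prop) : two_sided_ideal L ->
  (forall x, point_ideal Phi v x -> L x) -> ~ L 1 -> forall x, L x -> point_ideal Phi v x.
Proof.
move=> [L0 LB LM] KL L1 x Lx; apply: contrapT => /eqP xv; apply: L1.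
set c := (Phi x).@[_] in xv.
have : L (x - (x - c *: 1)).
  apply: LB => //; apply: KL; rewrite /point_ideal linearB linearZ rmorph1 mevalB mevalZ meval1.
  by rewrite mulr1; apply/eqP; rewrite subr_eq0.
rewrite opprB addrCA subrr addr0 => Lc.
by have [] := LM (c^-1 *: 1) _ Lc; rewrite -scalerAl mul1r scalerA mulVf // scale1r.
Qed.

Lemma in_Max_pointP (J : H -> Prop) v :
  in_Max J (point_ideal Phi v) <-> (forall x, J x -> point_ideal Phi v x).
Proof.
split=> [[_ rad _ _] x Jx|JK]; first by apply: (rad x 1%N); rewrite expr1.
split; [exact: point_ideal_two_sided | | exact: point_ideal1 | exact: point_ideal_max].
move=> x m /JK; rewrite /point_ideal rmorphXn => xm; apply/eqP.
have : (Phi x).@[pt v] ^+ m == 0 by rewrite -rmorphXn; apply/eqP.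
by rewrite expf_eq0 => /andP[].
Qed.

Lemma maximal_point (K : H -> Prop) : two_sided_ideal K -> ~ K 1 ->
  (forall L, two_sided_ideal L -> (forall x, K x -> L x) -> ~ L 1 -> forall x, L x -> K x) ->
  exists v, forall h, K h <-> point_ideal Phi v h.
Proof.
move=> [K0 KB KM] K1 Kmax.
have KD x y : K x -> K y -> K (x + y).
  by move=> Kx Ky; rewrite -[y]opprK -[- y]sub0r; apply: (KB) => //; apply: (KB).
(* The largest ideal that the Reynolds operator maps into [Phi(K)]. It contains [Phi(K)] by
   [reynoldsM], and it is proper because the Reynolds operator fixes 1. *)
pose J (p : {mpoly k[n]}) := forall q, exists2 h, K h & reynolds rV (q * p) = Phi h.
have rl := reynolds_linear rV.
have [||v Jv] := @nullstellensatz k n J char0.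
- split=> [q|p q Jp Jq r|r p Jp q].
  + by exists 0 => //; rewrite mulr0 (lin0 rl) linear0.
  + have [h Kh hE] := Jp r; have [h' Kh' hE'] := Jq r.
    by exists (h + h'); [apply: KD | rewrite mulrDr (linD rl) hE hE' linearD].
  + have [h Kh hE] := Jp (q * r); exists h; first exact: Kh.
    by rewrite mulrA.
- move=> /(_ 1)[h Kh]; rewrite mulr1 reynolds_id => [E|//|g]; last first.
    by apply: (mpoly_eval_inj char0) => v; rewrite poly_act_eval !meval1.
  suff h1 : h = 1 by apply: K1; rewrite -h1.
  by apply: (@smash_phi_inj _ _ _ _ _ H char0); rewrite -[LHS]E rmorph1.
exists (\col_i v i) => h.
have vE : pt (\col_i v i) = v by apply/funext => i; rewrite mxE.
have KP x : K x -> point_ideal Phi (\col_i v i) x.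
  move=> Kx; rewrite /point_ideal vE; apply: Jv => q; rewrite reynoldsM.
  have [y <-] := smash_phi_surj H char0 (reynolds_invariant rV char0 q).
  by exists (y * x); [case: (KM y x Kx) | rewrite rmorphM].
split; first exact: KP.
by apply: Kmax => //; [exact: point_ideal_two_sided | exact: point_ideal1].
Qed.

Lemma smash_orbit_space_homeo : orbit_space_homeo rV Phi.
Proof.
split.
- by move=> v; apply/in_Max_pointP => x ->; rewrite /point_ideal linear0 meval0.
- by move=> K [idK _ K1 Kmax]; apply: maximal_point.
- move=> v w; split=> [vw|[g ->] h]; last first.
    by rewrite /point_ideal [in X in _ <-> X]pt_mulmx smash_phi_gpoint.
  apply: contrapT => nvw.
  (* [r] vanishes on the orbit of [w] and is 1 at [v]; the average of a suitable multiple is an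
     invariant separating the two orbits. *)
  have [r [rv rg]] := separating_poly (fun g => gpoint rV g^-1%g (pt w)) (pt v).
  have r1 : r.@[pt v] != 0 by rewrite rv oner_eq0.
  have [s sv] := reynolds_nonvanishing r1.
  have [h hE] := smash_phi_surj H char0 (reynolds_invariant rV char0 (s * r)).
  case/eqP: sv; rewrite -hE; apply/vw; rewrite /point_ideal hE reynolds_eval big1 ?mulr0 //.
  move=> g _; rewrite mevalM rg ?mulr0 // => E; apply: nvw; exists g.
  apply/colP => i; rewrite -[RHS]/(pt (rV g *m v) i) pt_mulmx.
  have <- : gpoint rV g^-1%g (pt w) = pt v by [].
  by rewrite -gpointM mulgV gpoint1.
- move=> Z Zorb; split=> [[S ZS]|[S ZS]]; last first.
    exists (fun p => exists2 h, S h & p = Phi h) => v; split=> [/ZS h p [x Sx ->]|h]; first exact: h.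
    by apply/ZS => x Sx; apply: h; exists x.
  (* The invariants that vanish on [Z]. If a defining polynomial [p] is nonzero at [v], the average
     of some [s * p] is nonzero at [v] too, and it vanishes on [Z] because [Z] is stable. *)
  exists (fun h => forall v, Z v -> point_ideal Phi v h) => v; split=> [Zv h Sh|hv]; first exact: Sh.
  apply: contrapT => nZ.
  have [p Sp pv] : exists2 p, S p & p.@[pt v] != 0.
    apply: contrapT => np; apply/nZ/ZS => p Sp; apply/eqP/negPn/negP => pv.
    by apply: np; exists p.
  have [s sv] := reynolds_nonvanishing pv.
  have [h hE] := smash_phi_surj H char0 (reynolds_invariant rV char0 (s * p)).
  case/eqP: sv; rewrite -hE; apply: hv => w Zw.
  rewrite /point_ideal hE reynolds_eval big1 ?mulr0 // => g _.
  rewrite mevalM -pt_mulmx; have /ZS/(_ p Sp) -> : Z (rV g^-1%g *m w).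
    by apply: Zorb Zw; exists g^-1%g.
  by rewrite mulr0.
Qed.
End OrbitSpace.

(** * Supports *)

Section FreeLine.
Variables (k : fieldType) (M : vectType k).
Local Notation E1 := (exterior_superalgebra k 1).
Variable sM : supermodule E1 M.
Hypothesis char0 : [pchar k] =i pred0.
Local Notation t0 := (ebasis k [set ord0] : E1).
Local Notation t := (sm_act sM t0).
Local Notation ep := (eps (sm_parity sM)).

Lemma ext1E (a : exterior k 1) : a = a set0 *: (1 : exterior k 1) + a [set ord0] *: ebasis k [set ord0].
Proof.
have S1 (S : {set 'I_1}) : S = set0 \/ S = [set ord0].
  case: (boolP (ord0 \in S)) => h; [right|left]; apply/setP => i; rewrite (ord1 i) !inE //.
  exact/negbTE.
have n0 : (set0 == [set ord0] :> {set 'I_1}) = false.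
  by apply/negbTE; rewrite eq_sym; apply/set0Pn; exists ord0; rewrite inE.
apply/ffunP => S; rewrite -[1]/(ebasis k set0); case: (S1 S) => ->; rewrite !ffunE eqxx.
  by rewrite n0 scaler0 addr0 [RHS]mulr1.
by rewrite eq_sym n0 scaler0 add0r [RHS]mulr1.
Qed.

Lemma ext1_comm (a : exterior k 1) : ebasis k [set ord0] * a = a * ebasis k [set ord0].
Proof.
by rewrite [a]ext1E mulrDl mulrDr -!scalerAl -!scalerAr mul1r mulr1.
Qed.

Lemma line_sq x : t (t x) = 0.
Proof. by rewrite -sm_actM /= ebasis1_sq (lin0 (sm_linear_l sM x)). Qed.

Lemma line_eps x : ep (t x) = - t (ep x).
Proof. by rewrite (act_eps _ _ (egen_odd k ord0)) expr1 scaleN1r. Qed.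

Lemma line_actE a x : sm_act sM a x = (a : exterior k 1) set0 *: x + (a : exterior k 1) [set ord0] *: t x.
Proof.
have l := sm_linear_l sM x; rewrite {1}[a]ext1E -[LHS]/(lin l _) linearD !linearZ /=.
by rewrite sm_act1.
Qed.

(** Such a map exists exactly when the module is free; freeness enters the argument in this form. *)
Definition line_homotopy (s : M -> M) := linear s /\ forall x, t (s x) + s (t x) = x.

Lemma free_line_homotopy : free_supermodule sM -> exists s, line_homotopy s.
Proof.
move=> [r [b [_ bE]]].
have /choice[c cE] : forall x, exists c : {ffun 'I_r -> E1}, x = \sum_i sm_act sM (c i) (b i).
  by move=> x; have [c []] := bE x; exists c.
have cu x (c' : {ffun 'I_r -> E1}) : x = \sum_i sm_act sM (c' i) (b i) -> c x = c'.
  by move=> xE; have [d [_ du]] := bE x; rewrite -(du _ (cE x)) -(du _ xE).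
have clin u x y i : c (u *: x + y) i = u *: c x i + c y i.
  rewrite (cu _ [ffun i => u *: c x i + c y i]) ?ffunE //.
  rewrite {1}(cE x) {1}(cE y) scaler_sumr -big_split; apply: eq_bigr => j _ /=.
  by rewrite ffunE (sm_linear_l sM (b j)).
have ct x i : c (t x) i = (ebasis k [set ord0] * (c x i : exterior k 1)).
  rewrite (cu _ [ffun i => t0 * c x i]) ?ffunE // {1}(cE x) linear_sum.
  by apply: eq_bigr => j _; rewrite ffunE sm_actM.
exists (fun x => \sum_i sm_act sM (econtr ord0 (c x i)) (b i)); split=> [u x y|x].
  rewrite scaler_sumr -big_split; apply: eq_bigr => i _ /=.
  by rewrite clin linearP (sm_linear_l sM (b i)).
rewrite [RHS]cE linear_sum -big_split; apply: eq_bigr => i _ /=.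
rewrite -sm_actM -(linD (sm_linear_l sM (b i))); congr (sm_act sM _ _).
(* The contraction is adapted to right multiplication; as [k[t]/(t^2)] is commutative, it serves on
   the left as well. *)
by rewrite [LHS]addrC ct ext1_comm ext1_comm econtrM eqxx scale1r.
Qed.

(** [- eps s eps] is again a homotopy, because [eps] anticommutes with [t]; the mean of the two is
    odd. *)
Lemma line_homotopy_odd s : line_homotopy s ->
  exists2 s', line_homotopy s' & forall x, ep (s' x) = - s' (ep x).
Proof.
move=> [ls sE]; have two0 : 2%:R != 0 :> k := two_neq0 char0.
exists (fun x => 2%:R^-1 *: (s x - ep (s (ep x)))) => [|x]; last first.
  by rewrite linearZ linearB /= !epsK -scalerN opprB.
split=> [u x y|x].
  rewrite (eps_linear _ u x y) !ls (eps_linear _ u) opprD addrACA -scalerBr scalerDr.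
  by rewrite !scalerA mulrC.
have lt := sm_linear_r sM t0.
have lep := eps_linear (sm_parity sM).
have tep y : t (ep y) = - ep (t y) by rewrite line_eps opprK.
rewrite (linZ lt) -scalerDr (linB lt) addrACA sE tep (line_eps x).
have sN y : s (- y) = - s y by rewrite -!scaleN1r (linZ ls).
have epN y : ep (- y) = - ep y by rewrite -!scaleN1r (linZ lep).
rewrite opprK sN epN opprK -(linD lep) sE epsK -mulr2n -scaler_nat scalerA mulVf //.
by rewrite scale1r.
Qed.

(** [P = s t] is a projector and [x = P x + t (P (s x))], so a basis of the image of [P] is a basis
    over [k[t]/(t^2)]. With [s] odd, [P] is even and this basis can be taken homogeneous. *)
Lemma free_of_homotopy s : line_homotopy s -> free_supermodule sM.
Proof.
move=> /line_homotopy_odd[{}s [ls sE] sodd].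
have lt := sm_linear_r sM t0.
have tst x : t (s (t x)) = t x.
  by have := sE (t x); rewrite line_sq (lin0 ls) addr0.
pose P x := s (t x).
have PP x : P (P x) = P x by rewrite /P tst.
have lP : linear P by move=> u x y; rewrite /P lt ls.
have Pep x : ep (P x) = P (ep x).
  by rewrite /P sodd line_eps -!scaleN1r (linZ ls) scalerA mulrNN mul1r scale1r.
have Phom b x : is_homog (sm_parity sM) b x -> is_homog (sm_parity sM) b (P x).
  by move=> hx; apply: homog_eps => //; rewrite Pep (eps_homog hx) (linZ lP).
have lPp b : linear (fun x => P (spart (sm_parity sM) b x)).
  by move=> u x y; rewrite spart_linear lP.
pose U b := limg (linfun (lin (lPp b))).
have UP b x : x \in U b -> is_homog (sm_parity sM) b x /\ P x = x.
  by case/memv_imgP => y _ ->; rewrite lfunE /= PP; split=> //; apply/Phom/homog_spart.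
pose B := vbasis (U false) ++ vbasis (U true).
have Bhom y : y \in B -> exists p, is_homog (sm_parity sM) p y.
  by rewrite mem_cat => /orP[] /vbasis_mem/UP[h _]; [exists false | exists true].
have BP y : y \in B -> P y = y.
  by rewrite mem_cat => /orP[] /vbasis_mem/UP[].
have Bfree : free B.
  rewrite cat_free !(basis_free (vbasisP _)) /=; apply/directv_addP/eqP.
  rewrite !(span_basis (vbasisP _)) -subv0; apply/subvP => x.
  rewrite memv_cap memv0 => /andP[/UP[h0 _] /UP[h1 _]].
  by rewrite -h0 -h1 spartK.
have Bspan x : P x \in <<B>>%VS.
  rewrite span_cat !(span_basis (vbasisP _)).
  rewrite -(spart_sum (sm_parity sM) x) (linD lP); apply: memv_add.
    by apply/memv_imgP; exists x; rewrite ?memvf // lfunE.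
  by apply/memv_imgP; exists x; rewrite ?memvf // lfunE.
pose r := size B; pose b := in_tuple B.
have sb (i : 'I_r) : P b`_i = b`_i by apply/BP/mem_nth.
exists r, (fun i => b`_i); split=> [i|x]; first exact/Bhom/mem_nth.
have sum_act (c : {ffun 'I_r -> E1}) : \sum_i sm_act sM (c i) b`_i =
    \sum_i ((c i : exterior k 1) set0) *: b`_i + t (\sum_i ((c i : exterior k 1) [set ord0]) *: b`_i).
  rewrite (linear_sum (lin lt)) -big_split; apply: eq_bigr => i _ /=.
  by rewrite line_actE [in RHS](linZ lt).
have PB (f : 'I_r -> k) : P (\sum_i f i *: b`_i) = \sum_i f i *: b`_i.
  by rewrite -[LHS]/(lin lP _) linear_sum; apply: eq_bigr => i _; rewrite /= (linZ lP) sb.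
(* [P] kills the image of [t], which isolates the first sum; then [s t = P] isolates the second. *)
have indep (f g : 'I_r -> k) : \sum_i f i *: b`_i + t (\sum_i g i *: b`_i) = 0 ->
    (forall i, f i = 0) /\ forall i, g i = 0.
  move=> fg0; have /freeP fr : free b by [].
  have f0 : \sum_i f i *: b`_i = 0.
    have := congr1 P fg0; rewrite (linD lP) PB (lin0 lP) /P line_sq (lin0 ls) addr0.
    by [].
  split; first exact: fr.
  apply: fr; have := congr1 s fg0; rewrite f0 add0r (lin0 ls) -[s (t _)]/(P _) PB.
  by [].
pose c : {ffun 'I_r -> E1} := [ffun i =>
   coord b i (P x) *: (1 : exterior k 1) + coord b i (P (s x)) *: ebasis k [set ord0]].
have c0 i : (c i : exterior k 1) set0 = coord b i (P x) /\
    (c i : exterior k 1) [set ord0] = coord b i (P (s x)).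
  have n0 : (set0 == [set ord0] :> {set 'I_1}) = false.
    by apply/negbTE; rewrite eq_sym; apply/set0Pn; exists ord0; rewrite inE.
  rewrite ffunE; split; rewrite -[1]/(ebasis k set0) !ffunE eqxx.
    by rewrite n0 scaler0 addr0 [LHS]mulr1.
  by rewrite eq_sym n0 scaler0 add0r [LHS]mulr1.
have coordE y : P y = \sum_i coord b i (P y) *: b`_i by apply: coord_span.
have xE : x = \sum_i sm_act sM (c i) b`_i.
  rewrite sum_act; have -> : \sum_i ((c i : exterior k 1) set0) *: b`_i = P x.
    by rewrite [RHS]coordE; apply: eq_bigr => i _; rewrite (c0 i).1.
  have -> : \sum_i ((c i : exterior k 1) [set ord0]) *: b`_i = P (s x).
    by rewrite [RHS]coordE; apply: eq_bigr => i _; rewrite (c0 i).2.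
  by rewrite /P tst addrC sE.
exists c; split=> [|c' c'E]; first exact: xE.
apply/ffunP => i.
have E : \sum_i sm_act sM (c i) b`_i = \sum_i sm_act sM (c' i) b`_i by rewrite -xE.
move/eqP: E; rewrite -subr_eq0 !sum_act opprD addrACA -(linB lt) -!sumrB => /eqP.
under eq_bigr do rewrite -scalerBl.
under [X in _ + t X]eq_bigr do rewrite -scalerBl.
case/indep => d0 d1; rewrite [c i]ext1E [c' i]ext1E.
by have /eqP := d0 i; have /eqP := d1 i; rewrite !subr_eq0 => /eqP-> /eqP->.
Qed.
End FreeLine.

(* Linear maps M -> X, given by their values on a basis of M. *)
Section HomSpace.
Variables (k : fieldType) (M : vectType k).
Local Notation r := (\dim {:M}).
Local Notation bM := (vbasis {:M}).

Definition homsp (X : lmodType k) := {ffun 'I_r -> X}.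
HB.instance Definition _ X := GRing.Lmodule.on (homsp X).

Definition hval (X : lmodType k) (c : homsp X) (m : M) : X := \sum_a coord bM a m *: c a.
Definition hof (X : lmodType k) (f : M -> X) : homsp X := [ffun a : 'I_r => f bM`_a].

Lemma hval_linear (X : lmodType k) (c : homsp X) : linear (hval c).
Proof.
move=> t x y; rewrite /hval scaler_sumr -big_split; apply: eq_bigr => a _ /=.
by rewrite linearP scalerDl scalerA.
Qed.
HB.instance Definition _ (X : lmodType k) (c : homsp X) := GRing.isLinear.Build k M X _ (hval c) (hval_linear c).

Lemma hval_linear_l (X : lmodType k) m : linear (fun c : homsp X => hval c m).
Proof.
move=> t x y; rewrite /hval scaler_sumr -big_split; apply: eq_bigr => a _ /=.
by rewrite !ffunE scalerDr !scalerA mulrC.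
Qed.

Lemma hval_basis (X : lmodType k) (c : homsp X) (a : 'I_r) : hval c bM`_a = c a.
Proof.
have bf : free bM by apply: basis_free (vbasisP _).
rewrite /hval (bigD1 a) //= coord_free // eqxx scale1r big1 ?addr0 // => b ba.
by rewrite coord_free // eq_sym (negPf ba) scale0r.
Qed.

Lemma hval_hof (X : lmodType k) (f : M -> X) : linear f -> forall m, hval (hof f) m = f m.
Proof.
move=> lf m; rewrite {2}(coord_vbasis (memvf m)) -[RHS]/(lin lf _) linear_sum.
by apply: eq_bigr => a _; rewrite ffunE linearZ.
Qed.

Lemma hofK (X : lmodType k) (c : homsp X) : hof (hval c) = c.
Proof. by apply/ffunP => a; rewrite ffunE hval_basis. Qed.

Lemma hval_ext (X : lmodType k) (c c' : homsp X) : (forall m, hval c m = hval c' m) -> c = c'.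
Proof. by move=> cc; rewrite -[c]hofK -[c']hofK; apply/ffunP => a; rewrite !ffunE. Qed.

Definition hmap (X Y : lmodType k) (f : X -> Y) (c : homsp X) : homsp Y := [ffun a : 'I_r => f (c a)].

Section Hmap.
Variables (X Y : lmodType k) (f : {linear X -> Y}).

Lemma hmap_linear : linear (hmap f).
Proof. by move=> t c c'; apply/ffunP => a; rewrite !ffunE linearP. Qed.
HB.instance Definition _ := GRing.isLinear.Build k (homsp X) (homsp Y) _ (hmap f) hmap_linear.

Lemma hval_hmap c m : hval (hmap f c) m = f (hval c m).
Proof. by rewrite /hval linear_sum; apply: eq_bigr => a _; rewrite ffunE linearZ. Qed.
End Hmap.
End HomSpace.

(** * Zigzags in Hom(M, J) *)

Section HomAction.
Variables (k : fieldType) (B : superalgebra k) (n : nat) (e : 'I_n -> B).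
Hypothesis e_odd : forall i, is_homog (sa_parity B) true (e i).
Hypothesis e_sq : forall i, e i * e i = 0.
Hypothesis e_anti : forall i j, e i * e j = - (e j * e i).
Variables (M : vectType k) (sM : supermodule B M).
Local Notation epM := (eps (sm_parity sM)).

Section OneModule.
Variables (X : lmodType k) (sX : supermodule B X).
Local Notation ep := (eps (sm_parity sX)).

Lemma ep_e i x : ep (sm_act sX (e i) x) = - sm_act sX (e i) (ep x).
Proof. by rewrite (act_eps _ _ (e_odd i)) expr1 scaleN1r. Qed.

(* The supercommutator e c - (-1)^|c| c e. *)
Definition hact (b : B) (c : homsp M X) : homsp M X :=
  hof (fun m => sm_act sX b (hval c m) - ep (hval c (epM (sm_act sM b m)))).

Lemma hval_hact b c m :
  hval (hact b c) m = sm_act sX b (hval c m) - ep (hval c (epM (sm_act sM b m))).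
Proof.
apply: (hval_hof (f := fun m => sm_act sX b (hval c m) - ep (hval c (epM (sm_act sM b m))))).
move=> t x y; rewrite (sm_linear_r sM) (eps_linear _ t) !(hval_linear c t).
by rewrite (sm_linear_r sX) (eps_linear _ t) [in RHS]scalerBr opprD addrACA.
Qed.

Lemma hact_linear b : linear (hact b).
Proof.
move=> t x y; apply: hval_ext => m; rewrite hval_linear_l !hval_hact !hval_linear_l.
by rewrite (sm_linear_r sX) (eps_linear _ t) [in RHS]scalerBr opprD addrACA.
Qed.
HB.instance Definition _ b :=
  GRing.isLinear.Build k (homsp M X) (homsp M X) _ (hact b) (hact_linear b).

Lemma hact_comp i j c m : hval (hact (e i) (hact (e j) c)) m =
  sm_act sX (e i) (sm_act sX (e j) (hval c m)) - hval c (sm_act sM (e j) (sm_act sM (e i) m)) +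
  (sm_act sX (e j) (ep (hval c (epM (sm_act sM (e i) m)))) -
   sm_act sX (e i) (ep (hval c (epM (sm_act sM (e j) m))))).
Proof.
have le b := sm_linear_r sX b; have lep := eps_linear (sm_parity sX).
have E1 : epM (sm_act sM (e j) (epM (sm_act sM (e i) m))) = - sm_act sM (e j) (sm_act sM (e i) m).
  by rewrite (act_eps sM _ (e_odd j)) expr1 scaleN1r epsK.
have cN y : hval c (- y) = - hval c y by exact: linearN.
rewrite !hval_hact E1 cN (linB (le _)) (linB lep) epsK ep_e opprB opprK.
by rewrite addrACA; congr (_ + _); apply: addrC.
Qed.

(** In [hact_comp] the mixed terms are antisymmetric in [i] and [j]; the other two change sign by
    the relations on [X] and on [M]. *)
Lemma hact_anti i j c : hact (e i) (hact (e j) c) = - hact (e j) (hact (e i) c).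
Proof.
apply: hval_ext => m; rewrite -scaleN1r -[_ *: _]addr0 hval_linear_l scaleN1r.
have -> : hval (0 : homsp M X) m = 0 by exact: (lin0 (hval_linear_l m)).
have cN y : hval c (- y) = - hval c y by exact: linearN.
rewrite addr0 !hact_comp (act_anti e_anti sX i j) (act_anti e_anti sM i j) cN opprK.
by rewrite opprD opprB opprD.
Qed.

Lemma hact_sq i c : hact (e i) (hact (e i) c) = 0.
Proof.
apply: hval_ext => m; rewrite hact_comp !(act_sq e_sq) linear0 !subrr addr0.
by rewrite (lin0 (hval_linear_l m)).
Qed.
End OneModule.
Lemma hmap_hact (X Y : lmodType k) (sX : supermodule B X) (sY : supermodule B Y)
    (f : {linear X -> Y}) b c : hom_of_parity sX sY false f ->
  hmap f (hact sX b c) = hact sY b (hmap f c).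
Proof.
move=> hf; apply: hval_ext => m; rewrite hval_hmap !hval_hact !hval_hmap linearB /=.
by rewrite (hom_even_act _ _ hf) (hom_eps _ hf) scale1r.
Qed.

Variable J : injective_resolution sM.

(** Exactness holds entry by entry over a basis of [M]. Only the operators [e_i] are recorded: the
    Koszul property will come from contractions on [J], so that [Hom(M, J)] is neither made a
    supermodule nor shown to be injective. *)
Definition hom_eresolution : eresolution k n.
Proof.
apply: (@EResolution k n (fun j => homsp M (J j)) (homsp M M)
  (fun j => hmap (@ir_d _ _ _ _ J j)) (hmap (ir_aug J))
  (fun j i => hact (ir_mod J j) (e i)) (fun i => hact sM (e i))).
- by move=> j i l x; apply: hact_anti.
- by move=> j i x; apply: hact_sq.
- by move=> j i x; apply: hmap_hact (ir_d_hom J j).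
- by move=> i w; apply: hmap_hact (ir_aug_hom J).
- move=> c c' cc; apply/ffunP => a; apply: (@ir_aug_inj _ _ _ _ J).
  by have := congr1 (fun f : homsp M (J 0%N) => f a) cc; rewrite !ffunE.
- by move=> c; apply/ffunP => a; rewrite !ffunE; exact: ir_d_aug.
- by move=> j c; apply/ffunP => a; rewrite !ffunE; exact: ir_dd.
- move=> c dc; have /choice[w wE] : forall a, exists y, c a = ir_aug J y.
    move=> a; apply/ir_exact0.
    by have := congr1 (fun f : homsp M (J 1%N) => f a) dc; rewrite !ffunE.
  by exists [ffun a => w a]; apply/ffunP => a; rewrite !ffunE.
- move=> j c dc; have /choice[w wE] : forall a, exists y, c a = ir_d y.
    move=> a; apply/ir_exact.
    by have := congr1 (fun f : homsp M (J j.+2) => f a) dc; rewrite !ffunE.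
  by exists [ffun a => w a]; apply/ffunP => a; rewrite !ffunE.
Defined.

Hypothesis char0 : [pchar k] =i pred0.
Hypothesis C : contraction_basis e.

(** Composed with maps from [M], a contraction has to pass the twist by [eps] in the supercommutator
    with a sign. Its odd part does so, and still satisfies the Clifford relation since [e_i] is
    odd. *)
Lemma clifford_odd (X : lmodType k) (sX : supermodule B X) : injective_supermodule sX ->
  exists iota : 'I_n -> {linear X -> X},
    (forall i j x, sm_act sX (e i) (iota j x) + iota j (sm_act sX (e i) x) = (i == j)%:R *: x) /\
    forall j x, eps (sm_parity sX) (iota j x) = - iota j (eps (sm_parity sX) x).
Proof.
move=> /(injective_clifford C)[iota cl].
have lep := eps_linear (sm_parity sX).
have epN y : eps (sm_parity sX) (- y) = - eps (sm_parity sX) y by rewrite -!scaleN1r (linZ lep).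
have l j : linear (fun x => 2%:R^-1 *: (iota j x - eps (sm_parity sX) (iota j (eps (sm_parity sX) x)))).
  move=> t x y; rewrite (lep t x y) !(linearP (iota j)) /= (lep t) opprD addrACA -scalerBr scalerDr.
  by rewrite !scalerA mulrC.
exists (fun j => lin (l j)); split=> [i j x|j x] /=; last first.
  by rewrite (linZ lep) (linB lep) !epsK -scalerN opprB.
have le := sm_linear_r sX (e i).
have eep y : sm_act sX (e i) (eps (sm_parity sX) y) = - eps (sm_parity sX) (sm_act sX (e i) y).
  by rewrite ep_e opprK.
rewrite (linZ le) -scalerDr (linB le) addrACA cl eep (ep_e sX i x).
have iN y : iota j (- y) = - iota j y by exact: linearN.
rewrite iN epN !opprK -(linD lep) cl (linZ lep) epsK -scalerDr -mulr2n -scaler_nat.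
by rewrite !scalerA mulrAC mulVf ?mul1r // (two_neq0 char0).
Qed.

Lemma hom_koszul j i (c : 'X_{1..n} -> hom_eresolution j) :
  hdeg i.+1 c -> kdiff (er_e hom_eresolution j) c = 0 ->
  exists2 b, hdeg i b & kdiff (er_e hom_eresolution j) b = c.
Proof.
have [iota [cl io]] := clifford_odd (@ir_injective _ _ _ _ J j).
apply: (@koszul_exact k n (homsp M (J j)) (fun i => hact (ir_mod J j) (e i)) _ _
  (fun l => hmap (iota l))) => //.
- by move=> *; apply: hact_anti.
- by move=> *; apply: hact_sq.
move=> l l' x; apply: hval_ext => m.
rewrite (linD (hval_linear_l m)) (linZ (hval_linear_l m)) /= hval_hact !hval_hmap hval_hact (linearB (iota l')) /=.
by rewrite io opprK addrACA cl subrr addr0.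
Qed.
End HomAction.


(** * The support ideal at a point *)

Section Support.
Variables (k : fieldType) (gT : finGroupType) (n : nat).
Variable rV : mx_representation k [set: gT] n.
Local Notation A := (smash_superalgebra rV).
Local Notation kA := (trivial_supermodule (smash_counit rV)).
Variables (M : vectType k) (sM : supermodule A M).
Variables (I : injective_resolution kA) (J : injective_resolution sM).
Variable theta : forall i, I i -> M -> J i.
Arguments theta : clear implicits.
Hypothesis char0 : [pchar k] =i pred0.
Hypothesis htheta : tensor_comparison theta.
Local Notation sg := (sgen rV).
Local Notation X := (hom_eresolution (sgen_odd rV) (sgen_sq rV) (sgen_anti rV) J).
Local Notation Y := (eresolution_of (sgen_sq rV) (sgen_anti rV) I).
Local Notation scls := (cls (sgen_sq rV) (sgen_anti rV)).
Local Notation vec v := (sext rV (evec v) : A).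
Local Notation pt v := (fun i => v i 0).

Lemma theta_linear i x : linear (theta i x).
Proof. by case: htheta => /(_ i)[]. Qed.

Lemma theta_linear_l i m : linear (fun x : I i => theta i x m).
Proof. by case: htheta => /(_ i)[]. Qed.
Arguments theta_linear : clear implicits.
Arguments theta_linear_l : clear implicits.

Definition Theta i (x : I i) : homsp M (J i) := hof (theta i x).

Lemma hval_Theta i (x : I i) m : hval (Theta x) m = theta i x m.
Proof. by rewrite /Theta hval_hof //; apply: theta_linear. Qed.

Lemma Theta_linear i : linear (@Theta i).
Proof.
move=> t x y; apply: hval_ext => m.
by rewrite (hval_linear_l m) !hval_Theta (theta_linear_l i m).
Qed.

Lemma Theta_d i (x : I i) : Theta (ir_d x : I i.+1) = hmap (@ir_d _ _ _ _ J i) (Theta x).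
Proof.
apply: hval_ext => m; rewrite hval_hmap !hval_Theta.
by case: htheta => _ _ _ _ [td _]; apply: td.
Qed.

Lemma theta_eps i (x : I i) m : eps (sm_parity (ir_mod J i)) (theta i x (eps (sm_parity sM) m)) =
  theta i (eps (sm_parity (ir_mod I i)) x) m.
Proof.
have ltl := theta_linear_l i; have lt := theta_linear i.
elim/(@homog_ind _ _ (sm_parity (ir_mod I i))): x => [x y hx hy|b x hx].
  rewrite (linD (ltl _) x y) (linD (eps_linear _)) hx hy -(linD (ltl m)).
  by rewrite -(linD (eps_linear _)).
elim/(@homog_ind _ _ (sm_parity sM)): m => [m m' hm hm'|c m hm].
  rewrite (linD (eps_linear _) m m') (linD (lt x)) (linD (eps_linear _)) hm hm'.
  by rewrite -(linD (lt _)).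
case: htheta => _ par _ _ _; rewrite (eps_homog hx) (eps_homog hm) (linZ (lt x)) (linZ (eps_linear _)).
by rewrite (eps_homog (par _ _ _ _ _ hx hm)) (linZ (ltl m)) scalerA -signr_addb addbCA addbb addbF.
Qed.

(** The Leibniz rule for the primitive element [e_l], solved for the term in which it acts on [x],
    is a supercommutator; the sign comes from [theta_eps]. *)
Lemma Theta_e i l (x : I i) : Theta (sm_act (ir_mod I i) (sg l) x) = hact sM (ir_mod J i) (sg l) (Theta x).
Proof.
apply: hval_ext => m; rewrite hval_hact !hval_Theta theta_eps.
elim/(@homog_ind _ _ (sm_parity (ir_mod I i))): x => [x y hx hy|b x hx].
  rewrite (linD (eps_linear _) x y) (linD (theta_linear_l i _) (eps _ x)).
  rewrite (linD (sm_linear_r (ir_mod I i) (sg l)) x y).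
  rewrite (linD (theta_linear_l i _) (sm_act _ _ x)) hx hy (linD (theta_linear_l i _) x y).
  by rewrite (linD (sm_linear_r (ir_mod J i) (sg l))) opprD addrACA.
case: htheta => _ _ te _ _; have := te i b x m (delta_mx l 0) hx.
rewrite evec_delta -/(sg l) => ->; rewrite (eps_homog hx) (linZ (theta_linear_l i _)).
by rewrite addrK.
Qed.

Lemma vec_odd v : is_homog (sa_parity A) true (vec v).
Proof.
apply: sext_even; rewrite /evec; apply: homog_sum => i _.
exact/homogZ/egen_odd.
Qed.

Definition hid : homsp M M := hof id.

Lemma hval_hid m : hval hid m = m.
Proof. by apply: (hval_hof (f := id)). Qed.

Lemma Theta_aug (c : k^o) : Theta (ir_aug I c) = hmap (ir_aug J) (c *: hid).
Proof.
apply: hval_ext => m; rewrite hval_hmap hval_Theta (linZ (hval_linear_l m)) hval_hid.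
by case: htheta => _ _ _ _ [_ ta]; apply: ta.
Qed.

Lemma vzigzag_Theta v j (z : I j) (c : k^o) : @vzigzag k n Y v j z c ->
  @vzigzag k n X v j (Theta z) (c *: hid).
Proof.
apply: (@zigzag_map (fun j => I j) (fun j => homsp M (J j)) k^o (homsp M M)
  (fun j => er_d Y j) (fun j => vact v (er_e Y j)) (er_eta Y)
  (fun j => er_d X j) (fun j => vact v (er_e X j)) (er_eta X) Theta (fun c => c *: hid)).
- by move=> i x; apply: Theta_d.
- move=> i x; rewrite -[LHS]/(lin (@Theta_linear i) _) linear_sum; apply: eq_bigr => l _.
  by rewrite linearZ; congr (_ *: _); apply: Theta_e.
- exact: Theta_aug.
Qed.

Lemma szigzag_Theta j (z : I j) p : @szigzag k n Y j (sconst z) (pser p (1 : k^o)) ->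
  @szigzag k n X j (sconst (Theta z)) (pser p hid).
Proof.
pose T i := lin (@Theta_linear i).
have -> : pser p hid = (fun w : 'X_{1..n} -> k^o => fun m => w m *: hid) (pser p (1 : k^o)).
  by apply/funext => m; rewrite /pser [p@_m *: 1]mulr1.
rewrite -[sconst (Theta z)](smap_sconst n (T j)).
apply: (@zigzag_map (fun j => 'X_{1..n} -> I j) (fun j => 'X_{1..n} -> homsp M (J j))
  ('X_{1..n} -> k^o) ('X_{1..n} -> homsp M M)
  (fun j => smap (er_d Y j)) (fun j => kdiff (er_e Y j)) (smap (er_eta Y))
  (fun j => smap (er_d X j)) (fun j => kdiff (er_e X j)) (smap (er_eta X))
  (fun j => smap (T j)) (fun w => fun m => w m *: hid)).
- by move=> i a; apply/funext => m; apply: Theta_d.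
- by move=> i a; apply: smap_kdiff => l x; apply: Theta_e.
- by move=> w; apply/funext => m; apply: Theta_aug.
Qed.

Lemma line_act v x : sm_act (line_restriction sM v) (ebasis k [set ord0] : exterior_superalgebra k 1) x =
  sm_act sM (vec v) x.
Proof.
rewrite -[LHS]/(sm_act sM (sext rV (emap v (ebasis k [set ord0]))) x) emap_basis enum_set1 big_seq1.
by congr (sm_act sM (sext rV (evec _)) x); apply/colP => i; rewrite mxE.
Qed.

(** By the sign rule each homogeneous part supercommutes with [e_l]. A cochain that bounds [Theta z]
    thus gives a zigzag ending at 0. *)
Lemma super_hom_hact j (h : M -> J j) : super_hom sM (ir_mod J j) h ->
  forall l, hact sM (ir_mod J j) (sg l) (hof h) = 0.
Proof.
case=> h0 [h1 [hh0 hh1 hE]] l; have [l0 _ a0] := hh0; have [l1 _ a1] := hh1.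
have lh : linear h by move=> t x y; rewrite !hE l0 l1 scalerDr addrACA.
apply: hval_ext => m; rewrite hval_hact !hval_hof // (lin0 (hval_linear_l m)) !hE.
rewrite (linD (eps_linear _)) (hom_eps _ hh0) (hom_eps _ hh1) !epsK.
rewrite (a0 true _ _ (sgen_odd rV l)) (a1 true _ _ (sgen_odd rV l)) (linD (sm_linear_r _ _)).
by rewrite !scale1r expr1 !scaleN1r opprK subrr.
Qed.

Lemma coboundary_point (v : 'cV[k]_n) j (z : I j) p : scls z p -> ext_coboundary sM (fun x => theta j z x) ->
  p.@[pt v] != 0 -> exists s, line_homotopy (line_restriction sM v) s.
Proof.
move=> zp bd pv.
have Z0 : @vzigzag k n X (pt v) j (Theta z) 0.
  case: j z bd {zp} => [|j] z /= bd.
    by rewrite linear0; apply: hval_ext => m; rewrite hval_Theta bd (lin0 (hval_linear_l m)).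
  have [h hh thE] := bd; exists (hof h).
    have [h0 [h1 [[l0 _ _] [l1 _ _] hE]]] := hh.
    have lh : linear h by move=> t x y; rewrite !hE l0 l1 scalerDr addrACA.
    apply: hval_ext => m; rewrite hval_Theta thE.
    by transitivity (hval (hmap (@ir_d _ _ _ _ J j) (hof h)) m); rewrite // hval_hmap hval_hof.
  have -> : vact (pt v) (er_e X j) (hof h) = 0.
    by apply: big1 => l _; rewrite [er_e X j l _](super_hom_hact hh) scaler0.
  exact: (@vzigzag0 k n X).
(* Two zigzags start at [Theta z], one ending at 0 and one at [p(v)] times the identity; their
   difference starts at 0. *)
have := @vzigzag_linear k n X (pt v) j _ _ _ _ (-1) Z0 (vzigzag_Theta (zp (pt v))).
rewrite scaleN1r addNr scaler0 add0r => /(@vzigzag_inj k n X)[c cE].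
set u := p.@[pt v] in pv cE.
pose ep := eps (sm_parity sM); have lep : linear ep := eps_linear _.
have epK y : ep (ep y) = y by apply: epsK.
have cm m : u *: m = sm_act sM (vec v) (hval c m) - ep (hval c (ep (sm_act sM (vec v) m))).
  have := congr1 (fun f => hval f m) cE; rewrite (linZ (hval_linear_l m)) hval_hid => ->.
  rewrite /vact -[LHS]/(lin (hval_linear_l m) _) linear_sum !vec_sum.
  have -> : ep (hval c (ep (\sum_i v i 0 *: sm_act sM (sg i) m))) =
     \sum_i v i 0 *: ep (hval c (ep (sm_act sM (sg i) m))).
    have lf : linear (fun y => ep (hval c (ep y))).
      by move=> t x y; rewrite lep (hval_linear c) lep.
    rewrite -[LHS]/(lin lf _) linear_sum; apply: eq_bigr => i _.
    by rewrite linearZ.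
  rewrite -sumrB; apply: eq_bigr => i _.
  by rewrite linearZ -scalerBr; congr (_ *: _); apply: hval_hact.
have epv x : ep (sm_act sM (vec v) x) = - sm_act sM (vec v) (ep x).
  by rewrite /ep (act_eps _ _ (vec_odd v)) expr1 scaleN1r.
have lc : linear (hval c) := hval_linear c.
have lv : linear (sm_act sM (vec v)) := sm_linear_r sM _.
have two0 : 2%:R != 0 :> k := two_neq0 char0.
(* [c] need not be odd, and the supercommutator is an anticommutator on odd maps only. The odd part
   [(c - eps c eps) / 2], divided by [u = p(v)], is a homotopy. *)
exists (fun m => (2%:R * u)^-1 *: (hval c m - ep (hval c (ep m)))); split=> [t x y|m].
  rewrite (lep t) !lc (lep t) opprD addrACA -scalerBr scalerDr.
  by rewrite !scalerA mulrC.
have E1 := cm m; have := congr1 ep (cm (ep m)).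
rewrite (linZ lep) epK (linB lep) epK !epv epK.
have -> : hval c (- sm_act sM (vec v) m) = - hval c (sm_act sM (vec v) m).
  by rewrite -scaleN1r (linZ lc) scaleN1r.
rewrite opprK => E2; rewrite !line_act (linZ lv) -scalerDr.
transitivity ((2%:R * u)^-1 *: (u *: m + u *: m)).
  congr (_ *: _); rewrite [X in _ = X + _]E1 [X in _ = _ + X]E2 (linB lv).
  by rewrite -!addrA; congr (_ + _); rewrite [RHS]addrC -addrA.
by rewrite -mulr2n -scaler_nat !scalerA mulVf ?scale1r // mulf_neq0.
Qed.
End Support.

(** Over the fraction field [\adj N] is [\det N] times the inverse of [N], so it commutes with
    whatever commutes with [N]; cancelling [\det N] in the domain avoids the fractions. *)
Lemma adj_comm (R : idomainType) r (N X : 'M[R]_r) :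
  N *m X = X *m N -> \det N != 0 -> \adj N *m X = X *m \adj N.
Proof.
move=> NX N0; apply/eqP; rewrite -subr_eq0; apply/eqP.
have E : N *m (\adj N *m X - X *m \adj N) = 0.
  by rewrite mulmxBr mulmxA mul_mx_adj mulmxA NX -mulmxA mul_mx_adj scalar_mxC subrr.
have := congr1 (fun Q => \adj N *m Q) E; rewrite mulmxA mul_adj_mx mulmx0 mul_scalar_mx.
move=> /matrixP F; apply/matrixP => a b; have := F a b; rewrite mxE [RHS]mxE => /eqP.
by rewrite mulf_eq0 (negPf N0) => /eqP->; rewrite mxE.
Qed.

Lemma anticommutator_comm (R : pzRingType) r (D S P : 'M[R]_r) :
  P *m D = - (D *m P) -> P *m S = - (S *m P) ->
  (D *m S + S *m D) *m P = P *m (D *m S + S *m D).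
Proof.
move=> PD PS; rewrite mulmxDl mulmxDr; congr (_ + _).
  by rewrite [RHS]mulmxA PD mulNmx -2!mulmxA PS mulmxN opprK.
by rewrite [RHS]mulmxA PS mulNmx -2!mulmxA PD mulmxN opprK.
Qed.

(** * Null homotopies over the polynomial ring *)

Section NullSeries.
Variables (k : fieldType) (n r : nat).
Local Notation P := {mpoly k[n]}.

Lemma mcoeffXM i (p : P) (m : 'X_{1..n}) :
  ('X_i * p)@_m = if (0 < m i)%N then p@_(m - U_(i))%MM else 0.
Proof.
case: ifPn => mi.
  have le : (U_(i) <= m)%MM by rewrite lep1mP -lt0n.
  by rewrite mulrC -{1}(submK le) [(_ + U_(i))%MM]addmC mcoeffMX.
rewrite {1}[p]mpolyE mulr_sumr raddf_sum big1_seq //= => m' _.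
rewrite -scalerAr mcoeffZ -mpolyXD mcoeffX; case: eqP => [mE|_]; last by rewrite mulr0.
by move: mi; rewrite -mE mnmDE mnm1E eqxx.
Qed.

Variables (E : 'I_n -> 'M[k]_r) (S Ep : 'M[k]_r) (v : 'I_n -> k).
Hypothesis E_anti : forall i j, E i *m E j = - (E j *m E i).
Hypothesis E_sq : forall i, E i *m E i = 0.
Hypothesis S_htpy : \sum_i v i *: (E i *m S + S *m E i) = 1%:M.
Hypothesis Ep_E : forall i, Ep *m E i = - (E i *m Ep).
Hypothesis Ep_S : Ep *m S = - (S *m Ep).
Local Notation C Q := (map_mx (@mpolyC n k) Q).

Definition opD : 'M[P]_r := \sum_i 'X_i *: C (E i).
Definition opN : 'M[P]_r := opD *m C S + C S *m opD.

Lemma opD_sq : opD *m opD = 0.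
Proof.
rewrite /opD mulmx_suml; under eq_bigr do rewrite mulmx_sumr.
apply: sum_alternating => [i j|i]; rewrite -!scalemxAl -!scalemxAr !scalerA -!map_mxM /=.
  by rewrite E_anti map_mxN scalerN mulrC.
by rewrite E_sq map_mx0 scaler0.
Qed.

Lemma opN_opD : opN *m opD = opD *m opN.
Proof.
by rewrite /opN mulmxDl mulmxDr mulmxA opD_sq mul0mx add0r -[_ *m opD *m opD]mulmxA opD_sq mulmx0 addr0 mulmxA.
Qed.

Lemma opD_parity : C Ep *m opD = - (opD *m C Ep).
Proof.
rewrite /opD mulmx_sumr mulmx_suml -sumrN; apply: eq_bigr => i _.
by rewrite -scalemxAr -scalemxAl -!map_mxM /= Ep_E map_mxN scalerN.
Qed.

Lemma opN_parity : opN *m C Ep = C Ep *m opN.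
Proof.
apply: anticommutator_comm opD_parity _.
by rewrite -!map_mxM /= Ep_S map_mxN.
Qed.

Lemma opN_eval : (\det opN).@[v] = 1.
Proof.
rewrite -(det_map_mx (meval v)) -[RHS](det1 k r); congr (\det _).
have Cv (Q : 'M[k]_r) : map_mx (meval v) (C Q) = Q.
  by apply/matrixP => a b; rewrite !mxE mevalC.
have Dv : map_mx (meval v) opD = \sum_i v i *: E i.
  rewrite /opD raddf_sum /=; apply: eq_bigr => i _.
  by rewrite map_mxZ /= Cv mevalXU.
rewrite /opN raddfD /= !map_mxM Cv Dv -[RHS]S_htpy mulmx_suml mulmx_sumr -big_split.
by apply: eq_bigr => i _ /=; rewrite -scalemxAl -scalemxAr scalerDr.
Qed.

(* Where N = D S + S D is invertible, N^-1 S is a null homotopy of D; clearing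
   the denominator det N gives a polynomial matrix. *)
Lemma null_series (q : P) : exists Q : 'X_{1..n} -> 'M[k]_r,
  (forall m, Ep *m Q m = - (Q m *m Ep)) /\
  forall m : 'X_{1..n}, \sum_i (if (0 < m i)%N then E i *m Q (m - U_(i))%MM + Q (m - U_(i))%MM *m E i else 0)
    = ((q * \det opN)@_m)%:M.
Proof.
have N0 : \det opN != 0.
  by apply/eqP => N0; have := opN_eval; rewrite N0 meval0 => /esym/eqP; rewrite oner_eq0.
(* [\adj opN] commutes with [opD] and with the parity because [opN] does. So [T] is again odd, and
   [D T + T D = q \adj(N) (D S + S D) = q \det(N)]. *)
pose T : 'M[P]_r := q *: (\adj opN *m C S).
have TD : opD *m T + T *m opD = (q * \det opN)%:M.
  rewrite -scalemxAr -scalemxAl -scalerDr mulmxA -(adj_comm opN_opD N0) -!mulmxA -mulmxDr.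
  by rewrite -/opN mul_adj_mx scale_scalar_mx.
have TE : C Ep *m T = - (T *m C Ep).
  rewrite -scalemxAr -scalemxAl mulmxA -(adj_comm opN_parity N0) -!mulmxA -!map_mxM /=.
  by rewrite Ep_S map_mxN mulmxN scalerN.
clearbody T.
pose cf (m : 'X_{1..n}) (Q : 'M[P]_r) : 'M[k]_r := map_mx (mcoeff m) Q.
have cfl m Q R : cf m (C Q *m R) = Q *m cf m R.
  apply/matrixP => a b; rewrite !mxE raddf_sum; apply: eq_bigr => c _ /=.
  by rewrite !mxE mcoeffCM.
have cfr m Q R : cf m (R *m C Q) = cf m R *m Q.
  apply/matrixP => a b; rewrite !mxE raddf_sum; apply: eq_bigr => c _ /=.
  by rewrite !mxE mulrC mcoeffCM mulrC.
have cfX m i R : cf m ('X_i *: R) = if (0 < m i)%N then cf (m - U_(i))%MM R else 0.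
  by apply/matrixP => a b; rewrite !mxE mcoeffXM; case: ifP => _; rewrite !mxE.
have cfD m Q R : cf m (Q + R) = cf m Q + cf m R by exact: raddfD.
have cfS m (F : 'I_n -> 'M[P]_r) : cf m (\sum_i F i) = \sum_i cf m (F i) by exact: raddf_sum.
exists (fun m => cf m T); split=> m.
  by rewrite -cfl TE -cfr; apply/matrixP => a b; rewrite !mxE raddfN.
transitivity (cf m (opD *m T + T *m opD)).
  rewrite /opD mulmx_suml mulmx_sumr -big_split cfS; apply: eq_bigr => i _ /=.
  rewrite -scalemxAl -scalemxAr -scalerDr cfX; case: ifP => // _.
  by rewrite cfD [X in _ = X + _]cfl [X in _ = _ + X]cfr.
by rewrite TD; apply/matrixP => a b; rewrite !mxE raddfMn.
Qed.
End NullSeries.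

Section EndomorphismMatrices.
Variables (k : fieldType) (M : vectType k).
Local Notation r := (\dim {:M}).
Local Notation bM := (vbasis {:M}).

Definition endmx (f : M -> M) : 'M[k]_r := \matrix_(a, b) coord bM b (f bM`_a).

Definition mxend (Q : 'M[k]_r) : homsp M M := [ffun a => \sum_b Q a b *: bM`_b].

Lemma mxend_linear : linear mxend.
Proof.
move=> t Q R; apply/ffunP => a; rewrite !ffunE scaler_sumr -big_split; apply: eq_bigr => b _ /=.
by rewrite !mxE scalerDl scalerA.
Qed.

Lemma endmxK (f : M -> M) : mxend (endmx f) = hof f.
Proof.
apply/ffunP => a; rewrite !ffunE [RHS](coord_vbasis (memvf _)).
by apply: eq_bigr => b _; rewrite mxE.
Qed.

Lemma mxendK Q : endmx (hval (mxend Q)) = Q.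
Proof.
apply/matrixP => a b; rewrite mxE hval_basis ffunE coord_sum_free //.
exact: basis_free (vbasisP _).
Qed.

Lemma endmx_id : endmx id = 1%:M.
Proof.
have fb : free bM by apply: basis_free (vbasisP _).
by apply/matrixP => a b; rewrite !mxE coord_free // eq_sym.
Qed.

(** Rows hold the images of the basis vectors, hence the reversed order. *)
Lemma endmx_comp (f g : M -> M) : linear f -> endmx (fun x => f (g x)) = endmx g *m endmx f.
Proof.
move=> lf; apply/matrixP => a b; rewrite !mxE {1}(coord_vbasis (memvf (g _))).
rewrite -[f _]/(lin lf _) !linear_sum; apply: eq_bigr => c _.
by rewrite !mxE !linearZ.
Qed.

End EndomorphismMatrices.

Section NullIdentity.
Variables (k : fieldType) (B : superalgebra k) (n : nat) (e : 'I_n -> B).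
Hypothesis e_odd : forall i, is_homog (sa_parity B) true (e i).
Hypothesis e_sq : forall i, e i * e i = 0.
Hypothesis e_anti : forall i j, e i * e j = - (e j * e i).
Variables (M : vectType k) (sM : supermodule B M).
Variable (v : 'I_n -> k) (s : M -> M).
Local Notation ep := (eps (sm_parity sM)).
Local Notation Ep := (endmx ep).
Local Notation E i := (endmx (sm_act sM (e i))).
Hypothesis s_linear : linear s.
Hypothesis s_odd : forall x, ep (s x) = - s (ep x).
Hypothesis s_htpy : forall x, \sum_i v i *: (sm_act sM (e i) (s x) + s (sm_act sM (e i) x)) = x.

Lemma endmxN (f : M -> M) : endmx (fun x => - f x) = - endmx f.
Proof. by apply/matrixP => a b; rewrite !mxE linearN. Qed.

(** On an odd matrix, one that anticommutes with the parity, the supercommutator is an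
    anticommutator. *)
Lemma hact_mxend i Q : Ep *m Q = - (Q *m Ep) ->
  hact sM sM (e i) (mxend Q) = mxend (E i *m Q + Q *m E i).
Proof.
move=> EQ; rewrite /hact -endmxK; congr (mxend _).
have lc := hval_linear (mxend Q); have lep := eps_linear (sm_parity sM).
have le := sm_linear_r sM (e i).
have -> : endmx (fun m => sm_act sM (e i) (hval (mxend Q) m) -
    ep (hval (mxend Q) (ep (sm_act sM (e i) m)))) =
  endmx (fun m => sm_act sM (e i) (hval (mxend Q) m)) -
  endmx (fun m => ep (hval (mxend Q) (ep (sm_act sM (e i) m)))).
  by apply/matrixP => a b; rewrite !mxE linearB.
rewrite (endmx_comp _ le) mxendK (endmx_comp _ lep).
rewrite (endmx_comp (fun m => ep (sm_act sM (e i) m)) lc) (endmx_comp _ lep) mxendK.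
rewrite -[_ *m Q *m _]mulmxA -[_ *m (Q *m _)]mulmxA.
have -> : Ep *m (Q *m Ep) = - Q.
  rewrite mulmxA EQ mulNmx -mulmxA -(endmx_comp _ lep).
  have -> : endmx (fun x => ep (ep x)) = 1%:M.
    by rewrite -endmx_id; apply/matrixP => a b; rewrite !mxE epsK.
  by rewrite mulmx1.
by rewrite mulmxN opprK addrC.
Qed.

(** All multiples of [p] are covered because [p] is later multiplied by a separating polynomial
    before it is averaged over [G]. *)
Lemma hid_boundary : exists2 p : {mpoly k[n]}, p.@[v] != 0 &
  forall q, exists c : 'X_{1..n} -> homsp M M,
    pser (q * p) (hid M) = kdiff (fun i => hact sM sM (e i)) c.
Proof.
have lep := eps_linear (sm_parity sM).
have le i := sm_linear_r sM (e i).
pose F i := E i; pose S := endmx s.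
have F_anti i j : F i *m F j = - (F j *m F i).
  rewrite /F -(endmx_comp _ (le j)) -(endmx_comp _ (le i)) -endmxN.
  by apply/matrixP => a b; rewrite !mxE (act_anti e_anti).
have F_sq i : F i *m F i = 0.
  rewrite /F -(endmx_comp _ (le i)).
  by apply/matrixP => a b; rewrite !mxE (act_sq e_sq) linear0.
have S_htpy : \sum_i v i *: (F i *m S + S *m F i) = 1%:M.
  rewrite -endmx_id; apply/matrixP => a b; rewrite summxE [RHS]mxE.
  rewrite -[X in _ = coord _ _ X]s_htpy linear_sum; apply: eq_bigr => i _.
  by rewrite /F /S -(endmx_comp _ s_linear) -(endmx_comp _ (le i)) !mxE linearZ linearD addrC.
have Ep_F i : Ep *m F i = - (F i *m Ep).
  rewrite /F -(endmx_comp _ (le i)) -(endmx_comp _ lep) -endmxN.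
  by apply/matrixP => a b; rewrite !mxE (ep_e e_odd) opprK.
have Ep_S : Ep *m S = - (S *m Ep).
  rewrite /S -(endmx_comp _ s_linear) -(endmx_comp _ lep) -endmxN.
  by apply/matrixP => a b; rewrite !mxE s_odd opprK.
exists (\det (opN F S)); first by rewrite (opN_eval S_htpy) oner_eq0.
move=> q; have [Q [QE Qsum]] := null_series F_anti F_sq S_htpy Ep_F Ep_S q.
exists (fun m => mxend (Q m)); apply/funext => m.
have lm := @mxend_linear k M.
have -> : pser (q * \det (opN F S)) (hid M) m = mxend ((q * \det (opN F S))@_m)%:M.
  by rewrite /pser -scalemx1 (linZ lm) -endmx_id endmxK.
rewrite -Qsum -[LHS]/(lin lm _) linear_sum; apply: eq_bigr => i _ /=.
by case: ifP => _; rewrite ?(lin0 lm) // hact_mxend.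
Qed.
End NullIdentity.

(** * From linear maps to homomorphisms over the smash product *)

Section SmashHoms.
Variables (k : fieldType) (gT : finGroupType) (n : nat).
Variable rV : mx_representation k [set: gT] n.
Hypothesis char0 : [pchar k] =i pred0.
Local Notation A := (smash_superalgebra rV).
Variables (X Y : lmodType k) (sX : supermodule A X) (sY : supermodule A Y).
Local Notation sg := (sgen rV).
Local Notation epX := (eps (sm_parity sX)).
Local Notation epY := (eps (sm_parity sY)).

Lemma act_sum (Z : lmodType k) (sZ : supermodule A Z) (T : finType) (F : T -> A) z :
  sm_act sZ (\sum_t F t) z = \sum_t sm_act sZ (F t) z.
Proof. exact: linear_sum (lin (sm_linear_l sZ z)) _ _ _ _. Qed.

(** [A] is spanned by the products of the [e_S] and the [g]. The largest index of [S] is split off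
    repeatedly, each odd generator contributing the sign [(-1)^p]. *)
Lemma smash_hom_of_parity (p : bool) (f : X -> Y) : linear f ->
  (forall x, epY (f x) = (-1) ^+ p *: f (epX x)) ->
  (forall i x, f (sm_act sX (sg i) x) = (-1) ^+ p *: sm_act sY (sg i) (f x)) ->
  (forall g x, f (sm_act sX (sgrp rV g) x) = sm_act sY (sgrp rV g) (f x)) ->
  hom_of_parity sX sY p f.
Proof.
move=> lf epf ef gf; split=> // [b x|b a x ha]; first exact: eps_anti_parity.
have f_sum (T : finType) (F : T -> X) : f (\sum_t F t) = \sum_t f (F t) by exact: linear_sum (lin lf) _ _ _ _.
have eS S y : f (sm_act sX (sext rV (ebasis k S) : A) y) =
    (-1) ^+ (p && odd #|S|) *: sm_act sY (sext rV (ebasis k S) : A) (f y).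
  elim/set_max_ind: S y => [|S i lti IH] y.
    by rewrite cards0 andbF scale1r -[ebasis k set0]/(1 : exterior k n) rmorph1 !sm_act1.
  have -> : ebasis k (i |: S) = (ebasis k S * ebasis k [set i] : exterior k n).
    by rewrite -!(eprod_ebasis k) eprodU1r // [in RHS]/eprod enum_set1 big_seq1.
  have iS : i \notin S by apply/negP => /lti; rewrite ltnn.
  rewrite rmorphM /= -/(sg i) (sm_actM sX (sext rV (ebasis k S) : A) (sg i)).
  rewrite (sm_actM sY (sext rV (ebasis k S) : A) (sg i)) IH ef (linZ (sm_linear_r sY _)) scalerA.
  rewrite cardsU1 iS add1n /=; congr (_ *: _).
  by rewrite -signr_addb; case: (p); case: odd.
have eu u y : is_homog (exterior_superspace k n) b u ->
    f (sm_act sX (sext rV u : A) y) = (-1) ^+ (p && b) *: sm_act sY (sext rV u : A) (f y).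
  move/ehomogP => hu; rewrite [u]exteriorE !linear_sum.
  rewrite !act_sum f_sum scaler_sumr; apply: eq_bigr => S _.
  rewrite !linearZ /= (linZ (sm_linear_l sX y)) (linZ lf) (linZ (sm_linear_l sY (f y))) eS.
  rewrite !scalerA; case: (eqVneq (odd #|S|) b) => [->|/hu->]; first by rewrite mulrC.
  by rewrite mul0r mulr0 !scale0r.
have /shomogP hg := ha; rewrite [a]smash_decomp.
rewrite !act_sum f_sum scaler_sumr; apply: eq_bigr => g _.
by rewrite !sm_actM (eu _ _ (hg g)) gf.
Qed.

(* The hypothesis on the odd generators says that they supercommute with f,
   whose even and odd parts are (f +/- eps f eps)/2. *)
Lemma smash_super_hom (f : X -> Y) : linear f ->
  (forall i x, sm_act sY (sg i) (f x) = epY (f (epX (sm_act sX (sg i) x)))) ->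
  (forall g x, f (sm_act sX (sgrp rV g) x) = sm_act sY (sgrp rV g) (f x)) ->
  super_hom sX sY f.
Proof.
move=> lf ef gf; have two0 : 2%:R != 0 :> k := two_neq0 char0.
have lX := eps_linear (sm_parity sX); have lY := eps_linear (sm_parity sY).
pose f' x := epY (f (epX x)).
have lf' : linear f' by move=> t x y; rewrite /f' lX lf lY.
have ef' i x : sm_act sY (sg i) (f' x) = f (sm_act sX (sg i) x).
  have eN y : sm_act sY (sg i) (epY y) = - epY (sm_act sY (sg i) y).
    by rewrite (act_eps _ _ (sgen_odd rV i)) expr1 scaleN1r opprK.
  rewrite /f' eN ef epsK (act_eps _ _ (sgen_odd rV i)) expr1 epsK.
  by rewrite (linZ lf) scaleN1r opprK.
have gf' g x : f' (sm_act sX (sgrp rV g) x) = sm_act sY (sgrp rV g) (f' x).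
  by rewrite /f' !(act_eps _ _ (sgrp_even rV g), gf) !scale1r gf (act_eps _ _ (sgrp_even rV g)) scale1r.
have parts (p : bool) : hom_of_parity sX sY p (fun x => 2%:R^-1 *: (f x + (-1) ^+ p *: f' x)).
  have sgn2 (c : k) : (-1) ^+ p * ((-1) ^+ p * c) = c by rewrite mulrA -signr_addb addbb mul1r.
  apply: smash_hom_of_parity => [t x y|x|i x|g x].
  - rewrite lf lf' [(-1) ^+ p *: (_ + _)]scalerDr addrACA [_ *: (t *: f' x)]scalerA.
    rewrite [_ * t]mulrC -[(t * _) *: _]scalerA -scalerDr [LHS]scalerDr.
    by rewrite [_ *: (t *: _)]scalerA [_ * t]mulrC -[(t * _) *: _]scalerA.
  - rewrite (linZ lY) (linD lY) (linZ lY) /f' !epsK scalerA mulrC -scalerA; congr (_ *: _).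
    by rewrite [RHS]scalerDr [in RHS]scalerA -signr_addb addbb scale1r addrC.
  - have lS := sm_linear_r sY (sg i).
    rewrite (linZ lS) (linD lS) (linZ lS) ef' ef -/(f' _) scalerA mulrC -scalerA; congr (_ *: _).
    by rewrite [RHS]scalerDr [in RHS]scalerA -signr_addb addbb scale1r addrC.
  - have lS := sm_linear_r sY (sgrp rV g).
    by rewrite (linZ lS) (linD lS) (linZ lS) gf gf'.
exists (fun x => 2%:R^-1 *: (f x + (-1) ^+ false *: f' x)), (fun x => 2%:R^-1 *: (f x + (-1) ^+ true *: f' x)).
split=> // x; rewrite -scalerDr expr0 expr1 scale1r scaleN1r addrACA subrr addr0.
by rewrite -mulr2n -scaler_nat scalerA mulVf // scale1r.
Qed.
End SmashHoms.

Lemma mcoeff_pihomog (k : fieldType) n j (p : {mpoly k[n]}) m :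
  (pihomog mdeg j p)@_m = if mdeg m == j then p@_m else 0.
Proof.
rewrite pihomogE raddf_sum /= big_mkcond /= {3}[p]mpolyE raddf_sum /=.
case: ifP => mj; [apply: eq_bigr | apply: big1] => m' _; case: ifP => // m'j;
  rewrite !mcoeffZ !mcoeffX; case: eqP => [E|]; rewrite ?mulr0 //.
  by rewrite E mj in m'j.
by rewrite E mj in m'j.
Qed.

Lemma hpart_pser (k : fieldType) n (X : lmodType k) j (p : {mpoly k[n]}) (x : X) :
  hpart j (pser p x) = pser (pihomog mdeg j p) x.
Proof.
apply/funext => m; rewrite /hpart /pser mcoeff_pihomog.
by case: ifP; rewrite // scale0r.
Qed.

Section ConjugationAverage.
Variables (k : fieldType) (gT : finGroupType) (n : nat).
Variable rV : mx_representation k [set: gT] n.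
Local Notation A := (smash_superalgebra rV).
Variables (X Y : lmodType k) (sX : supermodule A X) (sY : supermodule A Y).
Local Notation sg := (sgen rV).
Local Notation gX g := (sm_act sX (sgrp rV g)).
Local Notation gY g := (sm_act sY (sgrp rV g)).
Local Notation epX := (eps (sm_parity sX)).
Local Notation epY := (eps (sm_parity sY)).

Definition conj_average (f : X -> Y) (x : X) : Y :=
  #|gT|%:R^-1 *: \sum_g gY g (f (gX g^-1%g x)).

(** Conjugation by [g] turns supercommutation with [v] into supercommutation with [g v]; the
    condition on the [e_i] is therefore first extended to all of [V]. *)
Lemma conj_average_super_hom f : [pchar k] =i pred0 -> linear f ->
  (forall i x, sm_act sY (sg i) (f x) = epY (f (epX (sm_act sX (sg i) x)))) ->
  super_hom sX sY (conj_average f).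
Proof.
move=> char0 lf ef.
have lX := eps_linear (sm_parity sX); have lY := eps_linear (sm_parity sY).
have vf v x : sm_act sY (sext rV (evec v) : A) (f x) = epY (f (epX (sm_act sX (sext rV (evec v) : A) x))).
  have lf' : linear (fun x => epY (f (epX x))) by move=> t y z; rewrite lX lf lY.
  rewrite !vec_sum -[RHS]/(lin lf' _) linear_sum; apply: eq_bigr => i _.
  by rewrite linearZ ef.
have vg (Z : lmodType k) (sZ : supermodule A Z) v g x : sm_act sZ (sext rV (evec v) : A) (sm_act sZ (sgrp rV g) x) =
    sm_act sZ (sgrp rV g) (sm_act sZ (sext rV (evec (rV g^-1%g *m v)) : A) x).
  by rewrite gact_vec mulmxA -rV_mul mulgV repr_mx1 mul1mx.
have eg (Z : lmodType k) (sZ : supermodule A Z) g x :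
    eps (sm_parity sZ) (sm_act sZ (sgrp rV g) x) = sm_act sZ (sgrp rV g) (eps (sm_parity sZ) x).
  by rewrite (act_eps _ _ (sgrp_even rV g)) scale1r.
apply: smash_super_hom => // [t x y|i x|g x].
- rewrite /conj_average scalerA mulrC -scalerA -scalerDr; congr (_ *: _).
  rewrite scaler_sumr -big_split; apply: eq_bigr => g _ /=.
  by rewrite (sm_linear_r sX) lf (sm_linear_r sY).
- have lS := sm_linear_r sY (sg i).
  rewrite /conj_average (linZ lS) (linZ lY); congr (_ *: _).
  rewrite -[LHS]/(lin lS _) -[RHS]/(lin lY _) !linear_sum; apply: eq_bigr => g _ /=.
  rewrite /sgen -evec_delta vg vf eg -(eg _ sX); congr (gY g (epY (f (epX _)))).
  by rewrite gact_vec.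
- rewrite /conj_average (linZ (sm_linear_r sY _)); congr (_ *: _).
  rewrite -[RHS]/(lin (sm_linear_r sY _) _) linear_sum (reindex_inj (mulgI g)).
  apply: eq_bigr => h _ /=.
  by rewrite gactM invMg gactM gactK.
Qed.
End ConjugationAverage.

(** * The zero set of the support ideal *)

Section SupportNonvanishing.
Variables (k : closedFieldType) (gT : finGroupType) (n : nat).
Variable rV : mx_representation k [set: gT] n.
Local Notation A := (smash_superalgebra rV).
Local Notation kA := (trivial_supermodule (smash_counit rV)).
Variables (M : vectType k) (sM : supermodule A M).
Variables (I : injective_resolution kA) (H : yoneda_algebra I) (J : injective_resolution sM).
Variable theta : forall i, I i -> M -> J i.
Arguments theta : clear implicits.
Hypothesis char0 : [pchar k] =i pred0.
Hypothesis htheta : tensor_comparison theta.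
Local Notation Phi := (smash_phi H char0).
Local Notation sg := (sgen rV).
Local Notation X := (hom_eresolution (sgen_odd rV) (sgen_sq rV) (sgen_anti rV) J).
Local Notation Y := (eresolution_of (sgen_sq rV) (sgen_anti rV) I).
Local Notation scls := (cls (sgen_sq rV) (sgen_anti rV)).
Local Notation pt v := (fun i => v i 0).
Local Notation Th := (@Theta k gT n rV M sM I J theta).

(** The coboundary condition over [Lambda(V)] only: [h] supercommutes with [V] but need not be
    compatible with [G], which [average_coboundary] repairs. *)
Definition theta_null j (z : I j) : Prop :=
  match j return I j -> Prop with
  | 0 => fun z => Th z = 0
  | i.+1 => fun z => exists2 h : homsp M (J i), Th z = hmap (@ir_d _ _ _ _ J i) h &
      forall l, hact sM (ir_mod J i) (sg l) h = 0
  end z.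

Lemma zigzag_theta_null j (z : I j) q c :
  @szigzag k n Y j (sconst z) (pser (pihomog mdeg j q) (1 : k^o)) ->
  pser q (hid M) = kdiff (fun i => hact sM sM (sg i)) c -> theta_null z.
Proof.
move=> /(szigzag_Theta htheta) zz qc.
have hE := hpart_pser j q (hid M); rewrite qc in hE.
case: j z zz hE => [|j] z zz hE /=.
  (* A series in the image of [D] has no constant term, so in degree 0 the zigzag ends at 0. *)
  move: zz; rewrite -hE => /(congr1 (fun a => a 0%MM)) /=; rewrite /sconst eqxx => ->.
  rewrite /smap /hpart mdeg0 eqxx /kdiff big1 ?linear0 // => i _.
  by rewrite mnm0E.
have [|h hE' hh] := @szigzag_boundary k n X
    (hom_koszul char0 (smash_contraction_basis rV))
    j (Th z) _ (hpart j c) zz.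
  by rewrite -hE -hpart_kdiff.
by exists h.
Qed.

Lemma theta_average j (z : I j) m : theta j (average (ir_mod I j) z) m =
  conj_average sM (ir_mod J j) (theta j z) m.
Proof.
have ltl : linear (fun x : I j => theta j x m) := theta_linear_l htheta m.
rewrite /average (linZ ltl) -[X in _ *: X]/(lin ltl _) linear_sum; congr (_ *: _).
apply: eq_bigr => g _ /=; case: htheta => _ _ _ tg _.
by rewrite tg gactVK.
Qed.

Lemma average_coboundary j (z : I j) : theta_null z ->
  ext_coboundary sM (fun m => theta j (average (ir_mod I j) z) m).
Proof.
case: j z => [|j] z /=.
  move=> z0 m; rewrite theta_average /conj_average big1 ?scaler0 // => g _.
  by rewrite -(hval_Theta htheta) z0 (lin0 (hval_linear_l _)) linear0.
case=> h zh hh; exists (conj_average sM (ir_mod J j) (hval h)).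
  apply: conj_average_super_hom => [//||i x]; first exact: hval_linear.
  have := congr1 (fun f => hval f x) (hh i).
  by rewrite hval_hact (lin0 (hval_linear_l _)) => /eqP; rewrite subr_eq0 => /eqP.
move=> m; rewrite theta_average /conj_average [RHS](linZ (@ir_d_linear _ _ _ _ J j)); congr (_ *: _).
rewrite [RHS](linear_sum (@ir_d _ _ _ _ J j)); apply: eq_bigr => g _; rewrite -(hval_Theta htheta) zh hval_hmap.
exact/esym/(hom_even_act _ _ (ir_d_hom J j)).
Qed.

Lemma support_nonvanishing v s : line_homotopy (line_restriction sM v) s ->
  exists2 h, support_ideal theta H h & (Phi h).@[pt v] != 0.
Proof.
move=> /(line_homotopy_odd char0)[{}s [ls sE] sodd].
have [|p pv pc] := @hid_boundary k A n sg (sgen_odd rV) (sgen_sq rV) (sgen_anti rV)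
    M sM (pt v) s ls sodd.
  move=> x; have := sE x; rewrite !line_act !vec_sum -[s (\sum_i _)]/(lin ls _) linear_sum.
  rewrite -big_split => xE; rewrite -[RHS]xE; apply: eq_bigr => i _.
  by rewrite linearZ scalerDr.
(* [p] need not be invariant, and its average might vanish at [v]; the factor [r] prevents this. *)
have [r rp] := reynolds_nonvanishing rV char0 pv.
have [c qc] := pc r; set q := r * p in rp qc.
(* [q] need not be homogeneous: each of its homogeneous parts gives a class in its own degree, and
   the average over [G] acts on the cocycle and on the bounding cochain together. *)
have ex j : exists z : I j, [/\ ext_cocycle kA (fun c : k^o => c *: z),
    scls z (reynolds rV (pihomog mdeg j q)) & ext_coboundary sM (fun m => theta j z m)].
  have [z [dz ez zz zp]] := cls_surj (sgen_odd rV) (sgen_sq rV) (sgen_anti rV) I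
    char0 (smash_contraction_basis rV) (pihomogP mdeg j q).
  exists (average (ir_mod I j) z); split.
  - apply: invariant_cocycle; last by rewrite -average_d dz linear0.
    by apply: smash_invariant; [exact: average_e | move=> g; apply: gact_average].
  - exact: cls_average.
  - exact: average_coboundary (zigzag_theta_null zz qc).
pose z j := sval (cid (ex j)); have zP j := svalP (cid (ex j)); rewrite -/(z _) in zP.
pose f j (c : k^o) := c *: z j.
have f1 j : f j 1 = z j by rewrite /f scale1r.
exists (\sum_(j < msize q) ya_class H (f j)).
  exists (msize q), f; split=> // [j|j _]; first by case: (zP j).
  by rewrite f1; case: (zP j).
suff -> : Phi (\sum_(j < msize q) ya_class H (f j)) = reynolds rV q by [].
transitivity (\sum_(j < msize q) reynolds rV (pihomog mdeg j q)).
  apply: (@phi_sum _ _ _ _ (sgen_odd rV) (sgen_sq rV) (sgen_anti rV) _ _ char0 H _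
    f (fun j => reynolds rV (pihomog mdeg j q))) => i; first by case: (zP i).
  by rewrite f1; case: (zP i).
rewrite [in RHS](pihomog_partitionE (leqnn (msize q))).
by rewrite -[RHS]/(lin (reynolds_linear rV) _) linear_sum.
Qed.

Lemma support_vanishing v h : ~ free_supermodule (line_restriction sM v) ->
  support_ideal theta H h -> point_ideal Phi v h.
Proof.
move=> nf [m [f [fc -> fb]]]; rewrite /point_ideal linear_sum raddf_sum big1 // => i _.
have [p fp] := cocycle_cls_exists (sgen_odd rV) (sgen_sq rV) (sgen_anti rV) (fc i).
transitivity p.@[pt v]; first by rewrite -(smash_phi_classE H char0 (fc i) fp).
apply/eqP/negPn/negP => pv.
have [s sh] := coboundary_point char0 htheta fp (fb i (ltn_ord i)) pv.
exact/nf/(free_of_homotopy char0 sh).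
Qed.

Lemma support_idealP v : (forall h, support_ideal theta H h -> point_ideal Phi v h) <->
  ~ free_supermodule (line_restriction sM v).
Proof.
split=> [hv /free_line_homotopy[s /support_nonvanishing[h hs]]|nf h].
  by rewrite (hv h hs) eqxx.
exact: support_vanishing.
Qed.
End SupportNonvanishing.

Theorem theorem3p2p3 (k : closedFieldType) (gT : finGroupType) (n : nat)
  (rV : mx_representation k [set: gT] n)
  (M : vectType k) (sM : supermodule (smash_superalgebra rV) M)
  (I : injective_resolution (trivial_supermodule (smash_counit rV)))
  (H : yoneda_algebra I)
  (L : injective_resolution (trivial_supermodule (exterior_counit k n)))
  (HL : yoneda_algebra L)
  (J : injective_resolution sM)
  (tau : forall i, I i -> L i) (theta : forall i, I i -> M -> J i) :
  [pchar k] =i pred0 ->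
  restriction_comparison tau ->
  tensor_comparison theta ->
  exists (kappa : {lrmorphism {mpoly k[n]} -> HL}) (Phi : {lrmorphism H -> {mpoly k[n]}}),
    [/\ canonical_iso kappa,
        restriction_iso tau kappa Phi,
        orbit_space_homeo rV Phi,
        forall v, in_Max (support_ideal theta H) (point_ideal Phi v) <->
                  ~ free_supermodule (line_restriction sM v)
      & forall K, in_Max (support_ideal theta H) K ->
          exists2 v, ~ free_supermodule (line_restriction sM v) &
            forall h, K h <-> point_ideal Phi v h].
Proof.
move=> char0 tau_res htheta.
exists (exterior_kappa HL char0), (smash_phi H char0); split.
- exact: exterior_canonical_iso.
- exact: smash_restriction_iso.
- exact: smash_orbit_space_homeo.
- by move=> v; rewrite in_Max_pointP; apply: support_idealP.
(* An ideal that is maximal over the support ideal is maximal in [H], hence a point ideal; the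
   radical condition with exponent 1 shows that it contains the support ideal. *)
- move=> K [idK rad K1 Kmax]; have [v Kv] := maximal_point char0 idK K1 Kmax.
  exists v => //; apply/(support_idealP H char0 htheta) => h hs.
  by apply/Kv/(rad h 1%N); rewrite expr1.
Qed.
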